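(* (i) For every $\varepsilon>0$ there exists $c=c(\varepsilon)>0$ such that for every $n$-vertex ordered graph $G$ with no induced monotone $P_7$, if $\varrho_5(\overline{G})>\varepsilon$, then $\overline{G}$ contains a copy of $K_2\big[\tfrac{cn}{\log n}\big]$. (ii) On the other hand, there exist a constant $\eta>0$ and, for all sufficiently large $n$, $n$-vertex ordered graphs $G_n$ with no induced monotone path $P_7$ such that $\varrho_4(\overline{G_n})\ge\eta$ and $\overline{G_n}$ has no biclique of size $n/e^{o(\sqrt{\log n/\log\log n})}$; that is, for every real function $\varphi$ with $\varphi(n)=o\big(\sqrt{\log n/\log\log n}\big)$, for all sufficiently large $n$ the graph $\overline{G_n}$ contains no copy of $K_2\big[n/e^{\varphi(n)}\big]$.
   Context: All graphs are finite and simple. An ordered graph is a graph with a total ordering $<$ on its vertex set. A monotone path $P_k$ is an ordered graph with vertices $v_1<v_2<\dots<v_k$ in which $v_i,v_j$ are adjacent if and only if $|i-j|=1$; an ordered graph $G$ has no induced monotone $P_k$ if there are no vertices $v_1<\dots<v_k$ of $G$ such that $v_iv_j\in E(G)$ if and only if $|i-j|=1$. $\overline{G}$ is the complement of $G$. $\varrho_r(G)$ is the number of copies of $K_r$ in $G$ divided by $\binom{|V(G)|}{r}$. $K_2[t]=K_{t,t}$ is the complete bipartite graph with parts of size $t$, also called a biclique of size $t$. Containing a copy means as a not necessarily induced subgraph. Floor signs are omitted: for non-integer $t$, read $\lfloor t\rfloor$. *)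

(* Defs.v *)
From HB Require Import structures.
From mathcomp Require Import all_boot all_order all_algebra.
From mathcomp Require Import all_classical all_reals all_analysis.

Set Implicit Arguments.
Unset Strict Implicit.
Unset Printing Implicit Defensive.

Import Order.TTheory GRing.Theory Num.Theory.
Import numFieldNormedType.Exports.

Local Open Scope ring_scope.

(* An ordered graph is an [sgraph V] whose vertex type [V] is a [finOrderType]. *)
Record sgraph (V : finType) := SGraph {
  adj :> rel V;
  adj_sym : symmetric adj;
  adj_irrefl : irreflexive adj }.

Section Complement.
Variables (V : finType) (G : sgraph V).

Definition compl_adj : rel V := fun x y => (x != y) && ~~ G x y.

Lemma compl_adj_sym : symmetric compl_adj.
Proof. by move=> x y; rewrite /compl_adj eq_sym adj_sym. Qed.

Lemma compl_adj_irrefl : irreflexive compl_adj.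
Proof. by move=> x; rewrite /compl_adj eqxx. Qed.

Definition compl : sgraph V := SGraph compl_adj_sym compl_adj_irrefl.

End Complement.

Section Biclique.
Variable t : nat.

(* The boolean component of a vertex says which of the two parts it is in. *)
Definition biclique_adj : rel (bool * 'I_t) := fun x y => x.1 != y.1.

Lemma biclique_adj_sym : symmetric biclique_adj.
Proof. by move=> x y; rewrite /biclique_adj eq_sym. Qed.

Lemma biclique_adj_irrefl : irreflexive biclique_adj.
Proof. by move=> x; rewrite /biclique_adj eqxx. Qed.

Definition biclique : sgraph (bool * 'I_t)%type :=
  SGraph biclique_adj_sym biclique_adj_irrefl.

End Biclique.

Definition contains_copy (V W : finType) (G : sgraph V) (H : sgraph W) : Prop :=
  exists f : W -> V, injective f /\ (forall x y, H x y -> G (f x) (f y)).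

Definition is_clique (V : finType) (G : sgraph V) (S : {set V}) : bool :=
  [forall x in S, forall y in S, (x != y) ==> G x y].

(* A copy of K_r in G is determined by its vertex set. When [r > #|V|] the
   denominator vanishes and the density is 0. *)
Definition clique_density (R : realType) (r : nat) (V : finType)
    (G : sgraph V) : R :=
  #|[set S : {set V} | (#|S| == r) && is_clique G S]|%:R / 'C(#|V|, r)%:R.

(* The disjunction says |i - j| = 1. *)
Definition has_induced_monotone_path (k : nat) (d : Order.disp_t)
    (V : finOrderType d) (G : sgraph V) : Prop :=
  exists v : 'I_k -> V,
    (forall i j : 'I_k, (i < j)%N -> (v i < v j)%O) /\
    (forall i j : 'I_k, G (v i) (v j) = (i.+1 == j :> nat) || (j.+1 == i :> nat)).

(* Main.v *)
(* Part (i). If the complement has no biclique of size [t = c n / log n], any two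
   [t]-sets span an edge. Count tuples of vertices with prescribed adjacencies.
   - Independent [k]-tuples cannot have positive density when [k] is huge. Order
     the parts and try to walk down from the top part to the next block of parts:
     either some part of the block receives many edges, and an induced path is
     prolonged, or the top part is sparse to the whole block and is set aside.
     Eight mutually sparse parts contain an induced monotone [P_7], grown by a
     Gyarfas path that stays in a component reaching the next part; finding such
     a component by repeated halving is what costs the factor [log n].
   - If independent [r+1]-tuples are rare but independent [r]-tuples are not, with
     [r >= 5], then nonadjacent pairs inside a class are rare, so that every class
     can be split into several parts; parts [a a | b b b | c c c | e e e | f]
     already force an induced monotone [P_7]. Hence independent 5-tuples are rare.

   Part (ii). A discrete analogue of the Bollobas-Erdos graph. Points of a product
   space of dimension [h ~ log n / log log n] are blown up into four consecutive
   cliques. Between blocks 0-1 and 2-3, vertices are joined when their labels are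
   close; between the other blocks, when their inner product is at most [rho]. If
   [a, b] and [c, d] are close then not all four inner products exceed [rho], and
   a monotone [P_7] would need such a quadruple because a clique meets it in at
   most two vertices. A Prekopa-Leindler inequality tensorizes to concentration:
   large sets of points are at distance [O (rho)], which excludes bicliques of size
   [n exp (- c sqrt h)]. Moments of order two and four show that inner products
   exceed [rho] with positive probability, and Cauchy-Schwarz yields the
   quadruples that form the independent 4-sets. *)

Require Import Defs.
From HB Require Import structures.
From mathcomp Require Import all_boot all_order all_algebra.
From mathcomp Require Import zify.
From Stdlib Require Import FunctionalExtensionality.

Set Implicit Arguments.
Unset Strict Implicit.
Unset Printing Implicit Defensive.

Import Order.POrderTheory Order.TotalTheory.

(** * Configurations with prescribed adjacencies *)

(** Every step turns an inverse density [D] into roughly [D ^ 2]. The number of parts is therefore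
    fixed before [D], while the sparsity [Gam] and the size bound [T] may depend on [D]. No
    regularity partition is used: a sparse pair of parts is read off from the candidate sets left by
    one well-chosen configuration of the other parts. Sparseness matters because a typical vertex
    then spoils only a small fraction of the parts used later. Elsewhere the lack of bicliques is
    used only between sets of linear size; the Gyarfas argument alone needs it at size [n / log n].
    In part (ii) the side of the grid equals the dimension [h]: each one-dimensional inequality
    loses a factor [1 + O (1 / h)], so the product loses only a constant, while with a fixed side
    this loss would be exponential in [h]. The price is a space of [h ^ (4 h)] points, the source of
    [log log n]. The threshold [rho] is at most half the standard deviation of an inner product, so
    it is exceeded with constant probability, but it is smaller than a typical distance by a factor
    of order [sqrt h], so close pairs are rare. *)

Section Configurations.
Variables (V : finType) (G : rel V).
Hypothesis Gsym : symmetric G.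

(* Labels [i], [j] prescribe adjacency: distinct vertices are to be adjacent if
   their labels agree and nonadjacent otherwise. *)
Definition ok (i j : nat) (x y : V) := (x != y) && (G x y == (i == j)).

Lemma ok_sym i j x y : ok i j x y = ok j i y x.
Proof. by rewrite /ok eq_sym Gsym [j == i]eq_sym. Qed.

Definition part := (nat * {set V})%type.
Definition env := nat -> {set V}.

Definition nb i j x := [set y | ok i j x y].
Definition upd (U : env) i x : env := fun j => U j :&: nb i j x.
Definition top : env := fun=> [set: V].

(** A configuration is remembered only through the environment that it leaves: [W j] is the set of
    vertices that can still be added with label [j]. The order of the choices is thereby forgotten,
    and sums over configurations are invariant under permutation of the parts. *)
Fixpoint confs (s : seq part) (U : env) : seq env :=
  if s is p :: s' then
    flatten [seq confs s' (upd U p.1 x) | x <- enum (p.2 :&: U p.1)]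
  else [:: U].

Definition Sum s U (F : env -> nat) := \sum_(W <- confs s U) F W.
(* [K s] counts the configurations taking one vertex from each part of [s].
   Densities are recorded by their inverses: [n ^ size s <= K s * D]. *)
Definition K s := Sum s top (fun=> 1).

Definition restr i x (s : seq part) := [seq (q.1, q.2 :&: nb i q.1 x) | q <- s].

Lemma Sum1 s U : Sum s U (fun=> 1) = size (confs s U).
Proof. exact: sum1_size. Qed.

Lemma Sum_nil U F : Sum [::] U F = F U.
Proof. by rewrite /Sum /= big_seq1. Qed.

Lemma Sum_cons p s U F :
  Sum (p :: s) U F = \sum_(x in p.2 :&: U p.1) Sum s (upd U p.1 x) F.
Proof. by rewrite /Sum /= big_flatten big_map big_enum. Qed.

Lemma upd_comm U i x j y : upd (upd U i x) j y = upd (upd U j y) i x.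
Proof. by apply: functional_extensionality => k; rewrite /upd setIAC. Qed.

Lemma eq_Sum s U F F' : F =1 F' -> Sum s U F = Sum s U F'.
Proof. by move=> e; apply: eq_bigr => W _; apply: e. Qed.

Lemma leq_Sum s U F F' : (forall W, F W <= F' W) -> Sum s U F <= Sum s U F'.
Proof. by move=> e; apply: leq_sum => W _; apply: e. Qed.

Lemma Sum_sum (I : finType) (P : pred I) s U (F : I -> env -> nat) :
  Sum s U (fun W => \sum_(i | P i) F i W) = \sum_(i | P i) Sum s U (F i).
Proof. by rewrite /Sum exchange_big. Qed.

Lemma Sum_mulr s U F c : Sum s U (fun W => F W * c) = Sum s U F * c.
Proof. by rewrite /Sum big_distrl. Qed.

Lemma Sum_swap p q s U F : Sum (p :: q :: s) U F = Sum (q :: p :: s) U F.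
Proof.
have E p' q' : Sum (p' :: q' :: s) U F =
   \sum_(x in p'.2 :&: U p'.1) \sum_(y in q'.2 :&: U q'.1 | ok p'.1 q'.1 x y)
      Sum s (upd (upd U p'.1 x) q'.1 y) F.
  rewrite Sum_cons; apply: eq_bigr => x xp; rewrite Sum_cons.
  by apply: eq_bigl => y; rewrite /upd /nb !inE andbA.
rewrite !E (exchange_big_dep (fun y => y \in q.2 :&: U q.1)) /=; last first.
  by move=> x y _ /andP[].
apply: eq_bigr => y yq; apply: eq_big => [x|x _]; last by rewrite upd_comm.
by rewrite yq /= ok_sym.
Qed.

(** Choosing the vertex of [p] last expresses a count through the candidate sets [W p.1] left by the
    other parts; densities of tuples become sizes of such sets. *)
Lemma Sum_push p s U F :
  Sum (p :: s) U F = Sum s U (fun W => \sum_(x in p.2 :&: W p.1) F (upd W p.1 x)).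
Proof.
elim: s U F => [|q s IH] U F.
  rewrite Sum_cons Sum_nil; apply: eq_bigr => x _; exact: Sum_nil.
by rewrite Sum_swap !Sum_cons; apply: eq_bigr => x xq; rewrite IH.
Qed.

Lemma Sum_perm s s' U F : perm_eq s s' -> Sum s U F = Sum s' U F.
Proof.
have cat s1 p s2 W : Sum (s1 ++ p :: s2) W F = Sum (p :: s1 ++ s2) W F.
  elim: s1 W => [|q s1 IH] W //=.
  by rewrite Sum_swap !(Sum_cons q); apply: eq_bigr => x _; apply: IH.
elim: s s' U => [|p s IH] s' U; first by rewrite perm_sym => /perm_nilP ->.
move=> pe; have ps' : p \in s' by rewrite -(perm_mem pe) mem_head.
case/splitPr: ps' pe => s1 s2 pe; rewrite cat.
have {}pe : perm_eq s (s1 ++ s2).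
  by rewrite -(perm_cons p) (permPl pe) perm_catC /= perm_cons perm_catC.
by rewrite !Sum_cons; apply: eq_bigr => x _; apply: IH.
Qed.

(** Compatibility is symmetric, so making every part compatible with [x] amounts to keeping the
    configurations after which [x] is still a candidate. A vertex that has left an environment never
    returns. *)
Lemma Sum_restr i x s (U : env) F : x \in U i ->
  Sum (restr i x s) U F = Sum s U (fun W => (x \in W i) * F W).
Proof.
have sub0 s' (W : env) : x \notin W i -> Sum s' W (fun W => (x \in W i) * F W) = 0.
  elim: s' W => [|q s' IH] W xW; first by rewrite Sum_nil (negbTE xW).
  rewrite Sum_cons big1 // => y _; apply: IH.
  by rewrite /upd !inE (negbTE xW).
elim: s U => [|q s IH] U xU; first by rewrite !Sum_nil xU mul1n.
rewrite !Sum_cons /= [RHS](bigID (fun y => ok i q.1 x y)) /=.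
rewrite [X in _ + X]big1 ?addn0; last first.
  by move=> y /andP[_ yx]; apply: sub0; rewrite /upd /nb !inE xU ok_sym.
apply: eq_big => [y|y]; rewrite !inE => /=.
  by rewrite -andbA [ok i _ x y && _]andbC andbA.
by case/andP => /andP[_ yx] _; apply: IH; rewrite /upd /nb !inE xU ok_sym.
Qed.

Lemma K_cons p s : K (p :: s) = \sum_(x in p.2) K (restr p.1 x s).
Proof.
rewrite /K Sum_push /=.
under eq_bigr => x _ do rewrite Sum_restr ?inE //.
rewrite -Sum_sum; apply: eq_Sum => W; rewrite big_mkcond [RHS]big_mkcond /=.
by apply: eq_bigr => x _; rewrite inE muln1; case: (x \in p.2); case: (x \in W _).
Qed.

Lemma K_push p s : K (p :: s) = Sum s top (fun W => #|p.2 :&: W p.1|).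
Proof.
by rewrite /K Sum_push; apply: eq_Sum => W; rewrite sum1_card.
Qed.

Lemma K_perm s s' : perm_eq s s' -> K s = K s'.
Proof. exact: Sum_perm. Qed.

Lemma K_push2 p q s : K (p :: q :: s) =
  Sum s top (fun W => \sum_(x in p.2 :&: W p.1) \sum_(y in q.2 :&: W q.1) ok p.1 q.1 x y).
Proof.
rewrite K_push Sum_push; apply: eq_Sum => W.
rewrite [RHS]exchange_big /=; apply: eq_bigr => y _.
rewrite -sum1_card big_mkcond [RHS]big_mkcond /=; apply: eq_bigr => x _.
by rewrite /upd /nb !inE ok_sym; case: (x \in p.2); case: (x \in W _) => //; case: (ok _ _ _ _).
Qed.

Lemma Sum1_le s U : Sum s U (fun=> 1) <= #|V| ^ size s.
Proof.
elim: s U => [|p s IH] U; first by rewrite Sum_nil.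
rewrite Sum_cons /= expnS; apply: (@leq_trans (\sum_(x in p.2 :&: U p.1) #|V| ^ size s)).
  by apply: leq_sum => x _; apply: IH.
by rewrite sum_nat_const leq_mul2r max_card orbT.
Qed.

Definition sube (U W : env) := forall i, U i \subset W i.
Definition refines (s' s : seq part) :=
  all2 (fun q' q : part => (q'.1 == q.1) && (q'.2 \subset q.2)) s' s.

Lemma sube_upd U W i x : sube U W -> sube (upd U i x) (upd W i x).
Proof. by move=> UW j; apply: setSI; apply: UW. Qed.

Lemma upd_sube U i x : sube (upd U i x) U.
Proof. by move=> j; apply: subsetIl. Qed.

Lemma leq_sum_sub (A B : {set V}) (f g : V -> nat) :
  A \subset B -> (forall x, x \in A -> f x <= g x) ->
  \sum_(x in A) f x <= \sum_(x in B) g x.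
Proof.
move=> AB fg; rewrite big_mkcond [leqRHS]big_mkcond /=; apply: leq_sum => x _.
case: ifPn => // xA; rewrite (subsetP AB) //; exact: fg.
Qed.

Lemma Sum_mono s' s U' U F' F : refines s' s -> sube U' U ->
  (forall W' W, sube W' W -> F' W' <= F W) -> Sum s' U' F' <= Sum s U F.
Proof.
move=> + + FF; elim: s' s U' U => [|q' s' IH] [|q s] U' U //=.
  by rewrite !Sum_nil => _; apply: FF.
case/andP=> /andP[/eqP e sq] rs UU; rewrite !Sum_cons e.
apply: leq_sum_sub => [|x _]; first by apply: setISS.
by apply: IH => //; apply: sube_upd.
Qed.

(** A deleted part offers at most [#|V|] choices, and each of them only shrinks the environment,
    which a monotone [F] tolerates. *)
Lemma Sum_drop s1 s2 U F : (forall W' W, sube W' W -> F W' <= F W) ->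
  Sum (s1 ++ s2) U F <= #|V| ^ size s1 * Sum s2 U F.
Proof.
move=> FF; elim: s1 => [|p s1 IH] /=; first by rewrite mul1n.
rewrite expnS -mulnA; apply: leq_trans (leq_mul (leqnn _) IH).
rewrite Sum_push mulnC -Sum_mulr; apply: leq_Sum => W.
apply: (@leq_trans (\sum_(x in p.2 :&: W p.1) F W)).
  by apply: leq_sum => x _; apply: FF; apply: upd_sube.
by rewrite sum_nat_const mulnC leq_mul2l max_card orbT.
Qed.

Lemma K_drop s1 s2 : K (s1 ++ s2) <= #|V| ^ size s1 * K s2.
Proof. exact: Sum_drop. Qed.

Lemma restr_refines i x s : refines (restr i x s) s.
Proof. by elim: s => //= q s ->; rewrite eqxx subsetIl. Qed.

Lemma refines_refl s : refines s s.
Proof. by elim: s => //= q s ->; rewrite eqxx subxx. Qed.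

Lemma refines_trans s2 s1 s3 : refines s1 s2 -> refines s2 s3 -> refines s1 s3.
Proof.
elim: s1 s2 s3 => [|p1 s1 IH] [|p2 s2] [|p3 s3] //=.
move=> /andP[/andP[/eqP -> p12] s12] /andP[/andP[/eqP -> p23] s23].
by rewrite eqxx (subset_trans p12 p23) (IH _ _ s12 s23).
Qed.

Lemma refines_size s s' : refines s' s -> size s' = size s.
Proof. by rewrite /refines all2E => /andP[/eqP]. Qed.

Lemma refines_cat s1' s1 s2' s2 :
  refines s1' s1 -> refines s2' s2 -> refines (s1' ++ s2') (s1 ++ s2).
Proof. by elim: s1' s1 => [|q' s' IH] [|q s] //= /andP[-> /=]; apply: IH. Qed.

Lemma refines_labels s' s : refines s' s -> map fst s' = map fst s.
Proof.
by elim: s' s => [|q' s' IH] [|q s] //= /andP[/andP[/eqP -> _] /IH ->].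
Qed.

Lemma size_restr i x s : size (restr i x s) = size s.
Proof. by rewrite size_map. Qed.

End Configurations.
Arguments top {V}.

(** * Dense and sparse pairs, and averaging *)

Lemma cauchy_nat (I : finType) (a : I -> nat) :
  (\sum_i a i) ^ 2 <= #|I| * \sum_i a i ^ 2.
Proof.
have E : 2 * (\sum_i a i) ^ 2 = \sum_i \sum_j 2 * (a i * a j).
  rewrite -mulnn big_distrl big_distrr /=; apply: eq_bigr => i _.
  by rewrite !big_distrr /=; apply: eq_bigr.
rewrite -(leq_pmul2l (ltn0Sn 1)) E.
apply: (@leq_trans (\sum_i \sum_j (a i ^ 2 + a j ^ 2))).
  by apply: leq_sum => i _; apply: leq_sum => j _; apply: nat_Cauchy.
under eq_bigr => i _ do rewrite big_split sum_nat_const /=.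
by rewrite big_split /= -big_distrr /= sum_nat_const mul2n addnn.
Qed.

Section Pairs.
Variable V : finType.
Implicit Types (A B : {set V}) (r : rel V).

Definition npairs r A B := \sum_(z : V * V) [&& z.1 \in A, z.2 \in B & r z.1 z.2].

Lemma npairsE r A B : npairs r A B = \sum_(x in A) \sum_(y in B) r x y.
Proof.
rewrite /npairs (eq_bigr (fun z : V * V => [&& (z.1, z.2).1 \in A, (z.1, z.2).2 \in B & r (z.1, z.2).1 (z.1, z.2).2] : nat)); last by case.
rewrite -(pair_bigA _ (fun x y => [&& x \in A, y \in B & r x y] : nat)) /=.
rewrite [RHS]big_mkcond /=; apply: eq_bigr => x _; case: ifP => _ /=.
  by rewrite [RHS]big_mkcond; apply: eq_bigr => y _; case: (y \in B).
by rewrite big1.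
Qed.

Lemma npairsS r A' A B' B : A' \subset A -> B' \subset B -> npairs r A' B' <= npairs r A B.
Proof.
move=> AA BB; apply: leq_sum => z _; case: and3P => // -[z1 z2 z3].
by rewrite (subsetP AA) // (subsetP BB) // z3.
Qed.

Lemma npairs_max r A B : npairs r A B <= #|V| ^ 2.
Proof.
apply: (@leq_trans (\sum_(z : V * V) 1)); first by apply: leq_sum => z _; case: (_ && _).
by rewrite sum1_card card_prod mulnn.
Qed.

(* The only analytic input is the Cauchy-Schwarz bound
   [T1 ^ 2 <= n ^ 2 * sum_(l, l') npairs r (l :&: l')]. *)
Lemma dense_or_sparse r (L : seq ({set V} * {set V})) w D Gam :
  size L <= w -> 0 < w -> 0 < #|V| -> 0 < Gam ->
  #|V| ^ 2 * w <= (\sum_(l <- L) npairs r l.1 l.2) * D ->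
     (#|V| ^ 2 * w <= (\sum_(l <- L) npairs (fun x y => ~~ r x y) l.1 l.2) * (2 * Gam * D ^ 2))
  \/ (exists2 l, l \in L & npairs (fun x y => ~~ r x y) l.1 l.2 * Gam <= #|V| ^ 2 /\
       #|V| ^ 2 * w <= (\sum_(l' <- L) npairs r (l.1 :&: l'.1) (l.2 :&: l'.2)) * (2 * D ^ 2)).
Proof.
set n := #|V|; set T1 := \sum_(l <- L) _; set T2 := \sum_(l <- L) npairs (fun x y => ~~ _) _ _.
move=> Lw w0 n0 G0 HT1.
pose S2 l := \sum_(l' <- L) npairs r (l.1 :&: l'.1) (l.2 :&: l'.2).
have CS : T1 ^ 2 <= n ^ 2 * \sum_(l <- L) S2 l.
  pose c (z : V * V) := \sum_(l <- L) [&& z.1 \in l.1, z.2 \in l.2 & r z.1 z.2].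
  have -> : T1 = \sum_z c z by rewrite /T1 /c exchange_big.
  have -> : \sum_(l <- L) S2 l = \sum_z c z ^ 2.
    rewrite /S2 /c; under eq_bigr => l _ do rewrite exchange_big /=.
    rewrite exchange_big /=; apply: eq_bigr => z _.
    rewrite -mulnn big_distrl /=; apply: eq_bigr => l _.
    rewrite big_distrr /=; apply: eq_bigr => l' _; rewrite !inE.
    by case: (z.1 \in l.1); case: (z.2 \in l.2); case: (r z.1 z.2) => //=;
       rewrite ?andbF ?mul1n.
  by apply: leq_trans (cauchy_nat c) _; rewrite card_prod mulnn.
have HS : n ^ 2 * w ^ 2 <= (\sum_(l <- L) S2 l) * D ^ 2.
  rewrite -(@leq_pmul2l (n ^ 2)) ?expn_gt0 ?n0 //.
  apply: (@leq_trans ((T1 * D) ^ 2)); first by rewrite mulnA mulnn -expnMn leq_exp2r.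
  by rewrite expnMn mulnA leq_mul2r CS orbT.
case: (leqP (n ^ 2 * w) (T2 * (2 * Gam * D ^ 2))) => [|T2s]; [by left | right].
have [/hasP[l lL /andP[l1 l2]]|/hasPn no] := boolP (has (fun l =>
  (npairs (fun x y => ~~ r x y) l.1 l.2 * Gam <= n ^ 2) && (n ^ 2 * w <= S2 l * (2 * D ^ 2))) L).
  by exists l.
exfalso.
have D0 : 0 < D.
  have : 0 < n ^ 2 * w by rewrite muln_gt0 expn_gt0 n0.
  by case: (D) HT1 => // ; rewrite muln0 leqNgt => /negbTE ->.
(* If [S2 l] is small, the first summand suffices. If [l] is not sparse, the trivial bound
   [S2 l <= n ^ 2 * w] is absorbed by its more than [n ^ 2 / Gam] pairs outside [r]. *)
have key l : l \in L -> S2 l * (2 * D ^ 2) <=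
   n ^ 2 * w + npairs (fun x y => ~~ r x y) l.1 l.2 * Gam * (w * (2 * D ^ 2)).
  move=> /no; rewrite negb_and -!ltnNge => /orP[h|h]; last by apply: leq_trans (ltnW h) (leq_addr _ _).
  apply: leq_trans (leq_addl _ _).
  rewrite [leqRHS]mulnA leq_mul2r; apply/orP; right.
  apply: leq_trans (leq_mul (ltnW h) (leqnn w)).
  apply: (@leq_trans (\sum_(l' <- L) n ^ 2)); first by apply: leq_sum => l' _; apply: npairs_max.
  by rewrite big_const_seq count_predT iter_addn_0 leq_mul2l Lw orbT.
have : (\sum_(l <- L) S2 l) * (2 * D ^ 2) <= n ^ 2 * w * w + T2 * Gam * (w * (2 * D ^ 2)).
  rewrite big_distrl /=; apply: (@leq_trans (\sum_(l <- L) (n ^ 2 * w + npairs (fun x y => ~~ r x y) l.1 l.2 * Gam * (w * (2 * D ^ 2))))).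
    by rewrite big_seq [leqRHS]big_seq; apply: leq_sum.
  rewrite big_split /= leq_add //.
    by rewrite big_const_seq count_predT iter_addn_0 leq_mul2l Lw orbT.
  by rewrite /T2 !big_distrl.
have := T2s; rewrite -(ltn_pmul2r w0).
set S := \sum_(l <- L) S2 l in HS *.
have -> : T2 * Gam * (w * (2 * D ^ 2)) = T2 * (2 * Gam * D ^ 2) * w by lia.
have -> : S * (2 * D ^ 2) = 2 * (S * D ^ 2) by lia.
have -> : n ^ 2 * w * w = n ^ 2 * w ^ 2 by lia.
move: HS; lia.
Qed.

End Pairs.

Lemma average (T : finType) (A : {set T}) (f : T -> nat) n c D :
  0 < c -> #|A| <= n -> 0 < n -> n * c <= (\sum_(x in A) f x) * D ->
  exists2 x, x \in A & c <= f x * D.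
Proof.
move=> c0 An n0 H.
have [/existsP[x /andP[xA xc]]|/existsPn no] := boolP [exists x, (x \in A) && (c <= f x * D)].
  by exists x.
exfalso; have : (\sum_(x in A) f x) * D <= n * c.-1.
  rewrite big_distrl /=; apply: (@leq_trans (\sum_(x in A) c.-1)).
    by apply: leq_sum => x xA; move: (no x); rewrite xA -ltnNge /=; lia.
  by rewrite sum_nat_const leq_mul2r An orbT.
by move=> H'; move: (leq_trans H H'); rewrite leq_pmul2l //; lia.
Qed.

(** Reverse Markov inequality: the elements outside the popular set carry at most half of the
    guaranteed sum, and each popular one contributes at most [c]. *)
Lemma average_popular (T : finType) (A : {set T}) (f : T -> nat) n c D :
  0 < c -> #|A| <= n -> n * c <= (\sum_(x in A) f x) * D ->
  (forall x, f x <= c) ->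
  n <= #|[set x in A | c <= f x * (2 * D)]| * (2 * D).
Proof.
move=> c0 An H fc; set B := [set x in A | _].
have BA : B \subset A by apply/subsetP => x; rewrite inE => /andP[].
rewrite (big_setID B) /= (setIidPr BA) in H.
have H1 : \sum_(x in B) f x <= #|B| * c by rewrite -sum_nat_const; apply: leq_sum.
have H2 : (\sum_(x in A :\: B) f x) * (2 * D) <= n * c.
  rewrite big_distrl /=; apply: (@leq_trans (\sum_(x in A :\: B) c)).
    apply: leq_sum => x; rewrite !inE negb_and => /andP[/orP[/negbTE ->//|]].
    by rewrite -ltnNge => /ltnW.
  rewrite sum_nat_const leq_mul2r; apply/orP; right; apply: leq_trans An.
  by apply: subset_leq_card; apply: subsetDl.
rewrite -(leq_pmul2r c0).
have : n * c * 2 <= (\sum_(x in B) f x) * D * 2 + n * c.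
  by apply: (leq_trans (leq_mul H (leqnn 2))); move: H2; set S := \sum_(x in A :\: B) f x; lia.
have : (\sum_(x in B) f x) * D <= #|B| * c * D by rewrite leq_mul2r H1 orbT.
lia.
Qed.

Section Dense.
Variables (V : finType) (G : rel V).
Hypothesis Gsym : symmetric G.
Let n := #|V|.
Hypothesis n0 : 0 < n.
Notation ok := (ok G).
Notation restr := (restr G).
Notation K := (K G).
Notation Sum := (Sum G).

Definition bad i j : rel V := fun x y => ~~ ok i j x y.

Lemma pow0 k : 0 < n ^ k. Proof. by rewrite expn_gt0 n0. Qed.

Lemma setn (A : {set V}) : #|A| <= n. Proof. exact: max_card. Qed.

Lemma K_le s : K s <= n ^ size s. Proof. exact: Sum1_le. Qed.

Lemma K_pick p s D : n ^ (size s).+1 <= K (p :: s) * D ->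
  exists2 x, x \in p.2 & n ^ size s <= K (restr p.1 x s) * D.
Proof. by rewrite K_cons // expnS => /average; apply => //; [apply: pow0|apply: setn]. Qed.

Lemma K_popular p s D : n ^ (size s).+1 <= K (p :: s) * D ->
  n <= #|[set x in p.2 | n ^ size s <= K (restr p.1 x s) * (2 * D)]| * (2 * D).
Proof.
rewrite K_cons // expnS => H.
apply: (@average_popular _ _ (fun x => K (restr p.1 x s)) n) H _ => [||x]; [exact: pow0|exact: setn|].
by rewrite -(size_restr G p.1 x s) K_le.
Qed.

Lemma K_part p s : K (p :: s) <= #|p.2| * n ^ size s.
Proof.
rewrite K_cons // -sum_nat_const; apply: leq_sum => x _.
by rewrite -(size_restr G p.1 x s) K_le.
Qed.

Lemma K_part_size p s D : n ^ (size s).+1 <= K (p :: s) * D -> n <= #|p.2| * D.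
Proof.
move=> H; rewrite -(leq_pmul2r (pow0 (size s))) -expnS; apply: leq_trans H _.
by rewrite mulnAC leq_mul2r K_part orbT.
Qed.

Lemma mem_part_size p s D : p \in s -> n ^ size s <= K s * D -> n <= #|p.2| * D.
Proof.
move=> ps; rewrite (K_perm Gsym (perm_to_rem ps)) => H.
by apply: (@K_part_size p (rem p s)); rewrite size_rem // prednK //; case: (s) ps.
Qed.

(** A configuration destroyed by prescribing [x] contains a vertex that is bad for [x], and its
    other vertices have at most [n] choices each. Multiplying by [n] keeps the exponent [size s] in
    place of [size s - 1]. *)
Lemma K_loss i x s :
  K s * n <= K (restr i x s) * n +
   (\sum_(q <- s) #|q.2 :&: [set y | bad i q.1 x y]|) * n ^ size s.
Proof.
rewrite /K; elim: s top => [|q s IH] U.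
  by rewrite big_nil mul0n addn0 !Sum_nil.
rewrite big_cons !Sum_cons [X in X * n <= _](bigID (fun y => ok i q.1 x y)) /= mulnDl.
rewrite mulnDl [leqRHS]addnCA addnC; apply: leq_add.
  rewrite expnS mulnCA mulnC leq_mul2l; apply/orP; right.
  apply: (@leq_trans (\sum_(y in q.2 :&: [set y | bad i q.1 x y]) n ^ size s)); last first.
    by rewrite sum_nat_const.
  rewrite big_mkcond [leqRHS]big_mkcond /=; apply: leq_sum => y _.
  by rewrite !inE /bad; case: (y \in q.2); case: (y \in U _); case: (ok _ _ _ _) => //=;
     apply: Sum1_le.
set B := \sum_(q <- s) _.
apply: (@leq_trans (\sum_(y in q.2 :&: U q.1 | ok i q.1 x y)
   (Sum (restr i x s) (upd G U q.1 y) (fun=> 1) * n + B * n ^ size s))).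
  by rewrite big_distrl; apply: leq_sum => y _; apply: IH.
rewrite big_split /= -big_distrl /= leq_add //.
  rewrite leq_mul2r; apply/orP; right; rewrite big_mkcond [leqRHS]big_mkcond /=.
  by apply: leq_sum => y _; rewrite !inE; case: (y \in q.2); case: (y \in U _); case: (ok _ _ _ _).
rewrite sum_nat_cond_const expnS mulnCA leq_mul2l; apply/orP; right.
by rewrite leq_mul2r; apply/orP; right; apply: max_card.
Qed.

(** [dense_or_sparse] is applied to the pairs of candidate sets left by the configurations of [s].
    In the sparse alternative [P'] and [Q'] are the candidate sets of a single configuration, and
    the intersections coming from Cauchy-Schwarz are just the counts for these smaller parts. *)
Lemma dense_sparse i P j Q s D Gam : 0 < Gam ->
  n ^ (size s).+2 <= K ((i, P) :: (j, Q) :: s) * D ->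
  n ^ (size s).+2 <= Sum s top (fun W => npairs (bad i j) (P :&: W i) (Q :&: W j)) * (2 * Gam * D ^ 2)
  \/ exists (P' Q' : {set V}), [/\ P' \subset P, Q' \subset Q, npairs (bad i j) P' Q' * Gam <= n ^ 2 &
        n ^ (size s).+2 <= K ((i, P') :: (j, Q') :: s) * (2 * D ^ 2)].
Proof.
move=> G0 H; pose L := [seq (P :&: W i, Q :&: W j) | W <- confs G s top].
have Kn (P' Q' : {set V}) : K ((i, P') :: (j, Q') :: s) =
    Sum s top (fun W => npairs (ok i j) (P' :&: W i) (Q' :&: W j)).
  by rewrite K_push2 //; apply: eq_Sum => W; rewrite npairsE.
have ES (F : {set V} * {set V} -> nat) :
  \sum_(l <- L) F l = Sum s top (fun W => F (P :&: W i, Q :&: W j)).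
  by rewrite /L big_map.
have memL l : l \in L -> exists W, l = (P :&: W i, Q :&: W j).
  rewrite /L; elim: (confs G s top) => //= W c IH; rewrite inE => /predU1P[->|/IH //].
  by exists W.
have Ls : size L <= n ^ size s.
  rewrite /L size_map; apply: leq_trans (Sum1_le G s top).
  by rewrite Sum1.
have e2 : n ^ (size s).+2 = n ^ 2 * n ^ size s by rewrite -expnD.
rewrite e2 in H *.
have := @dense_or_sparse V (ok i j) L (n ^ size s) D Gam Ls (pow0 _) n0 G0.
rewrite !ES -Kn => /(_ H)[|[l /memL[W ->] /= [l1 l2]]]; first by left.
right; exists (P :&: W i), (Q :&: W j); rewrite !subsetIl; split=> //.
have e (A B C : {set V}) : A :&: B :&: (A :&: C) = A :&: B :&: C by rewrite setIACA setIid setIA.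
by move: l2; rewrite ES Kn; under eq_Sum => W' do rewrite !e.
Qed.

Lemma dense_vertex i P j Q s D :
  n ^ (size s).+2 <= Sum s top (fun W => npairs (bad i j) (P :&: W i) (Q :&: W j)) * D ->
  exists2 y, y \in Q &
    n ^ (size s).+1 <= K ((i, P :&: [set x | bad i j x y]) :: restr j y s) * D.
Proof.
have -> : Sum s top (fun W => npairs (bad i j) (P :&: W i) (Q :&: W j)) =
   \sum_(y in Q) K ((i, P :&: [set x | bad i j x y]) :: restr j y s).
  under [RHS]eq_bigr => y _ do rewrite K_push // Sum_restr ?inE //.
  rewrite -Sum_sum; apply: eq_Sum => W; rewrite npairsE exchange_big /=.
  rewrite big_mkcond [RHS]big_mkcond /=; apply: eq_bigr => y _.
  rewrite inE; case: (y \in Q) => //=; case: (y \in W j) => //=; rewrite mul1n -sum1_card.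
  rewrite big_mkcond [RHS]big_mkcond /=; apply: eq_bigr => x _.
  by rewrite !inE; case: (x \in P) => //; case: (x \in W i) => //=; case: (bad _ _ _ _).
rewrite expnS => /average; apply => //; [exact: pow0|exact: setn].
Qed.

Lemma dense_pair i P j Q s D :
  n ^ (size s).+2 <= Sum s top (fun W => npairs (bad i j) (P :&: W i) (Q :&: W j)) * D ->
  exists x y, [/\ x \in P, y \in Q, bad i j x y &
    n ^ size s <= K (restr i x (restr j y s)) * D].
Proof.
move/dense_vertex => [y yQ]; rewrite -(size_restr G j y s) => /K_pick[x /=].
by rewrite !inE => /andP[xP xy] H; exists x, y.
Qed.

End Dense.

(** The inverse density after one use of [dense_sparse]. *)
Definition Dsq D := 2 * D ^ 2.
Lemma Dsq_ge D : D <= Dsq D.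
Proof. by rewrite /Dsq; nia. Qed.
Lemma Dsq_iter_ge k D : D <= iter k Dsq D.
Proof. by elim: k => //= k IH; apply: leq_trans IH (Dsq_ge _). Qed.
Lemma Dsq_iterS k D : iter k Dsq (Dsq D) = iter k.+1 Dsq D.
Proof. by rewrite iterSr. Qed.

Ltac perm_tac := apply/permP => ?; rewrite /= ?count_cat /= ?count_cat /=;
  repeat match goal with |- context [nat_of_bool ?b] => move: (nat_of_bool b) => ? end; clear; lia.

Section Head.
Variables (V : finType) (G : rel V).
Hypothesis Gsym : symmetric G.
Let n := #|V|.
Hypothesis n0 : 0 < n.
Notation K := (K G).
Notation Sum := (Sum G).
Notation bad := (bad G).

Definition sparse j (H : {set V}) Gam (s : seq (part V)) :=
  all (fun q : part V => npairs (bad q.1 j) q.2 H * Gam <= n ^ 2) s.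

Lemma sparseS j (H' H : {set V}) Gam' Gam s' s : H' \subset H -> Gam' <= Gam -> refines s' s ->
  sparse j H Gam s -> sparse j H' Gam' s'.
Proof.
move=> HH GG; elim: s' s => [|q' s' IH] [|q s] //= /andP[/andP[/eqP e qq] ss].
case/andP=> h /(IH _ ss) ->; rewrite andbT; apply: leq_trans h.
by rewrite e leq_mul // npairsS.
Qed.

(** The parts of [Bs] are tested against the head one at a time. A pair once sparse stays sparse
    when the head shrinks further, and treated parts wait in [s]; the first dense alternative ends
    the process. *)
Lemma head_sparsify Bs s j H D Gam : 0 < Gam ->
  n ^ (size Bs + size s).+1 <= K ((j, H) :: Bs ++ s) * D ->
  (exists (H' : {set V}) (Bs' : seq (part V)), [/\ H' \subset H, refines Bs' Bs, sparse j H' Gam Bs' &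
     n ^ (size Bs + size s).+1 <= K ((j, H') :: Bs' ++ s) * iter (size Bs) Dsq D])
  \/ (exists (B1 : seq (part V)) q B2 (H' : {set V}), [/\ refines (B1 ++ q :: B2) Bs, H' \subset H &
     n ^ (size Bs + size s).+1 <= Sum (B1 ++ B2 ++ s) top
        (fun W => npairs (bad q.1 j) (q.2 :&: W q.1) (H' :&: W j)) *
        (2 * Gam * iter (size Bs) Dsq D ^ 2)]).
Proof.
move=> G0; elim: Bs s H D => [|q Bs IH] s H D /=.
  by rewrite add0n => h; left; exists H, [::]; rewrite subxx.
have szE : (size Bs).+1 + size s = (size (Bs ++ s)).+1 by rewrite size_cat.
rewrite !szE => h; case: (@dense_sparse V G Gsym n0 q.1 q.2 j H (Bs ++ s) D Gam G0).
- apply: leq_trans h _; rewrite leq_mul2r; apply/orP; right.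
  by rewrite (@K_perm _ _ Gsym _ ((q.1, q.2) :: (j, H) :: Bs ++ s)) // -surjective_pairing; perm_tac.
- move=> h'; right; exists [::], q, Bs, H; split=> //=; first by rewrite eqxx subxx refines_refl.
  apply: leq_trans h' _; rewrite leq_mul2l; apply/orP; right.
  rewrite leq_mul2l; apply/orP; right; rewrite leq_exp2r //.
  by apply: leq_trans (Dsq_ge _); apply: Dsq_iter_ge.
case=> P' [H1 [PP HH sp h1]].
case: (IH ((q.1, P') :: s) H1 (Dsq D)) => [|[H2 [Bs2 [H2s r2 sp2 h2]]]|].
- rewrite /= addnS -size_cat; apply: leq_trans h1 _; rewrite leq_mul2r; apply/orP; right.
  by rewrite (@K_perm _ _ Gsym _ ((j, H1) :: Bs ++ (q.1, P') :: s)) //; perm_tac.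
- left; exists H2, ((q.1, P') :: Bs2); split=> //=.
  + exact: subset_trans H2s HH.
  + by rewrite eqxx PP r2.
  + by rewrite sp2 andbT; apply: leq_trans sp; rewrite leq_mul2r npairsS // orbT.
  + move: h2; rewrite Dsq_iterS /= addnS -size_cat => h2; apply: leq_trans h2 _.
    rewrite leq_mul2r; apply/orP; right.
    by rewrite (@K_perm _ _ Gsym _ ((j, H2) :: (q.1, P') :: Bs2 ++ s)) //; perm_tac.
case=> B1 [q2 [B2 [H2 [r2 H2s h2]]]]; right; exists ((q.1, P') :: B1), q2, B2, H2; split=> //=.
- by rewrite eqxx PP r2.
- exact: subset_trans H2s HH.
move: h2; rewrite Dsq_iterS /= addnS -size_cat => h2; apply: leq_trans h2 _.
rewrite leq_mul2r; apply/orP; right.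
by rewrite (@Sum_perm _ _ Gsym _ ((q.1, P') :: B1 ++ B2 ++ s)) //; perm_tac.
Qed.

End Head.

(** * Parts ordered from bottom to top *)

Section Order.
Variables (d : Order.disp_t) (V : finOrderType d).
Implicit Types (A B : {set V}).

Definition before A B := [forall x in A, forall y in B, (x < y)%O].

Lemma beforeP A B : reflect (forall x y, x \in A -> y \in B -> (x < y)%O) (before A B).
Proof.
apply: (iffP forall_inP) => [h x y xA yB|h x xA]; first exact: (forall_inP (h x xA)).
by apply/forall_inP => y; apply: h.
Qed.

Lemma beforeS A' A B' B : A' \subset A -> B' \subset B -> before A B -> before A' B'.
Proof.
move=> /subsetP AA /subsetP BB /beforeP h; apply/beforeP => x y /AA xA /BB; exact: h.
Qed.

Definition ordl (s : seq (part V)) := pairwise (fun p q : part V => before p.2 q.2) s.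

Lemma ordl_refines s' s : refines s' s -> ordl s -> ordl s'.
Proof.
rewrite /ordl; elim: s' s => [|q' s' IH] [|q s] //= /andP[/andP[_ qq] ss] /andP[a /(IH _ ss) ->].
rewrite andbT; elim: s' s ss a {IH} => [|p' s' IH] [|p s] //= /andP[/andP[_ pp] ss] /andP[a /(IH _ ss) ->].
by rewrite andbT; apply: beforeS a.
Qed.

Lemma ordl_subseq s' s : subseq s' s -> ordl s -> ordl s'.
Proof. exact: subseq_pairwise. Qed.

Lemma ordl_cat s1 s2 : ordl (s1 ++ s2) =
  [&& allrel (fun p q : part V => before p.2 q.2) s1 s2, ordl s1 & ordl s2].
Proof. exact: pairwise_cat. Qed.

End Order.

(** * Gyarfas paths *)

Lemma card_setall (T : finType) (I : Type) (A : {set T}) (l : seq I) (P : I -> pred T) :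
  #|A| <= #|[set u in A | all (fun i => P i u) l]| + \sum_(i <- l) #|[set u in A | ~~ P i u]|.
Proof.
elim: l => [|i l IH].
  by rewrite big_nil addn0 subset_leq_card //; apply/subsetP => u uA; rewrite inE uA.
rewrite big_cons addnA; apply: leq_trans IH _; rewrite leq_add2r /=.
apply: leq_trans (leq_card_setU _ _); apply: subset_leq_card.
by apply/subsetP => u; rewrite !inE => /andP[-> ->]; rewrite andbT; case: (P i u).
Qed.

Section Gyarfas.
Variables (d : Order.disp_t) (V : finOrderType d) (G : rel V).
Hypothesis Gsym : symmetric G.
Let n := #|V|.
Implicit Types (A B U W X Y : {set V}) (p : seq V).

(** Paths are grown downwards, by consing a smaller vertex; by transitivity it is enough to compare
    consecutive vertices. *)
Fixpoint ipath p := if p is x :: p' then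
  [&& (if p' is y :: _ then (x < y)%O && G x y else true),
      all (fun z => ~~ G x z) (behead p') & ipath p'] else true.

Definition no_biclique t := forall A B, before A B -> t <= #|A| -> t <= #|B| ->
  exists a b, [/\ a \in A, b \in B & G a b].

Lemma split_top U c : c <= #|U| ->
  exists2 U1 : {set V}, U1 \subset U & #|U1| = c /\ before (U :\: U1) U1.
Proof.
elim: c => [|c IH] cU.
  by exists set0; rewrite ?sub0set ?cards0; split=> //; apply/beforeP => x y _; rewrite inE.
have [U1 U1U [U1c /beforeP b]] := IH (ltnW cU).
have /card_gt0P[x0 x0U] : 0 < #|U :\: U1| by rewrite cardsD (setIidPr U1U) U1c subn_gt0.
have [x xU xmax] := @Order.TotalTheory.arg_maxP _ _ _ x0 (fun x => x \in U :\: U1) id x0U.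
have /andP[xU1 xU'] : (x \notin U1) && (x \in U) by rewrite !inE in xU.
exists (x |: U1); first by rewrite subUset sub1set xU'.
rewrite cardsU1 xU1 U1c; split=> //; apply/beforeP => y z; rewrite !inE negb_or -andbA.
case/and3P => yx yU1 yU /predU1P[->|zU1]; last by apply: b => //; rewrite !inE yU1.
by rewrite Order.POrderTheory.lt_neqAle yx /=; apply: xmax; rewrite !inE yU1.
Qed.

Section Halving.
Variables (R : V -> {set V}) (t : nat).
Hypotheses (t0 : 0 < t) (NB : no_biclique t).
Definition cover W := \bigcup_(w in W) R w.
Definition rclosed U := forall w y z, y \in R w -> z \in U -> (z < y)%O -> G y z -> z \in R w.

Lemma coverP W y : reflect (exists2 w, w \in W & y \in R w) (y \in cover W).
Proof. exact: bigcupP. Qed.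

(** No edge joins an uncovered vertex of [U] to a covered vertex of [Y], since closure would cover
    its lower end. Without bicliques, fewer than [t] vertices of [U] are thus uncovered. *)
Lemma cover_spread W Y U : before U Y -> rclosed U -> t <= #|cover W :&: Y| ->
  #|U| < t + #|cover W :&: U|.
Proof.
move=> UY cl tY; rewrite -(cardsID (cover W)) setIC addnC ltn_add2r ltnNge; apply/negP => tU.
have /(NB (B := cover W :&: Y))[] // : before (U :\: cover W) (cover W :&: Y).
  by apply: beforeS UY; rewrite ?subsetDl ?subsetIr.
move=> z [y []]; rewrite !inE => /andP[/coverP zW zU] /andP[/coverP[w wW yw] yY].
rewrite Gsym => yz; case: zW; exists w => //; apply: (cl w y z) => //.
exact: (beforeP _ _ UY).
Qed.

(** Binary search for one [w]. Some half of [W] covers [t] of the [2 * t] vertices; spreading into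
    the top [3 * t] vertices of [U], it covers more than [3 * t - t] of them, which restores the
    invariant. Every halving uses up one such slice of [U]. *)
Lemma halving k W Y U : #|W| <= 2 ^ k -> 2 * t <= #|cover W :&: Y| -> before U Y ->
  3 * t * k <= #|U| -> rclosed U -> exists2 w, w \in W & 2 * t <= #|R w :&: (Y :|: U)|.
Proof.
elim: k W Y U => [|k IH] W Y U Wk tY UY tU cl.
  case: (set_0Vmem W) => [W0|[w wW]].
    by move: tY; rewrite W0 /cover big_set0 set0I cards0; lia.
  exists w => //; apply: leq_trans tY _; apply: subset_leq_card.
  apply/subsetP => y; rewrite !inE => /andP[/coverP[w' w'W yw'] ->].
  suff -> : w = w' by rewrite yw'.
  by have /card_le1_eqP := Wk; apply.
have [W1 W1W [W1c _]] := split_top (leq_div #|W| 2).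
have W2c : #|W :\: W1| <= 2 ^ k.
  by rewrite cardsD (setIidPr W1W) W1c; move: Wk; rewrite expnS; lia.
have {}W1c : #|W1| <= 2 ^ k by rewrite W1c; move: Wk; rewrite expnS; lia.
have [W' [W'W W'c tW']] : exists W', [/\ W' \subset W, #|W'| <= 2 ^ k & t <= #|cover W' :&: Y|].
  have : #|cover W :&: Y| <= #|cover W1 :&: Y| + #|cover (W :\: W1) :&: Y|.
    apply: leq_trans (leq_card_setU _ _); apply: subset_leq_card.
    apply/subsetP => y; rewrite !inE => /andP[/coverP[w wW yw] ->]; rewrite !andbT.
    by apply/orP; case wW1: (w \in W1); [left|right]; apply/coverP; exists w; rewrite // !inE wW1.
  case: (leqP t #|cover W1 :&: Y|) => [h _|h h2]; first by exists W1.
  by exists (W :\: W1); rewrite subsetDl; split=> //; lia.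
have [|U1 U1U [U1c U1b]] := @split_top U (3 * t); first by apply: leq_trans tU; rewrite mulnS leq_addr.
have := @cover_spread W' Y U1 (beforeS U1U (subxx _) UY) (fun w y z yw zU => cl w y z yw (subsetP U1U _ zU)) tW'.
rewrite U1c => h.
have [||||w wW' tw] := IH W' U1 (U :\: U1) W'c => //.
- lia.
- by rewrite cardsD (setIidPr U1U) U1c; move: tU; rewrite mulnS; lia.
- by move=> w y z yw; rewrite !inE => /andP[_ zU]; apply: cl zU.
exists w; first exact: (subsetP W'W).
apply: leq_trans tw _; apply: subset_leq_card; apply: setIS.
by rewrite subUset; apply/andP; split; apply: subset_trans (subsetUr _ _); rewrite ?subsetDl.
Qed.

(** One additional slice raises [t] covered vertices to [2 * t] and moves them from [Y] into [U], so
    that the final [w] reaches [U] itself. *)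
Lemma pick_reach k W Y U : #|W| <= 2 ^ k -> t <= #|Y| -> Y \subset cover W -> before U Y ->
  3 * t * k.+1 <= #|U| -> rclosed U -> exists2 w, w \in W & t <= #|R w :&: U|.
Proof.
move=> Wk tY YW UY tU cl.
have [|U1 U1U [U1c U1b]] := @split_top U (3 * t); first by apply: leq_trans tU; rewrite mulnS leq_addr.
have := @cover_spread W Y U1 (beforeS U1U (subxx _) UY) (fun w y z yw zU => cl w y z yw (subsetP U1U _ zU)).
rewrite U1c (setIidPr YW) => /(_ tY) h.
have [|||w wW tw] := @halving k W U1 (U :\: U1) Wk _ U1b.
- lia.
- by rewrite cardsD (setIidPr U1U) U1c; move: tU; rewrite mulnS; lia.
- by move=> w y z yw; rewrite !inE => /andP[_ zU]; apply: cl zU.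
exists w => //; apply: leq_trans (leq_trans _ tw) _; first by lia.
by apply: subset_leq_card; apply: setIS; rewrite subUset U1U subsetDl.
Qed.

End Halving.

Definition estep X : rel V := fun a b => [&& (b < a)%O, G a b & b \in X].
Definition reach X w := [set y | connect (estep X) w y].

Lemma reach_closed X U : U \subset X -> rclosed (reach X) U.
Proof.
move=> UX w y z; rewrite !inE => wy zU zy yz; apply: connect_trans wy (connect1 _).
by rewrite /estep zy yz (subsetP UX).
Qed.

(* The last neighbour of [v] on a decreasing path from [v] is a new starting
   point from which the rest of the path avoids the neighbourhood of [v]. *)
Lemma reach_restart X U v y : y \in reach X v -> y != v ->
  exists2 w, w \in [set w in X | (w < v)%O && G v w] &
             y \in reach ((X :\: [set z | G v z]) :|: U) w.
Proof.
rewrite inE => /connectP[s vs ->] {y}.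
suff : (last v s <= v)%O && ((last v s != v) ==>
   [exists w in [set w in X | (w < v)%O && G v w], last v s \in reach ((X :\: [set z | G v z]) :|: U) w]).
  by case/andP=> _ /implyP h /h /exists_inP.
elim/last_ind: s vs => [|s z IH] /=; first by rewrite Order.POrderTheory.lexx eqxx.
rewrite rcons_path last_rcons => /andP[/IH /andP[lev /implyP IHs] /and3P[zl lz zX]].
have zv := Order.POrderTheory.lt_le_trans zl lev.
rewrite (Order.POrderTheory.ltW zv); apply/implyP => _; apply/exists_inP.
have [vz|vz] := boolP (G v z).
  by exists z; rewrite !inE ?connect0 // zX zv.
have [lv|/IHs/exists_inP[w wX]] := eqVneq (last v s) v; first by move: vz; rewrite -lv lz.
rewrite !inE => wl; exists w => //; rewrite !inE; apply: connect_trans wl (connect1 _).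
by rewrite /estep zl lz !inE vz zX.
Qed.

End Gyarfas.

Lemma few_heavy (V : finType) (r : rel V) (A B : {set V}) E Gam : 0 < #|V| ->
  npairs r A B * Gam <= #|V| ^ 2 ->
  #|[set u in B | #|V| < #|[set z in A | r z u]| * E]| * Gam <= E * #|V|.
Proof.
move=> n0 h; set C := [set u in B | _].
have hC : #|C| * #|V| <= npairs r A B * E.
  rewrite npairsE exchange_big big_distrl /=.
  rewrite -sum_nat_const big_mkcond [leqRHS]big_mkcond /=; apply: leq_sum => u _.
  rewrite inE; case: (u \in B) => //=; case: ifP => // /ltnW uh; apply: leq_trans uh _.
  rewrite leq_mul2r; apply/orP; right; rewrite -sum1_card big_mkcond [leqRHS]big_mkcond /=.
  by apply: leq_sum => z _; rewrite inE; case: (z \in A) => //=; case: (r z u).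
rewrite -(leq_pmul2r n0) mulnAC -[E * _ * _]mulnA mulnn.
apply: (@leq_trans (npairs r A B * E * Gam)); first by rewrite leq_mul2r hC orbT.
by rewrite mulnAC [_ * E]mulnC leq_mul2l h orbT.
Qed.

Section GyarfasPath.
Variables (d : Order.disp_t) (V : finOrderType d) (G : rel V).
Hypothesis Gsym : symmetric G.
Let n := #|V|.
Variables (D Gam k t : nat).
Hypotheses (t0 : 0 < t) (NB : no_biclique G t) (n0 : 0 < n) (nk : n <= 2 ^ k).
Hypotheses (D0 : 0 < D) (tn : 12 * t * k.+1 * D <= n) (GD : 7 * 256 * D ^ 2 <= Gam).

Implicit Types (c W X Y : {set V}) (cs : seq {set V}) (p : seq V).

Let light (c : {set V}) : pred V := fun x => #|[set u in c | G u x]| * (16 * D) <= n.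

Let next p (c : {set V}) (cs : seq {set V}) :=
  [set u in [set u in c | all (fun x => ~~ G u x) p] | all (fun c' => light c' u) cs].

(** Each of the at most seven vertices of [p] excludes at most [n / (16 D)] vertices of [c], and
    [7 * 256 * D ^ 2 <= Gam] makes the vertices heavy towards some part of [cs] at most [n / (16 D)]
    in total. Half of [n / D] survives. *)
Lemma next_size p c cs : size p + size cs <= 7 -> n <= #|c| * D -> all (light c) p ->
  all (fun c' => npairs G c' c * Gam <= n ^ 2) cs -> n <= #|next p c cs| * (4 * D).
Proof.
move=> sz cD lp sp.
have h1 := card_setall c p (fun x u => ~~ G u x).
have h2 := card_setall [set u in c | all (fun x => ~~ G u x) p] cs (fun c' u => light c' u).
have b1 : (\sum_(x <- p) #|[set u in c | ~~ ~~ G u x]|) * (16 * D) <= size p * n.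
  rewrite big_distrl -sum1_size big_distrl /= big_seq [leqRHS]big_seq; apply: leq_sum => x xp.
  rewrite mul1n; apply: leq_trans (allP lp x xp); rewrite leq_mul2r; apply/orP; right.
  by apply: subset_leq_card; apply/subsetP => u; rewrite !inE negbK.
have b2 : (\sum_(c' <- cs) #|[set u in [set u in c | all (fun x => ~~ G u x) p] | ~~ light c' u]|) * Gam
   <= size cs * (16 * D * n).
  rewrite big_distrl -sum1_size big_distrl /= big_seq [leqRHS]big_seq; apply: leq_sum => c' c'cs.
  rewrite mul1n; have := few_heavy (16 * D) n0 (allP sp c' c'cs); apply: leq_trans.
  rewrite leq_mul2r; apply/orP; right; apply: subset_leq_card; apply/subsetP => u.
  by rewrite !inE /light -ltnNge => /andP[/andP[-> _] ->].
rewrite -/(next p c cs) in h2.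
move: h1 h2 b1 b2; set S1 := \sum_(x <- p) _; set S2 := \sum_(c' <- cs) _; set Z := #|[set u in c | _]|.
set N := #|next p c cs| => h1 h2 b1 b2.
have b3 : S2 * (16 * D) <= n.
  rewrite -(@leq_pmul2r (7 * 16 * D)); last by rewrite !muln_gt0.
  have : S2 * (7 * 256 * D ^ 2) <= size cs * (16 * D * n).
    by apply: leq_trans b2; rewrite leq_mul2l GD orbT.
  have : size cs * (16 * D * n) <= 7 * (16 * D * n) by rewrite leq_mul2r; apply/orP; right; lia.
  lia.
have b4 : S1 * (16 * D) <= 7 * n.
  by apply: leq_trans b1 _; rewrite leq_mul2r; apply/orP; right; lia.
have : #|c| <= N + S2 + S1 by lia.
move/(leq_mul (leqnn (16 * D))); lia.
Qed.

Lemma gyarfas_step W Y X p c cs : size p + size cs <= 7 -> n <= #|c| * D -> all (light c) p ->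
  all (fun c' => npairs G c' c * Gam <= n ^ 2) cs -> before c Y -> t <= #|Y| ->
  next p c cs \subset X -> Y \subset cover (reach G X) W ->
  exists2 w, w \in W & t <= #|reach G X w :&: next p c cs|.
Proof.
move=> sz cD lp sp cY tY UX YW.
have Uc : next p c cs \subset c by apply/subsetP => u; rewrite !inE => /andP[/andP[]].
apply: (@pick_reach d V G Gsym _ t t0 NB k W Y) => //.
- exact: leq_trans (max_card _) nk.
- exact: beforeS Uc (subxx _) cY.
- have := next_size sz cD lp sp; set N := #|next p c cs|.
  by move=> h; rewrite -(@leq_pmul2r (4 * D)) ?muln_gt0 //; apply: leq_trans h; lia.
- exact: reach_closed.
Qed.

Let decreasing (cs : seq {set V}) := pairwise (fun a b => before b a && (npairs G b a * Gam <= n ^ 2)) cs.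

(** Invariant: [v :: p] is the path so far, [X] consists of vertices nonadjacent to [p] through
    which it may continue, and [Y], lying above all parts of [cs], is still reachable from [v]
    inside [X]. Each part of [cs] is spent on one new vertex, a lower neighbour of [v] that need not
    lie in this part but from which [t] vertices of the part are reachable. *)
Lemma gyarfas_path cs p v X Y :
  size p + size cs <= 6 -> ipath G (v :: p) ->
  (forall x, x \in X -> all (fun z => ~~ G x z) p) ->
  Y \subset reach G X v -> v \notin Y -> t <= #|Y| -> all (fun c => before c Y) cs ->
  decreasing cs -> all (fun c => n <= #|c| * D) cs ->
  all (fun c => all (light c) (v :: p)) cs -> (forall x, x \in X -> all (fun c => light c x) cs) ->
  exists2 p', ipath G p' & size p' = (size p + size cs).+1.
Proof.
elim: cs p v X Y => [|c cs IH] p v X Y sz pp Xp Yv vY tY csY dcs cD lp lX.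
  by exists (v :: p); rewrite //= addn0.
move: dcs => /= /andP[ccs dcs]; move: csY cD lp => /= /andP[cY csY] /andP[cD csD] /andP[lc lp].
pose U := next (v :: p) c cs.
pose X' := (X :\: [set z | G v z]) :|: U.
pose W := [set w in X | (w < v)%O && G v w].
have UU u : u \in U -> [/\ u \in c, ~~ G u v, all (fun x => ~~ G u x) p & all (fun c' => light c' u) cs].
  by rewrite !inE => /andP[/andP[? /= /andP[? ?]] ?].
have [||||w wW tw] := @gyarfas_step W Y X' (v :: p) c cs _ cD lc _ cY tY.
- by rewrite /= addSnnS; apply: leq_trans sz _.
- by apply: sub_all ccs => c' /andP[].
- exact: subsetUr.
- apply/subsetP => y yY; apply/coverP.
  apply: reach_restart; first exact: (subsetP Yv).
  by apply: contraNneq vY => <-.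
have [wX wv vw] : [/\ w \in X, (w < v)%O & G v w] by move: wW; rewrite inE => /and3P[].
have [|||||||||||p' pp' sp'] := IH (v :: p) w X' (reach G X' w :&: U).
- by rewrite /= addSnnS.
- by rewrite /= wv Gsym vw Xp //; move: pp => /= ->.
- move=> x; rewrite in_setU => /orP[|/UU[_ xv xp _]] /=; last by rewrite xv.
  by rewrite !inE => /andP[vx xX]; rewrite Gsym vx Xp.
- exact: subsetIl.
- by rewrite in_setI negb_and; apply/orP; right; apply/negP => /UU[_]; rewrite Gsym vw.
- exact: tw.
- apply: sub_all ccs => c' /andP[b _]; apply: beforeS b => //.
  by apply/subsetP => u; rewrite in_setI => /andP[_ /UU[]].
- exact: dcs.
- exact: csD.
- apply/allP => c' c'cs /=; rewrite (allP (lX w wX)) ?inE ?c'cs ?orbT //=.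
  exact: (allP lp c' c'cs).
- move=> x; rewrite in_setU => /orP[|/UU[]] //; rewrite !inE => /andP[_ xX].
  by have /= /andP[] := lX x xX.
by exists p'; rewrite // sp' /= addSnnS.
Qed.

(** The top part supplies the candidates for the first vertex, the second one the set that this
    vertex reaches, and each of the other six one further vertex: [1 + 6 = 7]. *)
Lemma sparse_path cs : size cs = 8 -> decreasing cs -> all (fun c => n <= #|c| * D) cs ->
  exists2 p, ipath G p & size p = 7.
Proof.
case: cs => [|a [|c cs]] //= [sz] /and3P[/andP[/andP[ca _] acs] ccs dcs] /and3P[aD cD csD].
pose W := next [::] a cs; pose U := next [::] c cs.
have sp1 : all (fun c' => npairs G c' a * Gam <= n ^ 2) cs by apply: sub_all acs => x /andP[].
have sp2 : all (fun c' => npairs G c' c * Gam <= n ^ 2) cs by apply: sub_all ccs => x /andP[].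
have Wa : W \subset a by apply/subsetP => u; rewrite !inE => /andP[/andP[]].
have Uc : U \subset c by apply/subsetP => u; rewrite !inE => /andP[/andP[]].
have [||||w wW tw] := @gyarfas_step W W U [::] c cs _ cD isT sp2 (beforeS (subxx _) Wa ca).
- by rewrite /= sz.
- have : n <= #|W| * (4 * D) by apply: next_size; rewrite //= sz.
  rewrite -(@leq_pmul2r (4 * D) t) ?muln_gt0 //; apply: leq_trans.
  by apply: leq_trans tn; nia.
- by [].
- by apply/subsetP => w wW; apply/coverP; exists w => //; rewrite inE connect0.
have [|||||||||||p' pp' sp'] := @gyarfas_path cs [::] w U (reach G U w :&: U) => //.
- by rewrite sz.
- exact: subsetIl.
- rewrite inE negb_and; apply/orP; right; apply/negP => /(subsetP Uc) wc.
  by have := beforeP _ _ ca _ _ wc (subsetP Wa _ wW); rewrite Order.POrderTheory.ltxx.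
- apply: sub_all ccs => c' /andP[b _]; apply: beforeS b => //.
  exact: subset_trans (subsetIr _ _) Uc.
- by apply/allP => c' c'cs /=; move: wW; rewrite !inE => /andP[_ /allP ->].
- by move=> x; rewrite !inE => /andP[].
by exists p'; rewrite // sp' sz.
Qed.

End GyarfasPath.

(** * Bounding the number of classes *)

(** With [k] one more than the truncated logarithm, [#|V| <= 2 ^ k], and the factor [.+2] is the
    [k.+1] slices of [pick_reach]. [T] stands for a constant exceeding the inverse densities that
    occur. *)
Definition tame (d : Order.disp_t) (V : finOrderType d) (G : rel V) t T :=
  [/\ symmetric G, forall p, ipath G p -> size p <> 7, no_biclique G t, 0 < t &
      12 * t * ((trunc_log 2 #|V|).+2 * T) <= #|V|].

Lemma tame_mono (d : Order.disp_t) (V : finOrderType d) (G : rel V) t T' T :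
  T' <= T -> tame G t T -> tame G t T'.
Proof.
move=> TT [h1 h2 h3 h4 h5]; split=> //; apply: leq_trans h5.
by rewrite !leq_mul2l TT !orbT.
Qed.

Lemma tame_gt0 (d : Order.disp_t) (V : finOrderType d) (G : rel V) t T :
  0 < T -> tame G t T -> 0 < #|V|.
Proof. by move=> T0 [_ _ _ t0]; apply: leq_trans; rewrite !muln_gt0 t0 T0. Qed.

Lemma refines_mem (V : finType) (s' s : seq (part V)) q' : refines s' s -> q' \in s' ->
  exists2 q, q \in s & q.1 = q'.1 /\ q'.2 \subset q.2.
Proof.
elim: s' s => [|p' s' IH] [|p s] //= /andP[/andP[/eqP e pp] ss]; rewrite inE => /predU1P[->|].
  by exists p; rewrite ?mem_head.
by move/(IH _ ss) => [q qs h]; exists q; rewrite // inE qs orbT.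
Qed.

Lemma npairs_sub (V : finType) (r r' : rel V) A B :
  (forall x y, r x y -> r' x y) -> npairs r A B <= npairs r' A B.
Proof.
by move=> rr; apply: leq_sum => z _; case: and3P => // -[-> -> /rr ->].
Qed.

Lemma bad_edge (V : finType) (G : rel V) i j x y : i != j -> G x y -> bad G i j x y.
Proof. by move=> ij xy; rewrite /bad /ok xy eq_sym (negbTE ij) andbF. Qed.

Lemma bad_neq (V : finType) (G : rel V) i j x y : i != j -> x != y -> bad G i j x y -> G x y.
Proof. by move=> ij xy; rewrite /bad /ok xy (negbTE ij) /=; case: (G x y). Qed.

Lemma ok_nonadj (V : finType) (G : rel V) i j x y : i != j -> ok G i j x y -> ~~ G x y.
Proof. by move=> ij; rewrite /ok (negbTE ij) => /andP[_]; case: (G x y). Qed.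

Lemma pairwise_rev (T : Type) (r : T -> T -> bool) s :
  pairwise r (rev s) = pairwise (fun a b => r b a) s.
Proof. by elim: s => //= x s IH; rewrite rev_cons pairwise_rcons all_rev IH. Qed.

Section State.
Variables (d : Order.disp_t) (V : finOrderType d) (G : rel V).
Let n := #|V|.

Definition sparse_pairs Gam (C : seq (part V)) :=
  pairwise (fun a b : part V => npairs (bad G a.1 b.1) a.2 b.2 * Gam <= n ^ 2) C.

(** [p] is the path built so far, [H] holds the candidates for its next vertex, [C] the parts set
    aside above [H], and [pool] the parts below it. The pool is below [p] and nonadjacent to it, so
    any edge from [H] down into the pool prolongs the path. *)
Record state D Gam (p : seq V) (C : seq (part V)) (H : part V) pool := State {
  state_ordl : ordl (pool ++ H :: C);
  state_uniq : uniq (map fst (pool ++ H :: C));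
  state_dense : n ^ (size pool + size C).+1 <= K G (H :: pool ++ C) * D;
  state_sparse : sparse_pairs Gam C;
  state_sparse_pool : all (fun c => sparse G c.1 c.2 Gam (H :: pool)) C;
  state_head : forall v, v \in H.2 -> ipath G (v :: p);
  state_pool : forall q v, q \in pool -> v \in q.2 -> all (fun z => (v < z)%O && ~~ G v z) p }.

Lemma sparse_pairsS Gam' Gam C' C : Gam' <= Gam -> refines C' C ->
  sparse_pairs Gam C -> sparse_pairs Gam' C'.
Proof.
move=> GG; rewrite /sparse_pairs; elim: C' C => [|q' s' IH] [|q s] //= /andP[/andP[/eqP e qq] ss] /andP[a /(IH _ ss) ->].
rewrite andbT; elim: s' s ss a {IH} => [|p' s' IH] [|p s] //= /andP[/andP[/eqP e' pp] ss] /andP[a /(IH _ ss) ->].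
by rewrite andbT; apply: leq_trans a; rewrite leq_mul // e e' npairsS.
Qed.

Lemma sparse_poolS Gam' Gam C' C (s' s : seq (part V)) : Gam' <= Gam -> refines C' C ->
  (forall q', q' \in s' -> exists2 q, q \in s & q.1 = q'.1 /\ q'.2 \subset q.2) ->
  all (fun c => sparse G c.1 c.2 Gam s) C -> all (fun c => sparse G c.1 c.2 Gam' s') C'.
Proof.
move=> GG CC ss /allP h; apply/allP => c' /(refines_mem CC)[c cC [e cc]].
apply/allP => q' /ss[q qs [e' qq]].
by have := allP (h c cC) q qs; apply: leq_trans; rewrite -e -e' leq_mul // npairsS.
Qed.

End State.

(* [m] more mutually sparse parts or [j] more path vertices are needed. *)
Definition winning m j := exists k, forall D, exists Gam T, [/\ 0 < Gam, 0 < T &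
  forall (d : Order.disp_t) (V : finOrderType d) (G : rel V) t, tame G t T ->
  forall p C H pool, size C + m = 8 -> size p + j = 7 -> size pool = k ->
  ~ state G D Gam p C H pool].

Lemma winning0 j : winning 0 j.
Proof.
exists 0 => D; exists (7 * 256 * D.+1 ^ 2), D.+1; split; rewrite ?muln_gt0 ?expn_gt0 //.
move=> d V G t tm p C H pool sC _ /size0nil -> [/= oC uC dC sp _ _ _].
have n0 := tame_gt0 (ltn0Sn D) tm; case: tm => Gs nop nb t0 tn.
have [|||||q iq] := @sparse_path d V G Gs D.+1 (7 * 256 * D.+1 ^ 2) (trunc_log 2 #|V|).+1 t t0 nb n0 _ (ltn0Sn D) _ (leqnn _) (rev (map snd C)).
- by rewrite ltnW // trunc_log_ltn.
- by rewrite -mulnA.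
- by rewrite size_rev size_map -sC addn0.
- rewrite pairwise_rev pairwise_map; move: oC uC sp; rewrite /ordl /sparse_pairs /=.
  move=> /andP[_ +] /andP[_ +]; elim: (C) => //= c C' IH /andP[bc oC] /andP[uc uC] /andP[sc sp].
  rewrite IH // andbT; apply/allP => b bC /=; rewrite (allP bc) //=.
  apply: leq_trans (leq_mul _ (leqnn _)) (allP sc b bC); apply: npairs_sub => x y; apply: bad_edge.
  by apply: contraNneq uc => ->; apply: map_f.
- rewrite all_rev all_map; apply/allP => c cC /=.
  have : #|V| <= #|c.2| * D by apply: (mem_part_size Gs n0 _ dC); rewrite inE cC orbT.
  by move/leq_trans; apply; rewrite leq_mul2l leqnSn orbT.
exact: nop iq.
Qed.

(** The upper [k2 + 1] parts of the pool form the block. If the head becomes sparse to the whole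
    block, it joins the parts set aside and a new path is started inside the block. Otherwise an
    edge into one part of the block prolongs the path, and the lower [k1] parts are the new pool.
    Since [k1] and [k2] do not depend on [D], the decay of the density is harmless. *)
Lemma winning_step m j : winning m 7 -> winning m.+1 j -> winning m.+1 j.+1.
Proof.
case=> k2 W2 [k1 W1]; exists (k1 + k2.+1) => D.
pose D2 := iter k2.+1 Dsq D.
have [Gam2 [T2 [G20 T20 {}W2]]] := W2 D2.
pose D3 := 2 * Gam2 * D2 ^ 2.
have [Gam1 [T1 [G10 T10 {}W1]]] := W1 D3.
exists (maxn Gam1 Gam2), (maxn T1 T2); rewrite !leq_max G10 T10; split=> //.
move=> d V G t tm p C H pool sC sp spool [oC uC dC spC spl hd pl].
have n0 : 0 < #|V| by apply: (tame_gt0 _ tm); rewrite leq_max T10.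
have Gs : symmetric G by case: tm.
have poolE := cat_take_drop k1 pool; set low := take k1 pool in poolE; set blk := drop k1 pool in poolE.
have slow : size low = k1 by rewrite size_take spool; case: ltnP => //; lia.
have sblk : size blk = k2.+1 by rewrite size_drop spool; lia.
rewrite -poolE in oC uC dC spl pl.
have dC' : #|V| ^ (size blk + size (low ++ C)).+1 <= K G ((H.1, H.2) :: blk ++ low ++ C) * D.
  rewrite -surjective_pairing; have -> : size blk + size (low ++ C) = size (low ++ blk) + size C.
    by rewrite !size_cat; lia.
  by rewrite (@K_perm _ _ Gs _ (H :: (low ++ blk) ++ C)) //; perm_tac.
have := head_sparsify Gs n0 G20 dC'; rewrite sblk -/D2 -/D3.
case=> [[H' [Bs [HH rB sB dB]]]|[B1 [q [B2 [H' [rB HH dB]]]]]].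
- have szB := refines_size rB; rewrite sblk in szB.
  case/lastP: Bs szB rB sB dB => // b h; rewrite size_rcons => -[szb] rB sB dB.
  apply: (W2 _ _ _ _ (tame_mono (leq_maxr _ _) tm) [::] ((H.1, H') :: C) h b) => //.
    by rewrite /= -sC addSnnS.
  have rL : refines (low ++ rcons b h ++ (H.1, H') :: C) ((low ++ blk) ++ H :: C).
    by rewrite -catA; apply: refines_cat (refines_refl _) (refines_cat rB _); rewrite /= eqxx HH refines_refl.
  have sL : subseq (b ++ h :: (H.1, H') :: C) (low ++ rcons b h ++ (H.1, H') :: C).
    by rewrite cat_rcons; apply: suffix_subseq.
  split.
  + exact: ordl_subseq sL (ordl_refines rL oC).
  + by apply: (subseq_uniq (map_subseq fst sL)); rewrite (refines_labels rL).
  + have := K_drop Gs low (h :: b ++ (H.1, H') :: C); rewrite slow.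
    set X := K G _ => h1.
    have h2 : K G ((H.1, H') :: rcons b h ++ low ++ C) = X.
      apply: K_perm => //; rewrite -cats1; perm_tac.
    rewrite h2 in dB.
    rewrite -(@leq_pmul2l (#|V| ^ k1)) ?expn_gt0 ?n0 // mulnA.
    apply: leq_trans (leq_mul h1 (leqnn _)); apply: leq_trans dB; rewrite -expnD.
    by rewrite leq_pexp2l //= szb size_cat slow !addSn !addnS addnCA.
  + rewrite /sparse_pairs /= -/(sparse_pairs _ _ _) (sparse_pairsS (leq_maxr _ _) (refines_refl C) spC) andbT.
    apply/allP => c /(allP spl) /= /andP[h0 _]; apply: leq_trans h0.
    by rewrite leq_mul ?leq_maxr // npairsS.
  + have -> : forall l, all (fun c => sparse G c.1 c.2 Gam2 (h :: b)) ((H.1, H') :: l) =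
        sparse G H.1 H' Gam2 (h :: b) && all (fun c => sparse G c.1 c.2 Gam2 (h :: b)) l by [].
    apply/andP; split; first by move: sB; rewrite /sparse all_rcons.
    apply: sparse_poolS (leq_maxr _ _) (refines_refl C) _ spl => q'; rewrite -mem_rcons.
    case/(refines_mem rB) => q qb e; exists q => //.
    by rewrite inE mem_cat qb !orbT.
  + by [].
  + by [].
- have szE : (k2.+1 + size (low ++ C)).+1 = (size (B1 ++ B2 ++ low ++ C)).+2.
    by move: (refines_size rB); rewrite !size_cat /= sblk; clear; lia.
  rewrite szE in dB; have [y yH' dy] := dense_vertex Gs n0 dB.
  set A := q.2 :&: _ in dy.
  have yH : y \in H.2 by exact: (subsetP HH).
  have rL : refines (low ++ (B1 ++ q :: B2) ++ H :: C) ((low ++ blk) ++ H :: C).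
    by rewrite -[(low ++ blk) ++ _]catA; apply: refines_cat (refines_refl _) (refines_cat rB (refines_refl _)).
  have sL : subseq (low ++ q :: C) (low ++ (B1 ++ q :: B2) ++ H :: C).
    rewrite cat_subseq // -catA; apply: (subseq_trans _ (suffix_subseq B1 _)).
    rewrite /= eqxx; apply: (subseq_trans _ (suffix_subseq B2 _)); exact: subseq_cons.
  have [q0 q0b [eq0 qq0]] : exists2 q0, q0 \in blk & q0.1 = q.1 /\ q.2 \subset q0.2.
    by apply: (refines_mem rB); rewrite mem_cat mem_head orbT.
  have beforeH c v : c \in low ++ blk -> v \in c.2 -> c.1 != H.1 /\ (v < y)%O.
    move=> cp vc; split.
      apply: contraTneq uC => e; rewrite map_cat cat_uniq /= -e.
      by rewrite map_f //= andbF.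
    move: oC; rewrite ordl_cat => /and3P[/allrelP /(_ c H cp (mem_head _ _)) b _ _].
    exact: (beforeP _ _ b).
  apply: (W1 _ _ _ _ (tame_mono (leq_maxl _ _) tm) (y :: p) (restr G H.1 y C) (q.1, A) (restr G H.1 y low)).
  + by rewrite size_restr.
  + by rewrite -sp /= addSnnS.
  + by rewrite size_restr.
  have rM : refines (restr G H.1 y low ++ (q.1, A) :: restr G H.1 y C) (low ++ q :: C).
    apply: refines_cat; first exact: restr_refines.
    by apply/andP; split; [rewrite eqxx subsetIl | exact: restr_refines].
  split.
  + exact: ordl_refines rM (ordl_subseq sL (ordl_refines rL oC)).
  + by rewrite (refines_labels rM); apply: (subseq_uniq (map_subseq fst sL)); rewrite (refines_labels rL).
  + have := K_drop Gs (restr G H.1 y (B1 ++ B2)) ((q.1, A) :: restr G H.1 y low ++ restr G H.1 y C).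
    set X := K G (_ :: _) => h1.
    have h2 : K G ((q.1, A) :: restr G H.1 y (B1 ++ B2 ++ low ++ C)) =
      K G (restr G H.1 y (B1 ++ B2) ++ (q.1, A) :: restr G H.1 y low ++ restr G H.1 y C).
      by apply: K_perm => //; rewrite /restr !map_cat; perm_tac.
    rewrite h2 in dy.
    rewrite -(@leq_pmul2l (#|V| ^ size (B1 ++ B2))) ?expn_gt0 ?n0 // mulnA.
    rewrite size_restr in h1.
    apply: leq_trans (leq_mul h1 (leqnn _)); apply: leq_trans dy; rewrite -expnD.
    by rewrite leq_pexp2l // !size_cat !size_restr; clear; lia.
  + exact: sparse_pairsS (leq_maxl _ _) (restr_refines _ _ _ _) spC.
  + apply: sparse_poolS (leq_maxl _ _) (restr_refines _ _ _ _) _ spl => q'; rewrite inE.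
    case/predU1P => [->|/(refines_mem (restr_refines _ _ _ _))[q1 q1l e]].
      exists q0; first by rewrite inE mem_cat q0b !orbT.
      by rewrite /=; split=> //; apply: subset_trans qq0; apply: subsetIl.
    by exists q1; rewrite // inE mem_cat q1l orbT.
  + move=> v; rewrite /= !inE => /andP[vq vy].
    have q0p : q0 \in low ++ blk by rewrite mem_cat q0b orbT.
    have [q0H vly] := beforeH q0 v q0p (subsetP qq0 _ vq); rewrite eq0 in q0H.
    rewrite vly (bad_neq q0H _ vy) //=; last by rewrite (lt_eqF vly).
    apply/andP; split; last exact: hd yH.
    by apply: sub_all (pl _ _ q0p (subsetP qq0 _ vq)) => z /andP[].
  + move=> q' v /mapP[q1 q1l ->] /=; rewrite !inE => /andP[vq1 oky].
    have q1p : q1 \in low ++ blk by rewrite mem_cat q1l.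
    have [q1H ->] := beforeH q1 v q1p vq1; rewrite ok_sym // in oky.
    rewrite (ok_nonadj q1H oky) /=; exact: pl q1p vq1.
Qed.

Lemma winning_all m j : winning m j.
Proof.
elim: m j => [|m IHm] j; first exact: winning0.
elim: j => [|j IHj]; last exact: winning_step (IHm 7) IHj.
exists 0 => D; exists 1, 1; split=> // d V G t tm p C H pool _; rewrite addn0 => sp _ st.
have n0 := tame_gt0 (ltn0Sn 0) tm; case: tm => Gs nop _ _ _.
have : #|V| <= #|H.2| * D.
  have := state_dense st; rewrite -size_cat => h.
  exact: (mem_part_size Gs n0 (mem_head H (pool ++ C)) h).
case: (set_0Vmem H.2) => [->|[v vH] _]; first by rewrite cards0 leqNgt n0.
have := state_head st vH; rewrite /= => /and3P[_ _ pp].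
exact: nop pp sp.
Qed.

Lemma many_parts : exists k, forall D, exists2 T, 0 < T &
  forall (d : Order.disp_t) (V : finOrderType d) (G : rel V) t, tame G t T ->
  forall s, ordl s -> uniq (map fst s) -> size s = k -> ~ (#|V| ^ k <= K G s * D).
Proof.
have [k W] := winning_all 8 7; exists k.+1 => D.
have [Gam [T [G0 T0 {}W]]] := W D; exists T => // d V G t tm s os us ss dK.
have Gs : symmetric G by case: tm.
case/lastP: s os us ss dK => // s h; rewrite size_rcons => os us [ss] dK.
apply: (W _ _ _ _ tm [::] [::] h s) => //; split=> //; rewrite ?cats1 //.
by rewrite /= cats0 addn0 ss (K_perm Gs (s' := rcons s h)) // perm_sym perm_rcons.
Qed.

(** * Separating two parts by a pivot *)

Section Separate.
Variables (d : Order.disp_t) (V : finOrderType d).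
Let n := #|V|.
Implicit Types (A B : {set V}).

Definition below v := [set x : V | (x < v)%O].

Lemma before_below v A B : before (A :&: below v) (B :\: below v).
Proof.
by apply/beforeP => x y; rewrite !inE -leNgt => /andP[_ xv] /andP[vy _]; apply: lt_le_trans vy.
Qed.

Let gap x y := #|[set v : V | (x < v <= y)%O]|.

Lemma few_close_above x c : 0 < c -> #|[set y | (x < y)%O && (gap x y * c < n)]| * c <= n.
Proof.
move=> c0; set Y := [set y | _].
case: (set_0Vmem Y) => [->|[y0 y0Y]]; first by rewrite cards0.
have [y yY ymax] := @arg_maxP _ _ _ y0 (fun y => y \in Y) id y0Y.
have : #|Y| <= gap x y.
  apply: subset_leq_card; apply/subsetP => z zY; have h := ymax z zY; move: zY.
  by rewrite !inE => /andP[-> _].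
by move=> h; move: yY; rewrite inE => /andP[_ /ltnW]; apply: leq_trans; rewrite leq_mul2r h orbT.
Qed.

Lemma few_close_below x c : 0 < c -> #|[set y | (y < x)%O && (gap y x * c < n)]| * c <= n.
Proof.
move=> c0; set Y := [set y | _].
case: (set_0Vmem Y) => [->|[y0 y0Y]]; first by rewrite cards0.
have [y yY ymin] := @arg_minP _ _ _ y0 (fun y => y \in Y) id y0Y.
have xY : x \notin Y :\ y by rewrite !inE ltxx /= andbF.
have : #|Y| <= gap y x.
  (* [gap y x] counts [x] but not [y], so [x] takes the place of [y] before the sets are
     compared. *)
  have -> : #|Y| = #|x |: (Y :\ y)| by rewrite cardsU1 xY (cardsD1 y Y) yY.
  apply: subset_leq_card; apply/subsetP => z; rewrite in_setU1 => /predU1P[->|].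
    by move: yY; rewrite !inE lexx andbT => /andP[].
  rewrite in_setD1 => /andP[zy zY]; have h := ymin z zY; move: zY.
  have yz : (y < z)%O by rewrite lt_neqAle eq_sym zy; exact: h.
  by rewrite !inE yz => /andP[/ltW].
by move=> h; move: yY; rewrite inE => /andP[_ /ltnW]; apply: leq_trans; rewrite leq_mul2r h orbT.
Qed.

(* Averaging over the pivot [v]: a pair at distance [g] is split by [g] pivots. *)
Lemma separate_weight (W : V -> V -> nat) c D A B : 0 < n -> 0 < c ->
  (forall x y, W x y <= c) -> (forall x, W x x = 0) ->
  n ^ 2 * c <= (\sum_(x in A) \sum_(y in B) W x y) * D ->
  exists v, n ^ 2 * c <= (\sum_(x in A :&: below v) \sum_(y in B :\: below v) W x y) * (16 * D ^ 2)
    \/ n ^ 2 * c <= (\sum_(x in A :\: below v) \sum_(y in B :&: below v) W x y) * (16 * D ^ 2).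
Proof.
move=> n0 c0 Wc W0 HN.
have D0 : 0 < D.
  have : 0 < n ^ 2 * c by rewrite muln_gt0 expn_gt0 n0.
  by case: (D) HN => //; rewrite muln0 leqNgt => /negbTE ->.
pose close x y := ((x < y)%O && (gap x y * (4 * D) < n)) || ((y < x)%O && (gap y x * (4 * D) < n)).
pose g x y := gap x y + gap y x.
(* Every [x] has at most [n / (4 D)] close vertices on either side, so close pairs carry at most
   half of the weight guaranteed by [HN]. *)
have Hclose : (\sum_(x in A) \sum_(y in B | close x y) W x y) * (2 * D) <= n ^ 2 * c.
  rewrite big_distrl /=; apply: (@leq_trans (\sum_(x in A) n * c)); last first.
    by rewrite sum_nat_const mulnA leq_mul2r -mulnn leq_mul2r max_card !orbT.
  apply: leq_sum => x _.
  apply: (@leq_trans (\sum_(y | close x y) c * (2 * D))).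
    rewrite big_distrl /= big_mkcond [leqRHS]big_mkcond /=; apply: leq_sum => y _.
    by case: (y \in B) => /=; case: (close x y) => //; rewrite leq_mul2r Wc orbT.
  rewrite sum_nat_cond_const.
  have := few_close_above x (c := 4 * D); have := few_close_below x (c := 4 * D).
  set a := #|_|; set b := #|_|; rewrite !muln_gt0 D0 => /(_ isT) ha /(_ isT) hb.
  have : #|[set y | close x y]| <= b + a.
    apply: leq_trans (leq_card_setU _ _); apply: subset_leq_card; apply/subsetP => y.
    by rewrite !inE.
  set e := #|_| => he.
  have : e * (2 * D) <= n by move: ha hb he; clear; nia.
  by clear => h; rewrite mulnCA [n * c]mulnC leq_mul2l h orbT.
have Hfar : n * (\sum_(x in A) \sum_(y in B | ~~ close x y) W x y) <=
    (\sum_(x in A) \sum_(y in B) W x y * g x y) * (4 * D).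
  rewrite big_distrr big_distrl /=; apply: leq_sum => x _.
  rewrite big_distrr big_distrl /= big_mkcond [leqRHS]big_mkcond; apply: leq_sum => y _.
  case: (y \in B) => //=; case: ifP => //; rewrite /close /g negb_or !negb_and.
  have [xy|xy|<-] := ltgtP x y; rewrite ?W0 ?muln0 //=.
    by rewrite andbT -leqNgt => h; rewrite mulnDr mulnDl mulnC -mulnA; apply: leq_trans (leq_addr _ _); rewrite leq_mul2l h orbT.
  by rewrite -leqNgt => h; rewrite mulnDr mulnDl mulnC -!mulnA; apply: leq_trans (leq_addl _ _); rewrite leq_mul2l h orbT.
pose S1 v := \sum_(x in A :&: below v) \sum_(y in B :\: below v) W x y.
pose S2 v := \sum_(x in A :\: below v) \sum_(y in B :&: below v) W x y.
have SE (P Q : V -> {set V}) (r : V -> rel V) :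
  (forall v x y, (x \in P v) && (y \in Q v) = [&& x \in A, y \in B & r v x y]) ->
  \sum_v \sum_(x in P v) \sum_(y in Q v) W x y =
  \sum_(x in A) \sum_(y in B) W x y * #|[set v | r v x y]|.
  move=> h; transitivity (\sum_v \sum_(x in A) \sum_(y in B) W x y * r v x y).
    apply: eq_bigr => v _; rewrite big_mkcond [RHS]big_mkcond /=; apply: eq_bigr => x _.
    case: ifP => xP; last first.
      case: ifP => // xA; rewrite big1 // => y yB.
      by have := h v x y; rewrite xP xA yB /= => <-; rewrite muln0.
    case: ifP => xA; last first.
      by rewrite big1 // => y yQ; have := h v x y; rewrite xP xA yQ.
    rewrite big_mkcond [RHS]big_mkcond /=; apply: eq_bigr => y _.
    have := h v x y; rewrite xP xA /= => ->; case: (y \in B) => //=.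
    by case: (r v x y); rewrite ?muln1 ?muln0.
  rewrite exchange_big /=; apply: eq_bigr => x _; rewrite exchange_big /=; apply: eq_bigr => y _.
  by rewrite -big_distrr /= -sum1_card [in RHS]big_mkcond /=; congr (_ * _); apply: eq_bigr => v _; rewrite inE; case: (r _ _ _).
have HS : \sum_v (S1 v + S2 v) = \sum_(x in A) \sum_(y in B) W x y * g x y.
  rewrite big_split /= /g.
  rewrite (SE _ _ (fun v x y => (x < v <= y)%O)); last first.
    by move=> v x y; rewrite !inE -leNgt; case: (x \in A); case: (y \in B); rewrite ?andbF ?andbT.
  rewrite (SE _ _ (fun v x y => (y < v <= x)%O)); last first.
    by move=> v x y; rewrite !inE -leNgt; case: (x \in A); case: (y \in B); rewrite ?andbF ?andbT // andbC.
  rewrite -big_split /=; apply: eq_bigr => x _; rewrite -big_split; apply: eq_bigr => y _.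
  by rewrite mulnDr.
have Hsplit : \sum_(x in A) \sum_(y in B) W x y =
    \sum_(x in A) \sum_(y in B | close x y) W x y + \sum_(x in A) \sum_(y in B | ~~ close x y) W x y.
  by rewrite -big_split /=; apply: eq_bigr => x _; rewrite -bigID.
have Hall : n * (n ^ 2 * c) <= (\sum_(v in [set: V]) (S1 v + S2 v)) * (8 * D ^ 2).
  have -> : \sum_(v in [set: V]) (S1 v + S2 v) = \sum_v (S1 v + S2 v) by apply: eq_bigl => v; rewrite inE.
  rewrite HS; move: Hclose Hfar HN; rewrite Hsplit.
  set C := \sum_(x in A) \sum_(y in B | close x y) _; set F := \sum_(x in A) \sum_(y in B | ~~ _) _.
  set S := \sum_(x in A) _; set N := n ^ 2 * c; clear => h1 h2 h3.
  have : N <= F * (2 * D) by lia.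
  move/(leq_mul (leqnn n)) => h; apply: leq_trans h _.
  have -> : n * (F * (2 * D)) = n * F * (2 * D) by lia.
  have -> : S * (8 * D ^ 2) = S * (4 * D) * (2 * D) by lia.
  by rewrite leq_mul2r h2 orbT.
have [||v _ hv] := average _ _ n0 Hall; first by rewrite muln_gt0 expn_gt0 n0.
  exact: max_card.
exists v; rewrite -/(S1 v) -/(S2 v); move: hv; set N := n ^ 2 * c; clear => hv.
by case: (leqP N (S1 v * (16 * D ^ 2))) => h; [left|right]; move: h hv; nia.
Qed.

End Separate.

(** * Ordering and doubling parts *)

(** The inverse density after one separation of two parts. *)
Definition Dsep D := 16 * D ^ 2.
Lemma Dsep_ge D : D <= Dsep D. Proof. by rewrite /Dsep; nia. Qed.
Lemma Dsep_iter_ge k D : D <= iter k Dsep D.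
Proof. by elim: k => //= k IH; apply: leq_trans IH (Dsep_ge _). Qed.

Lemma Dsep_iter_mono k k' D : k <= k' -> iter k Dsep D <= iter k' Dsep D.
Proof. by move=> h; rewrite -(subnK h) iterD Dsep_iter_ge. Qed.

Lemma cauchy_seq (T : Type) (l : seq T) (a : T -> nat) :
  (\sum_(x <- l) a x) ^ 2 <= size l * \sum_(x <- l) a x ^ 2.
Proof.
case: l => [|x0 l]; first by rewrite !big_nil.
rewrite !(big_nth x0) !big_mkord.
by apply: leq_trans (cauchy_nat _) _; rewrite card_ord.
Qed.

Section Sort.
Variables (d : Order.disp_t) (V : finOrderType d) (G : rel V).
Hypothesis Gsym : symmetric G.
Let n := #|V|.
Hypothesis n0 : 0 < n.
Notation K := (K G).

Lemma leqD D D' m k : D <= D' -> m <= k * D -> m <= k * D'.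
Proof. by move=> DD h; apply: leq_trans h _; rewrite leq_mul2l DD orbT. Qed.

Lemma K_eq0 p s : p.2 = set0 -> K (p :: s) = 0.
Proof. by move=> p0; rewrite K_cons // p0 big_set0. Qed.

Lemma dense_neq0 p s m D : n ^ m <= K (p :: s) * D -> p.2 != set0.
Proof.
move=> h; apply/eqP => p0; move: h; rewrite K_eq0 // mul0n leqNgt.
by rewrite expn_gt0 n0.
Qed.

Lemma separate i A j B s D : n ^ (size s).+2 <= K ((i, A) :: (j, B) :: s) * D ->
  exists (A' B' : {set V}), [/\ A' \subset A, B' \subset B, before A' B' || before B' A' &
    n ^ (size s).+2 <= K ((i, A') :: (j, B') :: s) * Dsep D].
Proof.
move=> H; pose W x y := ok G i j x y * K (restr G j y (restr G i x s)).
have KE (A' B' : {set V}) : K ((i, A') :: (j, B') :: s) = \sum_(x in A') \sum_(y in B') W x y.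
  rewrite K_cons //=; apply: eq_bigr => x _; rewrite K_cons //= big_mkcond [RHS]big_mkcond /=.
  by apply: eq_bigr => y _; rewrite !inE /W; case: (y \in B') => //=; case: ifP => _; rewrite ?mul1n.
have e2 : n ^ (size s).+2 = n ^ 2 * n ^ size s by rewrite -expnD.
rewrite e2 KE in H; have [|||v] := separate_weight n0 _ _ _ H.
- by rewrite expn_gt0 n0.
- move=> x y; rewrite /W; have := K_le G (restr G j y (restr G i x s)); rewrite !size_restr.
  by case: (ok _ _ _ _ _); rewrite ?mul1n ?mul0n.
- by move=> x; rewrite /W /ok eqxx mul0n.
case=> h; [exists (A :&: below v), (B :\: below v)|exists (A :\: below v), (B :&: below v)];
  by rewrite subsetIl subsetDl e2 KE before_below ?orbT; split.
Qed.

(** A step of insertion sort, with [z] carried along unsorted. Once the new part precedes the first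
    part of [s], transitivity through a vertex of the latter, nonempty by density, puts it before
    all others. *)
Lemma insert s : forall i A z D, ordl s ->
  n ^ (size s + size z).+1 <= K ((i, A) :: s ++ z) * D ->
  exists (A' : {set V}) s'' s', [/\ A' \subset A, refines s'' s, perm_eq s' ((i, A') :: s''), ordl s' &
    n ^ (size s + size z).+1 <= K (s' ++ z) * iter (size s) Dsep D].
Proof.
elim: s => [|[j B] s IH] i A z D os H.
  by exists A, [::], [:: (i, A)].
have szE : size ((j, B) :: s) + size z = (size (s ++ z)).+1 by rewrite size_cat.
rewrite szE in H *; have [A1 [B1 [AA BB sep H1]]] := separate H.
case/orP: sep => sep.
- exists A1, ((j, B1) :: s), ((i, A1) :: (j, B1) :: s); split=> //.
  + by rewrite /= eqxx BB refines_refl.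
  + have o1 : ordl ((j, B1) :: s) by apply: ordl_refines os; rewrite /= eqxx BB refines_refl.
    apply/andP; split=> //; apply/allP => q; rewrite inE => /predU1P[->//|qs].
    have H2 : n ^ (size (s ++ z)).+2 <= K ((j, B1) :: (i, A1) :: s ++ z) * Dsep D.
      by rewrite (@K_perm _ _ Gsym _ ((i, A1) :: (j, B1) :: s ++ z)) //; perm_tac.
    have /set0Pn[y yB] := dense_neq0 H2.
    move: o1 => /andP[/allP /(_ q qs) /= /beforeP b _]; move/beforeP: sep => b'.
    by apply/beforeP => x w xA wq; apply: lt_trans (b' x y xA yB) (b y w yB wq).
  + by apply: leqD H1; rewrite /= -iterS iterSr Dsep_iter_ge.
- have [||A2 [s2 [s3 [A2A r2 pe os3 H3]]]] := IH i A1 ((j, B1) :: z) (Dsep D).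
  + by case/andP: os.
  + rewrite /= addnS -size_cat (@K_perm _ _ Gsym _ ((i, A1) :: (j, B1) :: s ++ z)) //; perm_tac.
  exists A2, ((j, B1) :: s2), ((j, B1) :: s3); split.
  + exact: subset_trans A2A AA.
  + by rewrite /= eqxx BB r2.
  + have := pe; rewrite -(perm_cons (j, B1)) => /permPl ->.
    by perm_tac.
  + apply/andP; split=> //; apply/allP => q; rewrite (perm_mem pe) inE => /predU1P[->|].
      by apply: beforeS sep.
    case/(refines_mem r2) => q0 q0s [_ qq]; move: os => /andP[/allP /(_ q0 q0s) h _].
    exact: beforeS h.
  + rewrite -iterSr /= addnS -size_cat in H3.
    by rewrite (@K_perm _ _ Gsym _ (s3 ++ (j, B1) :: z)) //; perm_tac.
Qed.

Lemma sort_parts s : forall z D, n ^ (size s + size z) <= K (s ++ z) * D ->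
  exists s', [/\ perm_eq (map fst s') (map fst s), ordl s' &
    n ^ (size s + size z) <= K (s' ++ z) * iter (size s * size s) Dsep D].
Proof.
elim: s => [|[i A] s IH] z D H; first by exists [::].
have [|s1 [p1 o1 H1]] := IH ((i, A) :: z) D.
  rewrite /= addnS; have -> : K (s ++ (i, A) :: z) = K ((i, A) :: s ++ z); last exact: H.
  by apply: K_perm => //; perm_tac.
have sz1 : size s1 = size s by rewrite -(size_map fst s1) (perm_size p1) size_map.
have [|A' [s2 [s' [AA r2 p2 o2 H2]]]] := @insert s1 i A z (iter (size s * size s) Dsep D) o1.
  rewrite sz1 -addnS; have -> : K ((i, A) :: s1 ++ z) = K (s1 ++ (i, A) :: z); last exact: H1.
  by apply: K_perm => //; perm_tac.
rewrite sz1 -iterD in H2.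
exists s'; split=> //.
  by rewrite (perm_trans (perm_map fst p2)) //= (refines_labels r2) perm_cons.
by apply: leqD H2; apply: Dsep_iter_mono => /=; rewrite mulSn mulnS; clear; lia.
Qed.

Definition nonadj : rel V := fun x y => (x != y) && ~~ G x y.

(* A pair of distinct nonadjacent vertices with label [i] extends the remaining
   labels to one more class, [i'] being a label not yet in use. *)
Lemma nonadj_le i i' A B s1 s2 s : perm_eq s (s2 ++ s1) ->
  i \notin map fst s1 -> i' \notin map fst s1 -> i != i' ->
  Sum G s top (fun W => npairs nonadj (A :&: W i) (B :&: W i)) <=
    n ^ size s2 * K [seq (l, [set: V]) | l <- i :: i' :: map fst s1].
Proof.
move=> pe is1 i's1 ii'; rewrite (Sum_perm Gsym _ _ pe).
set F := fun W => npairs nonadj (A :&: W i) (B :&: W i).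
have Fm W' W : sube W' W -> F W' <= F W.
  by move=> WW; apply: npairsS; apply: setIS; apply: WW.
apply: (leq_trans (@Sum_drop V G Gsym s2 s1 top F Fm)).
rewrite leq_mul2l; apply/orP; right.
pose F' (W : env V) := \sum_(x in W i) \sum_(y in W i') ok G i i' x y.
have FF (W : env V) : W i = W i' -> F W <= F' W.
  move=> e; rewrite /F npairsE; apply: leq_sum_sub => [|x _]; first exact: subsetIr.
  rewrite -e; apply: leq_sum_sub => [|y _]; first exact: subsetIr.
  by rewrite /nonadj /ok (negbTE ii'); case: (G x y).
have step (U : env V) : U i = U i' -> Sum G s1 U F <= Sum G s1 U F'.
  elim: s1 U is1 i's1 {pe} => [|q s1 IH] U /=; first by rewrite !Sum_nil => _ _; apply: FF.
  rewrite !inE !negb_or => /andP[iq is1] /andP[i'q i's1] e; rewrite !Sum_cons.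
  apply: leq_sum => x _; apply: IH => //; rewrite /upd e; congr (_ :&: _).
  by apply/setP => y; rewrite !inE /ok ![q.1 == _]eq_sym (negbTE iq) (negbTE i'q).
apply: leq_trans (step top (erefl _)) _; rewrite /= K_push2 //=.
apply: Sum_mono => //; first by elim: (s1) => //= q s' ->; rewrite eqxx subsetT.
move=> W' W WW; rewrite /F'; apply: leq_sum_sub => [|x _]; first by rewrite setTI WW.
by apply: leq_sum_sub => //; rewrite setTI WW.
Qed.

(** By Cauchy-Schwarz the candidate sets contain a [1 / D ^ 2] fraction of all pairs. Nonadjacent
    pairs and the diagonal take at most a quarter of this each; the rest are adjacent pairs with
    label [i], which a pivot separates. *)
Lemma double i A s D : n ^ (size s).+1 <= K ((i, A) :: s) * D ->
  Sum G s top (fun W => npairs nonadj (A :&: W i) (A :&: W i)) * (4 * D ^ 2) <= n ^ (size s).+2 ->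
  4 * D ^ 2 <= n ->
  exists (A1 A2 : {set V}), [/\ A1 \subset A, A2 \subset A, before A1 A2 &
    n ^ (size s).+2 <= K ((i, A1) :: (i, A2) :: s) * Dsep (2 * D ^ 2)].
Proof.
move=> H Hna Dn; set k := size s in H Hna *.
set NA := Sum _ _ _ _ in Hna.
have CS : K ((i, A) :: s) ^ 2 <= n ^ k * Sum G s top (fun W => #|A :&: W i| ^ 2).
  rewrite K_push // /Sum; apply: leq_trans (cauchy_seq _ _) _; rewrite leq_mul2r; apply/orP; right.
  by apply: leq_trans (Sum1_le G s top); rewrite /Sum sum1_size.
have split3 : Sum G s top (fun W => #|A :&: W i| ^ 2) <= K ((i, A) :: (i, A) :: s) + NA + n * n ^ k.
  rewrite K_push2 //= /NA /Sum -big_split /=.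
  have -> : n * n ^ k = n ^ k * n by rewrite mulnC.
  apply: (@leq_trans (\sum_(W <- confs G s top) ((\sum_(x in A :&: W i) \sum_(y in A :&: W i) ok G i i x y) + npairs nonadj (A :&: W i) (A :&: W i) + n))).
    apply: leq_sum => W _; rewrite npairsE -big_split /=.
    apply: (@leq_trans (\sum_(x in A :&: W i) (\sum_(y in A :&: W i) (ok G i i x y + nonadj x y) + 1))).
      rewrite -mulnn -sum_nat_const; apply: leq_sum => x xA.
      rewrite (cardsD1 x) xA add1n addn1 ltnS.
      rewrite -sum1_card big_mkcond [leqRHS]big_mkcond /=; apply: leq_sum => y _.
      rewrite in_setD1; case: (y \in _); rewrite ?andbF // andbT.
      by rewrite /ok /nonadj eqxx eq_sym; case: (_ != _); case: (G x y).
    rewrite big_split /= sum1_card leq_add ?max_card //.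
    by apply: leq_sum => x _; rewrite big_split.
  rewrite big_split /= leq_add // big_const_seq count_predT iter_addn_0 mulnC leq_mul2r.
  by apply/orP; right; apply: leq_trans (Sum1_le G s top); rewrite /Sum sum1_size.
have Hk : n ^ k.+2 <= K ((i, A) :: (i, A) :: s) * (2 * D ^ 2).
  rewrite -(@leq_pmul2l (n ^ k)) ?expn_gt0 ?n0 //.
  have h1 : n ^ k * n ^ k.+2 <= (K ((i, A) :: s) * D) ^ 2.
    by rewrite -expnD; apply: leq_trans (leq_mul H H); rewrite -expnD leq_pexp2l // !addnS addSn.
  have h2 : n * n ^ k * (4 * D ^ 2) <= n ^ k.+2.
    have -> : n ^ k.+2 = n * n ^ k * n by rewrite -expnS -expnSr.
    by rewrite leq_mul2l Dn orbT.
  move: h1 h2 CS split3 Hna; rewrite expnMn; set S2 := Sum _ _ _ _; set KA := K ((i, A) :: s).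
  set KK := K _; set N := n ^ k; set M := n ^ k.+2; set Q := n * N; set E := D ^ 2.
  clear => h1 h2 CS sp Hna.
  have h3 : M <= S2 * E \/ N = 0.
    case: (posnP N) => [->|N0]; first by right.
    left; rewrite -(leq_pmul2l N0); apply: leq_trans h1 _.
    by rewrite mulnA leq_mul2r CS orbT.
  case: h3 => [h3|->]; last by rewrite !mul0n.
  rewrite leq_mul2l; apply/orP; right.
  have : S2 * E <= (KK + NA + Q) * E by rewrite leq_mul2r sp orbT.
  lia.
have [A1 [A2 [s1 s2 /orP[b|b] h]]] := separate Hk.
  by exists A1, A2.
exists A2, A1; split=> //.
by rewrite (@K_perm _ _ Gsym _ ((i, A1) :: (i, A2) :: s)) // (perm_catCA [:: _] [:: _]).
Qed.

End Sort.

Lemma select_light (V : finType) (G : rel V) E D Gam j (B : {set V}) L : 0 < #|V| ->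
  #|V| <= #|B| * D -> sparse G j B Gam L -> 2 * size L * E * D <= Gam ->
  #|V| <= #|[set u in B | all (fun q : part V => #|[set z in q.2 | bad G q.1 j z u]| * E <= #|V|) L]| * (2 * D).
Proof.
move=> n0 BD sp GD.
have := card_setall B L (fun q u => #|[set z in q.2 | bad G q.1 j z u]| * E <= #|V|).
set S := #|[set u in B | _]|; set R := \sum_(q <- L) _ => h.
have hR : R * Gam <= size L * (E * #|V|).
  rewrite -sum1_size !big_distrl /= big_seq [leqRHS]big_seq; apply: leq_sum => q qL.
  rewrite mul1n; have := few_heavy E n0 (allP sp q qL); apply: leq_trans.
  rewrite leq_mul2r; apply/orP; right; apply: subset_leq_card; apply/subsetP => u.
  by rewrite !inE -ltnNge.
have hR2 : R * (2 * D) <= #|V|.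
  case: (posnP (size L * E)) => [z|p].
    move: z => /eqP; rewrite muln_eq0 => /orP[/nilP l0|/eqP e0].
      by rewrite /R l0 big_nil.
    rewrite /R big1 // => q _; apply/eqP; rewrite cards_eq0 -subset0.
    by apply/subsetP => u; rewrite !inE e0 muln0 leq0n andbF.
  rewrite -(leq_pmul2l p); apply: (@leq_trans (R * Gam)); last by rewrite -mulnA.
  have -> : size L * E * (R * (2 * D)) = R * (2 * size L * E * D) by clear; lia.
  by rewrite leq_mul2l GD orbT.
move: h hR2 BD; clear; nia.
Qed.

(** * Edges between large ordered sets *)

Section Tame.
Variables (d : Order.disp_t) (V : finOrderType d) (G : rel V).

Lemma tame_edge t T M (A B : {set V}) : tame G t T -> 0 < M -> M <= T -> before A B ->
  #|V| <= #|A| * M -> #|V| <= #|B| * M -> exists a b, [/\ a \in A, b \in B, (a < b)%O & G a b].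
Proof.
case=> _ _ nb t0 tn M0 MT AB.
have tM : t * M <= #|V|.
  apply: leq_trans tn; rewrite -mulnA mulnCA leq_mul2l; apply/orP; right.
  by apply: leq_trans MT _; rewrite mulnA leq_pmull.
move=> /(leq_trans tM); rewrite leq_pmul2r // => tA /(leq_trans tM); rewrite leq_pmul2r // => tB.
have [a [b [aA bB ab]]] := nb A B AB tA tB.
by exists a, b; split=> //; apply: (beforeP _ _ AB).
Qed.

Lemma ordl_nth s i j : ordl s -> i < j < size s ->
  before (nth (0, set0) s i).2 (nth (0, @set0 V) s j).2.
Proof.
move/(pairwiseP (0, @set0 V)) => h /andP[ij js]; apply: h => //.
by rewrite inE (ltn_trans ij js).
Qed.

Lemma sub_before (A' A B' B : {set V}) a b : A' \subset A -> B' \subset B -> before A B -> a \in A' -> b \in B' -> (a < b)%O.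
Proof. by move=> /subsetP AA /subsetP BB /beforeP h /AA aA /BB; apply: h. Qed.

Lemma dense_drop s s1 s2 D : symmetric G -> 0 < #|V| -> perm_eq s (s1 ++ s2) ->
  #|V| ^ size s <= K G s * D -> #|V| ^ size s2 <= K G s2 * D.
Proof.
move=> Gs n0 pe h; have := K_drop Gs s1 s2; rewrite -(K_perm Gs pe) => h1.
rewrite -(@leq_pmul2l (#|V| ^ size s1)) ?expn_gt0 ?n0 // -expnD -size_cat -(perm_size pe).
by apply: leq_trans h _; rewrite mulnA leq_mul2r h1 orbT.
Qed.

Lemma card_diff (X Y : {set V}) M : #|V| <= #|X| * M -> #|X :&: Y| * (2 * M) <= #|V| ->
  #|V| <= #|X :\: Y| * (2 * M).
Proof. by rewrite -(cardsID Y X); set a := #|_|; set b := #|_|; set n := #|_|; clear; nia. Qed.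

Lemma light_diff (X A : {set V}) (r : rel V) y M : #|V| <= #|X| * M -> X \subset A ->
  #|[set z in A | r z y]| * (2 * M) <= #|V| -> #|V| <= #|X :\: [set z | r z y]| * (2 * M).
Proof.
move=> XM XA h; apply: card_diff XM _; apply: leq_trans h; rewrite leq_mul2r; apply/orP; right.
by apply: subset_leq_card; apply/subsetP => z; rewrite !inE => /andP[/(subsetP XA) -> ->].
Qed.

End Tame.

(** [F] is tested against [E2]. If edges are dense, an edge [y' z] with [y'] in [E2] is fixed first,
    and [x y] is found between [B] and [E1] among compatible vertices. If they are sparse, a popular
    [x] is joined to a light [y] in [E2], and [y' z] is found between [E3] and [F]. The edge [y y']
    comes from the common label [e]. *)
Lemma tail_path D : exists Gam T, [/\ 0 < Gam, 0 < T &
  forall (d : Order.disp_t) (V : finOrderType d) (G : rel V) t, tame G t T ->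
  forall b e f B E1 E2 E3 F, b != e -> b != f -> e != f ->
  ordl [:: (b, B); (e, E1); (e, E2); (e, E3); (f, F)] ->
  npairs (bad G e e) E3 E2 * Gam <= #|V| ^ 2 ->
  #|V| ^ 5 <= K G [:: (b, B); (e, E1); (e, E2); (e, E3); (f, F)] * D ->
  exists x y y' z, [/\ x \in B, y \in E1 :|: E2 :|: E3, y' \in E1 :|: E2 :|: E3, z \in F & ipath G [:: x; y; y'; z]]].
Proof.
pose D2 := 2 * D ^ 2; pose Gam := (16 * D2 ^ 2).+1; pose D3 := 2 * Gam * D ^ 2.
exists Gam, (D3 + 4 * D2).+1; split=> // d V G t tm b e f B E1 E2 E3 F be bf ef o near H.
have n0 : 0 < #|V| by apply: (tame_gt0 _ tm).
have Gs : symmetric G by case: tm.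
have nD : 0 < D by case: (D) H => //; rewrite muln0 leqNgt expn_gt0 n0.
have D20 : 0 < D2 by rewrite muln_gt0 expn_gt0 nD.
have oB1 := ordl_nth o (isT : 0 < 1 < 5); have o12 := ordl_nth o (isT : 1 < 2 < 5).
have oB2 := ordl_nth o (isT : 0 < 2 < 5); have o23 := ordl_nth o (isT : 2 < 3 < 5).
have o2F := ordl_nth o (isT : 2 < 4 < 5); have o3F := ordl_nth o (isT : 3 < 4 < 5).
rewrite /= in oB1 o12 oB2 o23 o2F o3F.
have H1 : #|V| ^ (size [:: (b, B); (e, E1); (e, E3)]).+2 <=
    K G ((f, F) :: (e, E2) :: [:: (b, B); (e, E1); (e, E3)]) * D.
  by apply: leq_trans H _; rewrite leq_mul2r; apply/orP; right; rewrite (@K_perm _ _ Gs _ [:: (b, B); (e, E1); (e, E2); (e, E3); (f, F)]) //; perm_tac.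
have [H2|[F' [E2' [FF EE sp H2]]]] := dense_sparse Gs n0 (ltn0Sn _ : 0 < Gam) H1.
- have [z [y' [zF y'E zy' H3]]] := dense_pair Gs n0 H2; rewrite -/D3 in H3.
  set s := restr _ _ _ _ in H3.
  have := mem_part_size Gs n0 (mem_nth (0, set0) (isT : 0 < size s)) H3.
  have := mem_part_size Gs n0 (mem_nth (0, set0) (isT : 1 < size s)) H3.
  rewrite /=; set E' := E1 :&: _ :&: _; set B' := B :&: _ :&: _ => sE sB.
  have B'B : B' \subset B by rewrite /B' -setIA subsetIl.
  have E'E : E' \subset E1 by rewrite /E' -setIA subsetIl.
  have D30 : 0 < D3 by rewrite !muln_gt0 ?expn_gt0 nD.
  have [|x [y [xB yE xy Gxy]]] := tame_edge tm D30 _ (beforeS B'B E'E oB1) sB sE.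
    by rewrite ltnW // ltnS leq_addr.
  exists x, y, y', z; move: (xB) (yE); rewrite !inE => /andP[/andP[-> ok1] ok2] /andP[/andP[-> ok3] ok4].
  rewrite y'E orbT; split=> //.
  have y'z : (y' < z)%O by apply: (beforeP _ _ o2F).
  have yy' : (y < y')%O by apply: (sub_before E'E (subxx _) o12).
  rewrite ok_sym // in ok1; rewrite ok_sym // in ok2; rewrite ok_sym // in ok3; rewrite ok_sym // in ok4.
  have Gy'z : G y' z by rewrite Gs; apply: bad_neq zy'; rewrite ?(gt_eqF y'z) // eq_sym.
  have Gyy' : G y y' by move: ok3; rewrite /ok eqxx eqb_id => /andP[].
  by rewrite /= xy yy' y'z Gxy Gyy' Gy'z (ok_nonadj be ok1) (ok_nonadj bf ok2) (ok_nonadj ef ok4).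
have D2D T0 : T0 <= 4 * D2 -> T0 <= (D3 + 4 * D2).+1 by move=> h; rewrite ltnW // ltnS (leq_trans h) // leq_addl.
have H3 : #|V| ^ size [:: (b, B); (e, E2'); (e, E3); (f, F')] <= K G [:: (b, B); (e, E2'); (e, E3); (f, F')] * D2.
  by apply: (@dense_drop _ _ _ _ [:: (e, E1)] _ _ Gs n0 _ H2); perm_tac.
have popB := K_popular Gs n0 H3; set Bp := [set x in _ | _] in popB.
have E2D : #|V| <= #|E2'| * D2.
  by apply: (mem_part_size Gs n0 (mem_nth (0, set0) (isT : 1 < size [:: (b, B); (e, E2'); (e, E3); (f, F')])) H3).
have sp2 : sparse G e E2' Gam [:: (e, E3); (f, F')].
  by rewrite /sparse /= sp !andbT; apply: leq_trans near; rewrite leq_mul // npairsS.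
have GD : 2 * size [:: (e, E3); (f, F')] * (4 * D2) * D2 <= Gam.
  by rewrite /Gam -mulnn /=; clear; lia.
have popE := select_light n0 E2D sp2 GD.
set Ep := [set u in E2' | _] in popE.
have BpB : Bp \subset B by apply/subsetP => x; rewrite inE => /andP[].
have EpE : Ep \subset E2 by apply: subset_trans EE; apply/subsetP => x; rewrite inE => /andP[].
have [||x [y [xB yE xy Gxy]]] := tame_edge tm _ _ (beforeS BpB EpE oB2) popB popE.
- by rewrite muln_gt0.
- by apply: D2D; rewrite leq_mul2r orbT.
move: (xB) (yE); rewrite !inE => /andP[xB' /= Hx] /= /andP[yE2 /and3P[l3 lF _]].
set s := [:: _; _; _] in Hx.
have := mem_part_size Gs n0 (mem_nth (0, set0) (isT : 1 < size s)) Hx.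
have := mem_part_size Gs n0 (mem_nth (0, set0) (isT : 2 < size s)) Hx.
rewrite /= => sF s3.
rewrite -[4]/(2 * 2) -mulnA in l3 lF.
(* As [y] is light, deleting the vertices bad for it leaves at least half of the size guaranteed for
   each candidate set of [x]. *)
have {}s3 := light_diff s3 (subsetIl _ _) l3; have {}sF := light_diff sF (subsetIl _ _) lF.
set E3' := _ :\: _ in s3; set F2 := _ :\: _ in sF.
have E3'E : E3' \subset E3 by exact: subset_trans (subsetDl _ _) (subsetIl _ _).
have F2F : F2 \subset F by exact: subset_trans (subset_trans (subsetDl _ _) (subsetIl _ _)) FF.
have [||y' [z [y'E zF y'z Gy'z]]] := tame_edge tm _ _ (beforeS E3'E F2F o3F) s3 sF.
- by rewrite 2!muln_gt0 D20.
- by apply: D2D; rewrite mulnA.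
exists x, y, y', z; move: (y'E) (zF); rewrite !inE !negbK.
case/andP=> ok1 /andP[y'3 ok2] /andP[ok3 /andP[zF' ok4]].
rewrite xB' y'3 (subsetP EE _ yE2) (subsetP FF _ zF') ?orbT; split=> //.
have yy' : (y < y')%O by apply: (beforeP _ _ o23) => //; apply: (subsetP EE).
rewrite ok_sym // in ok1; rewrite ok_sym // in ok3.
have Gyy' : G y y' by move: ok1; rewrite /ok eqxx eqb_id => /andP[].
rewrite eq_sym in ef.
by rewrite /= xy yy' y'z Gxy Gyy' Gy'z (ok_nonadj be ok2) (ok_nonadj bf ok4) (ok_nonadj _ ok3) // eq_sym.
Qed.

(** * Five classes *)

Lemma ok_adj (V : finType) (G : rel V) i x y : ok G i i x y -> G x y.
Proof. by rewrite /ok eqxx eqb_id => /andP[]. Qed.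

(* The path is [x0 p q x y y' z], where a dense pair gives [p q] and [tail_path]
   the rest. *)
Lemma dense_case D : exists Gam T, [/\ 0 < Gam, 0 < T &
  forall (d : Order.disp_t) (V : finOrderType d) (G : rel V) t, tame G t T ->
  forall a c e f x0 P C C' E1 E2 E3 F, a != c -> a != e -> a != f -> c != e -> c != f -> e != f ->
  ordl [:: (a, P); (c, C); (c, C'); (e, E1); (e, E2); (e, E3); (f, F)] ->
  npairs (bad G e e) E3 E2 * Gam <= #|V| ^ 2 ->
  (forall x, x \in P -> (x0 < x)%O && G x0 x) ->
  (forall x, x \in C :|: C' :|: (E1 :|: E2 :|: E3) :|: F -> ~~ G x0 x) ->
  ~ #|V| ^ 7 <= Sum G [:: (c, C'); (e, E1); (e, E2); (e, E3); (f, F)] top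
       (fun W => npairs (bad G a c) (P :&: W a) (C :&: W c)) * D].
Proof.
have [Gam [T [G0 T0 tp]]] := tail_path D; exists Gam, T; split=> //.
move=> d V G t tm a c e f x0 P C C' E1 E2 E3 F ac ae af ce cf ef o near x0P x0n H.
have n0 : 0 < #|V| by apply: (tame_gt0 _ tm).
have [Gs nop _ _ _] := tm.
have [p [q [pP qC pq H1]]] := dense_pair Gs n0 (s := [:: (c, C'); (e, E1); (e, E2); (e, E3); (f, F)]) H.
have oPC := ordl_nth o (isT : 0 < 1 < 7); have oCC := ordl_nth o (isT : 1 < 2 < 7).
rewrite /= in oPC oCC.
set s := restr _ _ _ _ in H1.
have rs : refines s [:: (c, C'); (e, E1); (e, E2); (e, E3); (f, F)].
  exact: refines_trans (restr_refines _ _ _ _) (restr_refines _ _ _ _).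
have os : ordl s by apply: (ordl_refines rs); do 2 case/andP: o => _ o.
rewrite /s /= in os H1.
have sub (X Y Z : {set V}) : X :&: Y :&: Z \subset X by rewrite -setIA subsetIl.
have [|x [y [y' [z [xC yE y'E zF pth]]]]] := tp _ _ _ _ tm c e f _ _ _ _ _ ce cf ef os _ H1.
  by apply: leq_trans near; rewrite leq_mul // npairsS.
move: xC; rewrite !inE => /andP[/andP[xC' okq] okp].
have in3 w : w \in E1 :&: nb G c e q :&: nb G a e p :|: E2 :&: nb G c e q :&: nb G a e p :|: E3 :&: nb G c e q :&: nb G a e p ->
   [/\ ~~ G x0 w, ~~ G p w & ~~ G q w].
  rewrite -!setIUl => /setIP[/setIP[wE]]; rewrite !inE => qw pw.
  by rewrite x0n ?(ok_nonadj ae pw) ?(ok_nonadj ce qw) // !inE; move: wE; rewrite !inE => ->; rewrite ?orbT.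
have [x0y py qy] := in3 y yE; have [x0y' py' qy'] := in3 y' y'E.
move: zF; rewrite !inE => /andP[/andP[zF qz] pz].
have [/andP[x0p Gx0p] pq' qx] : [/\ (x0 < p)%O && G x0 p, (p < q)%O & (q < x)%O].
  by split; [exact: x0P | exact: (beforeP _ _ oPC) | exact: (beforeP _ _ oCC)].
apply: (nop [:: x0, p, q & [:: x; y; y'; z]]) => //.
have Gpq : G p q by apply: bad_neq pq; rewrite ?(lt_eqF pq').
move: pth => /= ->; rewrite x0p Gx0p pq' Gpq qx (ok_adj okq) x0y x0y' py py' qy qy'.
rewrite (ok_nonadj ac okp) (ok_nonadj af pz) (ok_nonadj cf qz).
by rewrite !x0n // !inE ?qC ?xC' ?zF ?orbT.
Qed.

(* All classes are sparse towards the third one: a typical edge [y' z] leaving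
   the third class, then a typical edge [x' y] entering it, obstruct nothing. *)
Lemma sparse_case D : exists Gam T, [/\ 0 < Gam, 0 < T &
  forall (d : Order.disp_t) (V : finOrderType d) (G : rel V) t, tame G t T ->
  forall a b c e x0 A B1 B2 C1 C2 E, a != b -> a != c -> a != e -> b != c -> b != e -> c != e ->
  ordl [:: (a, A); (b, B1); (b, B2); (c, C1); (c, C2); (e, E)] ->
  sparse G c C2 Gam [:: (a, A); (b, B1); (b, B2); (c, C1)] ->
  sparse G c C1 Gam [:: (a, A); (b, B1)] ->
  (forall x, x \in A -> (x0 < x)%O && G x0 x) ->
  (forall x, x \in B1 :|: B2 :|: C1 :|: C2 :|: E -> ~~ G x0 x) ->
  ~ #|V| ^ 6 <= K G [:: (a, A); (b, B1); (b, B2); (c, C1); (c, C2); (e, E)] * D].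
Proof.
pose Gam := (2 * 4 * (16 * D) * (4 * D)).+1.
exists Gam, (16 * D).+1; split=> //.
move=> d V G t tm a b c e x0 A B1 B2 C1 C2 E ab ac ae bc be ce o sp2 sp1 x0A x0n H.
have n0 : 0 < #|V| by apply: (tame_gt0 _ tm).
have [Gs nop _ _ _] := tm.
have nD : 0 < D by case: (D) H => //; rewrite muln0 leqNgt expn_gt0 n0.
have oAB := ordl_nth o (isT : 0 < 1 < 6); have oBB := ordl_nth o (isT : 1 < 2 < 6).
have oBC := ordl_nth o (isT : 2 < 3 < 6); have oCC := ordl_nth o (isT : 3 < 4 < 6).
have oCE := ordl_nth o (isT : 4 < 5 < 6).
rewrite /= in oAB oBB oBC oCC oCE.
set s4 := [:: (a, A); (b, B1); (b, B2); (c, C1)] in sp2.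
have H1 : #|V| ^ size ((e, E) :: s4) <= K G ((e, E) :: s4) * D.
  by apply: (@dense_drop _ _ _ _ [:: (c, C2)] _ _ Gs n0 _ H); perm_tac.
have C2D : #|V| <= #|C2| * D.
  exact: (mem_part_size Gs n0 (mem_nth (0, set0) (isT : 4 < size [:: (a, A); (b, B1); (b, B2); (c, C1); (c, C2); (e, E)])) H).
have GD : 2 * size s4 * (16 * D) * D <= Gam by rewrite /Gam /=; clear; nia.
have popC := select_light n0 C2D sp2 GD; have popE := K_popular Gs n0 H1.
set Cp := [set u in C2 | _] in popC; set Ep := [set u in _ | _] in popE.
have CpC : Cp \subset C2 by apply/subsetP => x; rewrite inE => /andP[].
have EpE : Ep \subset E by apply/subsetP => x; rewrite inE => /andP[].
have [||y' [z [y'C zE y'z Gy'z]]] := tame_edge tm _ _ (beforeS CpC EpE oCE) popC popE.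
- by rewrite muln_gt0.
- by rewrite ltnW // ltnS leq_mul2r orbT.
move: (y'C) (zE); rewrite inE => /andP[y'C2 lights]; rewrite inE => /andP[zE' H2].
set sz := restr G e z s4 in H2.
(* Of the at least [n ^ 4 / (2 D)] configurations compatible with the popular [z], the light vertex
   [y'] destroys at most [4 n ^ 4 / (16 D)], by [K_loss]. *)
have H3 : #|V| ^ 4 <= K G (restr G c y' sz) * (4 * D).
  rewrite -(@leq_pmul2r #|V|) //; have := K_loss G c y' sz; rewrite size_restr.
  have : (\sum_(q <- sz) #|q.2 :&: [set y | bad G c q.1 y' y]|) * (16 * D) <= 4 * #|V|.
    have -> : 4 * #|V| = size s4 * #|V| by [].
    rewrite big_distrl big_map -sum1_size big_distrl big_seq [leqRHS]big_seq.
    apply: leq_sum => q qs; rewrite /= mul1n.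
    have /= := allP lights q qs; apply: leq_trans; rewrite leq_mul2r; apply/orP; right; apply: subset_leq_card; apply/subsetP => w.
    by rewrite !inE /bad [ok G c q.1 y' w]ok_sym // => /andP[/andP[-> _] ->].
  move: H2; rewrite -[size s4]/4; set L := \sum_(q <- sz) _; set K1 := K G sz; set K2 := K G (restr _ _ _ _).
  set n4 := #|V| ^ 4; set n := #|V|; clear => h1 h2 h3.
  have : n * n4 <= K1 * n * (2 * D) by rewrite mulnAC mulnC leq_mul2r h1 orbT.
  have : K1 * n * (2 * D) <= (K2 * n + L * n4) * (2 * D) by rewrite leq_mul2r h3 orbT.
  have : L * (16 * D) * n4 <= 4 * n * n4 by rewrite leq_mul2r h2 orbT.
  lia.
rewrite /sz /s4 /= in H3; set sub := fun X Y Z : {set V} => subset_trans (subsetIl (X :&: Y) Z) (subsetIl X Y).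
have mem3 (X Y Z : {set V}) w : w \in X :&: Y :&: Z -> [/\ w \in X, w \in Y & w \in Z].
  by rewrite !inE => /andP[/andP[]].
set A' := A :&: _ :&: _ in H3; set B1' := B1 :&: _ :&: _ in H3.
set B2' := B2 :&: _ :&: _ in H3; set C1' := C1 :&: _ :&: _ in H3.
have AA : A' \subset A := sub _ _ _; have BB1 : B1' \subset B1 := sub _ _ _.
have BB2 : B2' \subset B2 := sub _ _ _; have CC1 : C1' \subset C1 := sub _ _ _.
have H4 : #|V| ^ size [:: (b, B2'); (a, A'); (b, B1')] <= K G [:: (b, B2'); (a, A'); (b, B1')] * (4 * D).
  by apply: (@dense_drop _ _ _ _ [:: (c, C1')] _ _ Gs n0 _ H3); perm_tac.
have C1D : #|V| <= #|C1'| * (4 * D).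
  exact: (mem_part_size Gs n0 (mem_nth (0, set0) (isT : 3 < size [:: (a, A'); (b, B1'); (b, B2'); (c, C1')])) H3).
have sp1' : sparse G c C1' Gam [:: (a, A); (b, B1)].
  by apply: sparseS sp1 => //; apply: refines_refl.
have GD' : 2 * size [:: (a, A); (b, B1)] * (16 * D) * (4 * D) <= Gam by rewrite /Gam /=; clear; nia.
have popC1 := select_light n0 C1D sp1' GD'; have popB := K_popular Gs n0 H4.
set Dp := [set u in C1' | _] in popC1; set Bp := [set u in _ | _] in popB.
have DpC : Dp \subset C1 by apply: subset_trans CC1; apply/subsetP => x; rewrite inE => /andP[].
have BpB : Bp \subset B2 by apply: subset_trans BB2; apply/subsetP => x; rewrite inE => /andP[].
have [||x' [y [x'B yC x'y Gx'y]]] := tame_edge tm _ _ (beforeS BpB DpC oBC) popB popC1.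
- by rewrite !muln_gt0.
- by rewrite ltnW // ltnS mulnA leq_mul2r orbT.
move: (x'B) (yC); rewrite inE /= => /andP[x'B2 H5]; rewrite inE => /andP[yC1 /= /and3P[lA lB _]].
set s := [:: _; _] in H5.
have := mem_part_size Gs n0 (mem_nth (0, set0) (isT : 0 < size s)) H5.
have := mem_part_size Gs n0 (mem_nth (0, set0) (isT : 1 < size s)) H5.
rewrite /= => sB sA.
have e16 : 16 * D = 2 * (2 * (4 * D)) by clear; lia.
rewrite e16 in lA lB.
have {}sA := light_diff sA (subset_trans (subsetIl _ _) AA) lA.
have {}sB := light_diff sB (subset_trans (subsetIl _ _) BB1) lB.
set A2 := _ :\: _ in sA; set B3 := _ :\: _ in sB.
have A2A : A2 \subset A by apply: subset_trans AA; exact: subset_trans (subsetDl _ _) (subsetIl _ _).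
have B3B : B3 \subset B1 by apply: subset_trans BB1; exact: subset_trans (subsetDl _ _) (subsetIl _ _).
have [||p [q [pA qB pq Gpq]]] := tame_edge tm _ _ (beforeS A2A B3B oAB) sA sB.
- by rewrite !muln_gt0.
- by rewrite -e16.
have y'Ci := subsetP CpC _ y'C; have zEi := subsetP EpE _ zE.
have x'Bi := subsetP BpB _ x'B; have yCi := subsetP DpC _ yC.
have pAi := subsetP A2A _ pA; have qBi := subsetP B3B _ qB.
move: pA; rewrite in_setD in_setI => /andP[okpy /andP[/mem3[_ okzp oky'p] okx'p]].
move: qB; rewrite in_setD in_setI => /andP[okqy /andP[/mem3[_ okzq oky'q] okx'q]].
have [_ okzx' oky'x'] := mem3 _ _ _ _ x'B2; have [_ okzy oky'y] := mem3 _ _ _ _ yC1.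
have O := ok_nonadj; have cs i j u v : i != j -> ok G j i u v -> ~~ G v u.
  by move=> ij; rewrite ok_sym //; apply: O.
rewrite inE negbK in okpy; rewrite inE negbK in okqy; rewrite inE in okx'p; rewrite inE in okx'q.
rewrite !inE in okzp oky'p okzq oky'q okzx' oky'x' okzy oky'y.
have /andP[x0p Gx0p] := x0A p pAi.
have qx' : (q < x')%O by apply: (beforeP _ _ oBB).
have yy' : (y < y')%O by apply: (beforeP _ _ oCC).
(* The edges [q x'] and [y y'] come from common labels, [p q], [x' y] and [y' z] from the lack of
   bicliques, and [x0 p] from the choice of [x0]. *)
apply: (nop [:: x0; p; q; x'; y; y'; z]) => //=.
rewrite x0p Gx0p pq Gpq qx' x'y Gx'y yy' y'z Gy'z !x0n ?inE ?qBi ?x'Bi ?yCi ?y'Ci ?zEi ?orbT //=.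
have -> : G q x' by rewrite Gs; apply: ok_adj okx'q.
have -> : G y y' by rewrite Gs; apply: ok_adj oky'y.
rewrite (cs _ _ _ _ ab okx'p) (O _ _ _ _ _ _ ac okpy) (cs _ _ _ _ ac oky'p) (cs _ _ _ _ ae okzp).
rewrite (O _ _ _ _ _ _ bc okqy) (cs _ _ _ _ bc oky'q) (cs _ _ _ _ be okzq).
by rewrite (cs _ _ _ _ bc oky'x') (cs _ _ _ _ be okzx') (cs _ _ _ _ ce okzy).
Qed.

(** [a0] and [b0] are ready-made first vertices. If [A], [B1] or [B2] has a dense pair with the
    third class, [dense_case] starts at the vertex of the matching label; otherwise [C1] and [C2]
    are sparse to all three, and [sparse_case] starts at [a0]. *)
Lemma five_classes_started D : exists Gam T, [/\ 0 < Gam, 0 < T &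
  forall (d : Order.disp_t) (V : finOrderType d) (G : rel V) t, tame G t T ->
  forall a b c e f a0 b0 A B1 B2 C1 C2 C3 E1 E2 E3 F, uniq [:: a; b; c; e; f] ->
  let late := [:: (c, C3); (e, E1); (e, E2); (e, E3); (f, F)] in
  ordl [:: (a, A), (b, B1), (b, B2), (c, C1), (c, C2) & late] ->
  npairs (bad G c c) C1 C2 * Gam <= #|V| ^ 2 ->
  npairs (bad G e e) E3 E2 * Gam <= #|V| ^ 2 ->
  (forall x, x \in A -> (a0 < x)%O && G a0 x) ->
  (forall x, x \in B1 :|: B2 -> (b0 < x)%O && G b0 x) ->
  (forall q x, q \in [:: (b, B1), (b, B2), (c, C1), (c, C2) & late] -> x \in q.2 -> ~~ G a0 x) ->
  (forall q x, q \in [:: (c, C1), (c, C2) & late] -> x \in q.2 -> ~~ G b0 x) ->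
  ~ #|V| ^ 10 <= K G [:: (a, A), (b, B1), (b, B2), (c, C1), (c, C2) & late] * D].
Proof.
pose D1 := iter 3 Dsq D; pose D2 := iter 3 Dsq D1.
have [GC [TC [GC0 TC0 caseC]]] := sparse_case D2.
pose D3 := 2 * GC * D2 ^ 2.
have [GX [TX [GX0 TX0 caseX]]] := dense_case D3.
exists (GX + GC), (TX + TC); split; rewrite ?addn_gt0 ?GX0 ?TX0 //.
move=> d V G t tm a b c e f a0 b0 A B1 B2 C1 C2 C3 E1 E2 E3 F ul late o nearC nearE a0A b0B a0n b0n H.
have n0 : 0 < #|V| by apply: (tame_gt0 _ tm); rewrite addn_gt0 TX0.
have [Gs _ _ _ _] := tm.
move: (ul); rewrite /= !inE !negb_or => /and5P[/and4P[ab ac ae af] /and3P[bc be bf] /andP[ce cf] ef _].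
have D12 : D1 <= D2 by apply: Dsq_iter_ge.
have D3le : 2 * GC * D1 ^ 2 <= D3 by rewrite leq_mul2l leq_exp2r // D12 orbT.
have {}nearE : npairs (bad G e e) E3 E2 * GX <= #|V| ^ 2.
  by apply: leq_trans nearE; rewrite leq_mul2l leq_addr orbT.
pose Bs := [:: (a, A); (b, B1); (b, B2)].
(* A dense pair towards the third class starts a path of type [dense_case]. *)
have dense_out (q : part V) (C : {set V}) (s : seq (part V)) : (exists2 q0, q0 \in Bs & q0.1 = q.1 /\ q.2 \subset q0.2) -> C \subset C1 \/ C \subset C2 ->
  ~ #|V| ^ (size (s ++ late)).+2 <= Sum G (s ++ late) top
       (fun W => npairs (bad G q.1 c) (q.2 :&: W q.1) (C :&: W c)) * D3.
  move=> [q0 q0B [eq0 qq0]] CC Hs.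
  have Hl : #|V| ^ 7 <= Sum G late top (fun W => npairs (bad G q.1 c) (q.2 :&: W q.1) (C :&: W c)) * D3.
    have := @Sum_drop V G Gs s late top (fun W => npairs (bad G q.1 c) (q.2 :&: W q.1) (C :&: W c)).
    set S := Sum G late _ _ => h; rewrite -(@leq_pmul2l (#|V| ^ size s)) ?expn_gt0 ?n0 // -expnD.
    rewrite mulnA; apply: leq_trans (leq_mul (h _) (leqnn _)); last first.
      by move=> W' W WW; apply: npairsS; apply: setIS; apply: WW.
    by apply: leq_trans Hs; rewrite size_cat leq_pexp2l // !addnS.
  have [x0 [qc qe qf x0q x0n]] : exists x0, [/\ q.1 != c, q.1 != e, q.1 != f,
      forall x, x \in q.2 -> (x0 < x)%O && G x0 x &
      forall q' x, q' \in [:: (c, C1), (c, C2) & late] -> x \in q'.2 -> ~~ G x0 x].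
    move: q0B; rewrite !inE => /or3P[] /eqP e0; rewrite -eq0 e0 /=; rewrite e0 /= in qq0.
    - exists a0; split=> // [x /(subsetP qq0)|q' x q's]; [exact: a0A|].
      by apply: a0n; rewrite 2!in_cons q's !orbT.
    - by exists b0; split=> // x /(subsetP qq0) h; apply: b0B; rewrite inE h.
    - by exists b0; split=> // x /(subsetP qq0) h; apply: b0B; rewrite inE h orbT.
  have [Ci [CCi CiB]] : exists Ci : {set V}, C \subset Ci /\ (Ci = C1 \/ Ci = C2).
    by case: CC => CC; [exists C1 | exists C2]; split=> //; [left | right].
  have oq : ordl [:: q0, (c, Ci) & late].
    apply: ordl_subseq o; move: q0B; rewrite !inE; set s10 := (X in subseq _ X).
    case/or3P => /eqP ->; case: CiB => ->;
      [exact: (mask_subseq [:: true; false; false; true; false; true; true; true; true; true] s10)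
      |exact: (mask_subseq [:: true; false; false; false; true; true; true; true; true; true] s10)
      |exact: (mask_subseq [:: false; true; false; true; false; true; true; true; true; true] s10)
      |exact: (mask_subseq [:: false; true; false; false; true; true; true; true; true; true] s10)
      |exact: (mask_subseq [:: false; false; true; true; false; true; true; true; true; true] s10)
      |exact: (mask_subseq [:: false; false; true; false; true; true; true; true; true; true] s10)].
  apply: (caseX _ _ _ _ (tame_mono (leq_addr _ _) tm) q.1 c e f x0 q.2 C C3 E1 E2 E3 F) => //.
  - by apply: ordl_refines oq; rewrite /= eq0 !eqxx qq0 CCi !subxx.
  - move=> x; have Cin : (c, Ci) \in [:: (c, C1), (c, C2) & late].
      by case: CiB => ->; rewrite !inE eqxx ?orbT.
    rewrite !inE -!orbA => /orP[/(subsetP CCi) xC|]; first exact: x0n Cin xC.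
    case/or4P => [||| /orP[]] h; [apply: (x0n (c, C3)) h|apply: (x0n (e, E1)) h|apply: (x0n (e, E2)) h|apply: (x0n (e, E3)) h|apply: (x0n (f, F)) h]; by rewrite !inE eqxx ?orbT.
have HS1 : #|V| ^ (size Bs + size ((c, C2) :: late)).+1 <= K G ((c, C1) :: Bs ++ (c, C2) :: late) * D.
  have -> : K G ((c, C1) :: Bs ++ (c, C2) :: late) = K G [:: (a, A), (b, B1), (b, B2), (c, C1), (c, C2) & late].
    by apply: K_perm => //; perm_tac.
  exact: H.
have [[C1' [Bs1 [CC1 rB1 sp1 H1]]]|[B1l [q [B2l [C1' [rB CC Hd]]]]]] := head_sparsify Gs n0 GC0 HS1; last first.
  apply: (dense_out q C1' (B1l ++ B2l ++ [:: (c, C2)])).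
  - by apply: (refines_mem rB); rewrite mem_cat mem_head orbT.
  - by left.
  - have -> : (size ((B1l ++ B2l ++ [:: (c, C2)]) ++ late)).+2 = (size Bs + size ((c, C2) :: late)).+1.
      by move: (refines_size rB); rewrite !size_cat /=; clear; lia.
    rewrite -!catA; apply: leq_trans Hd _; rewrite leq_mul2l; apply/orP; right; exact: D3le.
have szB1 := refines_size rB1; rewrite -/D1 in H1.
have HS2 : #|V| ^ (size Bs1 + size ((c, C1') :: late)).+1 <= K G ((c, C2) :: Bs1 ++ (c, C1') :: late) * D1.
  have -> : K G ((c, C2) :: Bs1 ++ (c, C1') :: late) = K G ((c, C1') :: Bs1 ++ (c, C2) :: late).
    by apply: K_perm => //; perm_tac.
  by rewrite szB1; exact: H1.
have := head_sparsify Gs n0 GC0 HS2; rewrite szB1 -/D2.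
case=> [[C2' [Bs2 [CC2 rB2 sp2 H2]]]|[B1l [q [B2l [C2' [rB CC Hd]]]]]]; last first.
  apply: (dense_out q C2' (B1l ++ B2l ++ [:: (c, C1')])).
  - have [q1 q1B [e1 qq1]] : exists2 q1, q1 \in Bs1 & q1.1 = q.1 /\ q.2 \subset q1.2.
      by apply: (refines_mem rB); rewrite mem_cat mem_head orbT.
    have [q0 q0B [e0 qq0]] := refines_mem rB1 q1B.
    by exists q0; rewrite // e0 e1; split=> //; apply: subset_trans qq1 qq0.
  - by right.
  - have -> : (size ((B1l ++ B2l ++ [:: (c, C1')]) ++ late)).+2 = (size Bs + size ((c, C1') :: late)).+1.
      by move: (refines_size rB); rewrite szB1 !size_cat /=; clear; lia.
    by rewrite -!catA.
have rB := refines_trans rB2 rB1.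
have szB2 : size Bs2 = 3 := refines_size rB.
case: Bs2 szB2 rB sp2 H2 rB2 => [|[la A'] [|[lb B1'] [|[lb' B2'] [|? ?]]]] //= _ rB sp2 H2 rB2.
case/and4P: rB => /andP[/eqP ea AA] /andP[/eqP eb BB1] /andP[/eqP eb' BB2] _.
rewrite /= in ea eb eb' AA BB1 BB2; subst la lb lb'.
pose s6 := [:: (a, A'); (b, B1'); (b, B2'); (c, C1'); (c, C2'); (e, E1)].
have H6 : #|V| ^ 6 <= K G s6 * D2.
  apply: (@dense_drop _ _ G [:: (c, C2'), (a, A'), (b, B1'), (b, B2'), (c, C1') & late]
    [:: (c, C3); (e, E2); (e, E3); (f, F)] s6 _ Gs n0 _ H2).
  by rewrite /s6 /late; perm_tac.
apply: (caseC _ _ _ _ (tame_mono (leq_addl _ _) tm) a b c e a0 A' B1' B2' C1' C2' E1) => //.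
- have o6 : ordl [:: (a, A); (b, B1); (b, B2); (c, C1); (c, C2); (e, E1)].
    by apply: ordl_subseq o; exact: (mask_subseq [:: true; true; true; true; true; false; true] [:: (a, A), (b, B1), (b, B2), (c, C1), (c, C2) & late]).
  by apply: ordl_refines o6; rewrite /= !eqxx AA BB1 BB2 CC1 CC2 subxx.
- move: sp2; rewrite /sparse /= => /and4P[-> -> -> _] /=; rewrite andbT.
  apply: leq_trans nearC; apply: leq_mul; first exact: npairsS.
  exact: leq_addl.
- have : sparse G c C1' GC [:: (a, A'); (b, B1'); (b, B2')] by apply: sparseS sp1; rewrite ?subxx.
  by rewrite /sparse /= => /and4P[-> -> _ _].
- by move=> x /(subsetP AA); apply: a0A.
- move=> x; rewrite !inE -!orbA => /or4P[/(subsetP BB1)|/(subsetP BB2)|/(subsetP CC1)|/orP[/(subsetP CC2)|]] h;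
  [apply: (a0n (b, B1)) h|apply: (a0n (b, B2)) h|apply: (a0n (c, C1)) h|apply: (a0n (c, C2)) h|apply: (a0n (e, E1)) h];
  by rewrite !inE eqxx ?orbT.
Qed.

(** The lowest parts [A0] and [B0] of the first two classes are spent on the vertices [a0] and [b0],
    and all other parts are made compatible with both. *)
Lemma five_classes D : exists Gam T, [/\ 0 < Gam, 0 < T &
  forall (d : Order.disp_t) (V : finOrderType d) (G : rel V) t, tame G t T ->
  forall a b c e f A0 A B0 B1 B2 C1 C2 C3 E1 E2 E3 F, uniq [:: a; b; c; e; f] ->
  let s := [:: (a, A0); (a, A); (b, B0); (b, B1); (b, B2); (c, C1); (c, C2); (c, C3);
               (e, E1); (e, E2); (e, E3); (f, F)] in
  ordl s ->
  npairs (bad G c c) C1 C2 * Gam <= #|V| ^ 2 ->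
  npairs (bad G e e) E3 E2 * Gam <= #|V| ^ 2 ->
  ~ #|V| ^ 12 <= K G s * D].
Proof.
have [Gam [T [G0 T0 main]]] := five_classes_started D; exists Gam, T; split=> //.
move=> d V G t tm a b c e f A0 A B0 B1 B2 C1 C2 C3 E1 E2 E3 F ul s o nearC nearE H.
have n0 : 0 < #|V| by apply: (tame_gt0 _ tm).
have [Gs _ _ _ _] := tm.
pose s10 := [:: (a, A); (b, B1); (b, B2); (c, C1); (c, C2); (c, C3); (e, E1); (e, E2); (e, E3); (f, F)].
have H1 : #|V| ^ (size ((b, B0) :: s10)).+1 <= K G ((a, A0) :: (b, B0) :: s10) * D.
  have -> : K G ((a, A0) :: (b, B0) :: s10) = K G s by apply: K_perm => //; rewrite /s10 /s; perm_tac.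
  exact: H.
have [a0 a0A {}H1] := K_pick Gs n0 H1.
have [b0 b0B H2] := K_pick Gs n0 (s := restr G a a0 s10) H1.
rewrite [(a, A0).1]/= [(b, _).1]/= size_restr in H2.
move: b0B; rewrite inE => /andP[b0B _]; rewrite /= in a0A b0B.
have r10 : refines (restr G b b0 (restr G a a0 s10)) s10.
  exact: refines_trans (restr_refines _ _ _ _) (restr_refines _ _ _ _).
have o10 : ordl s10 by apply: ordl_subseq o; exact: (mask_subseq [:: false; true; false; true; true; true; true; true; true; true; true; true] s).
have mem3 (X Y Z : {set V}) w : w \in X :&: Y :&: Z -> [/\ w \in X, w \in Y & w \in Z].
  by rewrite !inE => /andP[/andP[]].
have beforeA := ordl_nth o (isT : 0 < 1 < 12); have beforeB1 := ordl_nth o (isT : 2 < 3 < 12).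
have beforeB2 := ordl_nth o (isT : 2 < 4 < 12); rewrite /= in beforeA beforeB1 beforeB2.
move: (ul); rewrite /= !inE !negb_or => /and5P[/and4P[ab ac ae af] /and3P[bc be bf] /andP[ce cf] ef _].
apply: (main _ _ _ _ tm a b c e f a0 b0 _ _ _ _ _ _ _ _ _ _ ul _ _ _ _ _ _ _ H2).
- exact: ordl_refines r10 o10.
- by apply: leq_trans nearC; rewrite leq_mul // npairsS // -setIA subsetIl.
- by apply: leq_trans nearE; rewrite leq_mul // npairsS // -setIA subsetIl.
- move=> x /mem3[xA + _]; rewrite inE => /ok_adj ->; rewrite andbT.
  exact: (beforeP _ _ beforeA).
- move=> x; rewrite inE => /orP[] /mem3[xB _]; rewrite inE => /ok_adj ->; rewrite andbT.
    exact: (beforeP _ _ beforeB1).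
  exact: (beforeP _ _ beforeB2).
- move=> q x qs; have {qs} : q \in restr G b b0 (restr G a a0 (drop 1 s10)) := qs.
  case/mapP => q1 /mapP[q2 q2s ->] -> /mem3[_ + _]; rewrite inE; apply: ok_nonadj.
  by apply: (allP (_ : all (fun q => a != q.1) (drop 1 s10)) q2 q2s); rewrite /= ab ac ae af.
- move=> q x qs; have {qs} : q \in restr G b b0 (restr G a a0 (drop 3 s10)) := qs.
  case/mapP => q1 /mapP[q2 q2s ->] -> /mem3[_ _]; rewrite inE; apply: ok_nonadj.
  by apply: (allP (_ : all (fun q => b != q.1) (drop 3 s10)) q2 q2s); rewrite /= bc be bf.
Qed.

(** With distinct labels and full parts, [K] counts the ordered independent [r]-tuples. *)
Definition no_dense r := forall D, exists2 T, 0 < T &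
  forall (d : Order.disp_t) (V : finOrderType d) (G : rel V) t, tame G t T ->
  forall l, uniq l -> size l = r -> ~ (#|V| ^ r <= K G [seq (i, [set: V]) | i <- l] * D).

Lemma no_dense_up r : no_dense r -> no_dense r.+1.
Proof.
move=> h D; have [T T0 {}h] := h D; exists T => // d V G t tm [|i l] //= /andP[_ ul] [sl] H.
have n0 := tame_gt0 T0 tm; have [Gs _ _ _ _] := tm.
apply: (h _ _ _ _ tm l ul sl); rewrite -sl -(size_map (fun i => (i, [set: V])) l).
apply: (@dense_drop _ _ G _ [:: (i, [set: V])] _ _ Gs n0 (perm_refl _)).
by rewrite /= size_map sl.
Qed.

Lemma no_dense_many : exists k, no_dense k.
Proof.
have [k h] := many_parts; exists k => D.
have [T T0 {}h] := h (iter (k * k) Dsep D); exists T => // d V G t tm l ul sl H.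
have n0 := tame_gt0 T0 tm; have [Gs _ _ _ _] := tm.
set s := [seq _ | _ <- _] in H; have ss : size s = k by rewrite size_map.
have [|s' [pe os']] := @sort_parts _ _ G Gs n0 s [::] D.
  by rewrite cats0 addn0 ss.
have ps : map fst s = l by rewrite /s -map_comp map_id.
rewrite !cats0 addn0 ss => H'; apply: (h _ _ _ _ tm s' os' _ _ H').
  by rewrite (perm_uniq pe) ps.
by rewrite -(size_map fst) (perm_size pe) size_map.
Qed.

Lemma pick_labels (V : finType) l1 : forall s : seq (part V), uniq l1 -> {subset l1 <= map fst s} ->
  exists s1 s2, perm_eq s (s2 ++ s1) /\ map fst s1 = l1.
Proof.
elim: l1 => [|x l IH] s /=; first by exists [::], s; rewrite cats0.
case/andP=> xl ul sub; have /mapP[q qs ex] := sub x (mem_head _ _).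
have [|y yl|s1 [s2 [pe e]]] := IH (rem q s) => //.
  have /mapP[q' q's ey] := sub y (mem_behead (s := x :: l) yl).
  apply/mapP; exists q' => //; move: q's; rewrite (perm_mem (perm_to_rem qs)) inE => /predU1P[e|//].
  by case/negP: xl; rewrite ex -e -ey.
exists (q :: s1), s2; rewrite /= e ex; split=> //.
rewrite (permPl (perm_to_rem qs)) -(perm_cons q) in pe *.
by rewrite (permPl pe); perm_tac.
Qed.

Lemma npairs_bad_sym (V : finType) (G : rel V) i j A B : symmetric G ->
  npairs (bad G i j) A B = npairs (bad G j i) B A.
Proof.
move=> Gs; rewrite !npairsE exchange_big /=; apply: eq_bigr => y _; apply: eq_bigr => x _.
by rewrite /bad ok_sym.
Qed.

Lemma ordl_double (d : Order.disp_t) (V : finOrderType d) (s1 s2 : seq (part V)) i (A A1 A2 : {set V}) :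
  A1 \subset A -> A2 \subset A -> before A1 A2 -> ordl (s1 ++ (i, A) :: s2) ->
  ordl (s1 ++ [:: (i, A1), (i, A2) & s2]).
Proof.
move=> s1A s2A b o.
have o1 : ordl (s1 ++ (i, A1) :: s2).
  by apply: ordl_refines o; apply: refines_cat (refines_refl _) _; rewrite /= eqxx s1A refines_refl.
have o2 : ordl (s1 ++ (i, A2) :: s2).
  by apply: ordl_refines o; apply: refines_cat (refines_refl _) _; rewrite /= eqxx s2A refines_refl.
move: o1 o2; rewrite !ordl_cat !allrel_consr => /and3P[/andP[a1 a2] os1 c1] /and3P[/andP[a3 _] _ c2].
case/andP: c1 => c1 _; apply/and3P; split=> //; first by rewrite a1 a2 a3.
by apply/andP; split; [apply/andP; split; [exact: b | exact: c1] | exact: c2].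
Qed.

Lemma fresh_label (l : seq nat) : exists i, i \notin l.
Proof.
exists (\max_(i <- l) i).+1; apply/negP => h.
have := @leq_bigmax_seq _ l xpredT id _ h isT; by rewrite ltnn.
Qed.

Section Doubling.
Variables (d : Order.disp_t) (V : finOrderType d) (G : rel V) (r Dn : nat) (l : seq nat).
Let n := #|V|.
Hypotheses (Gs : symmetric G) (n0 : 0 < n) (ul : uniq l) (sl : size l = r).
Hypothesis small : forall l', uniq l' -> size l' = r.+1 ->
  ~ (n ^ r.+1 <= K G [seq (i, [set: V]) | i <- l'] * Dn).

(** Every label other than [i] is represented in [s], so a nonadjacent pair inside class [i]
    completes some parts of [s] to an independent tuple with [r.+1] labels. *)
Definition covers i (s : seq (part V)) := (i \in l) && all (fun x => (x == i) || (x \in map fst s)) l.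

Lemma nonadj_small i A B s : covers i s ->
  Sum G s top (fun W => npairs (nonadj G) (A :&: W i) (B :&: W i)) * Dn < n ^ (size s).+2.
Proof.
case/andP=> il /allP cov.
have [|x|s1 [s2 [pe e1]]] := @pick_labels V (rem i l) s; first exact: rem_uniq.
  by rewrite mem_rem_uniq // inE => /andP[/negbTE xi /cov]; rewrite xi.
have [i' i'l] := fresh_label (i :: l); rewrite inE negb_or in i'l; case/andP: i'l => i'i i'l.
have is1 : i \notin map fst s1 by rewrite e1 mem_rem_uniq // inE eqxx.
have i's1 : i' \notin map fst s1 by rewrite e1; apply: contra i'l; apply: mem_rem.
rewrite eq_sym in i'i.
have := nonadj_le Gs A B pe is1 i's1 i'i; rewrite e1.
have ss1 : (size s1).+1 = r by rewrite -(size_map fst) e1 size_rem // prednK //; case: (l) il.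
have ul' : uniq [:: i, i' & rem i l] by rewrite /= -e1 inE negb_or i'i is1 i's1 e1 rem_uniq.
have sl' : size [:: i, i' & rem i l] = r.+1 by rewrite /= -e1 size_map -ss1.
have /negP := small ul' sl'; rewrite -ltnNge => h1 h2.
rewrite (perm_size pe) size_cat -!addnS ss1 expnD.
apply: leq_ltn_trans (leq_mul h2 (leqnn _)) _; rewrite -mulnA ltn_pmul2l ?expn_gt0 ?n0 //.
Qed.

Lemma double_at i A s1 s2 D : covers i (s1 ++ s2) -> 4 * D ^ 2 <= Dn -> 4 * D ^ 2 <= n ->
  ordl (s1 ++ (i, A) :: s2) -> n ^ size (s1 ++ (i, A) :: s2) <= K G (s1 ++ (i, A) :: s2) * D ->
  exists A1 A2, ordl (s1 ++ [:: (i, A1), (i, A2) & s2]) /\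
    n ^ size (s1 ++ [:: (i, A1), (i, A2) & s2]) <= K G (s1 ++ [:: (i, A1), (i, A2) & s2]) * Dsep (2 * D ^ 2).
Proof.
move=> cov DDn Dln o; have -> : K G (s1 ++ (i, A) :: s2) = K G ((i, A) :: s1 ++ s2).
  by apply: K_perm => //; perm_tac.
rewrite size_cat /= addnS -size_cat => H.
have [|A1 [A2 [A1A A2A b H']]] := double Gs n0 H _ Dln.
  by apply: ltnW; apply: leq_ltn_trans (nonadj_small A A cov); rewrite leq_mul2l DDn orbT.
exists A1, A2; split; first exact: ordl_double o.
have -> : K G (s1 ++ [:: (i, A1), (i, A2) & s2]) = K G [:: (i, A1), (i, A2) & s1 ++ s2].
  by apply: K_perm => //; perm_tac.
by rewrite size_cat /= !addnS -size_cat.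
Qed.

(** Between ordered parts of one label a bad pair is a nonadjacent pair. The dense alternative of
    [dense_sparse] thus contradicts [nonadj_small]. *)
Lemma near_at i (P Q : {set V}) s1 s2 D Gam : 0 < Gam -> covers i (s1 ++ s2) -> 2 * Gam * D ^ 2 <= Dn ->
  ordl (s1 ++ [:: (i, P), (i, Q) & s2]) ->
  n ^ size (s1 ++ [:: (i, P), (i, Q) & s2]) <= K G (s1 ++ [:: (i, P), (i, Q) & s2]) * D ->
  exists (P' Q' : {set V}), [/\ ordl (s1 ++ [:: (i, P'), (i, Q') & s2]), P' \subset P, Q' \subset Q,
    npairs (bad G i i) P' Q' * Gam <= n ^ 2 &
    n ^ size (s1 ++ [:: (i, P'), (i, Q') & s2]) <= K G (s1 ++ [:: (i, P'), (i, Q') & s2]) * (2 * D ^ 2)].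
Proof.
move=> G0 cov GDn o.
have KE (P' Q' : {set V}) : K G (s1 ++ [:: (i, P'), (i, Q') & s2]) = K G [:: (i, P'), (i, Q') & s1 ++ s2].
  by apply: K_perm => //; perm_tac.
have sE (P' Q' : {set V}) : size (s1 ++ [:: (i, P'), (i, Q') & s2]) = (size (s1 ++ s2)).+2.
  by rewrite !size_cat /= !addnS.
rewrite KE sE => H; case: (dense_sparse Gs n0 G0 H) => [H'|[P' [Q' [PP QQ sp H']]]]; last first.
  exists P', Q'; rewrite KE sE; split=> //; apply: ordl_refines o; apply: refines_cat (refines_refl _) _.
  by rewrite /= !eqxx PP QQ refines_refl.
have bPQ : before P Q.
  by move: o; rewrite ordl_cat => /and3P[_ _ /andP[/= /andP[]]].
have := nonadj_small P Q cov; rewrite ltnNge => /negP[]; apply: leq_trans H' _.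
apply: leq_mul => //; apply: leq_Sum => W; rewrite !npairsE.
apply: leq_sum => x; rewrite inE => /andP[xP _]; apply: leq_sum => y; rewrite inE => /andP[yQ _].
rewrite /bad /ok /nonadj eqxx eqb_id (lt_eqF (beforeP _ _ bPQ _ _ xP yQ)) /=.
by case: (G x y).
Qed.

End Doubling.

Lemma tame_le (d : Order.disp_t) (V : finOrderType d) (G : rel V) t T : tame G t T -> T <= #|V|.
Proof.
case=> _ _ _ t0; apply: leq_trans; rewrite mulnA leq_pmull //.
by rewrite !muln_gt0 t0.
Qed.

Ltac cover_tac cov := apply: cov;
  [by rewrite !inE eqxx ?orbT | let y := fresh "y" in intro y; rewrite /= !inE; by do ?case: (_ == _)].

(** Twelve parts are needed from five: one doubling of [a] and two of each of [b], [c], [e], whence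
    the exponent in [D7]. [D8] and [D9] pay for making one pair of parts of [c] and one of [e]
    nearly complete. *)
Lemma no_dense_down r : 4 < r -> no_dense r.+1 -> no_dense r.
Proof.
move=> r5 nd D.
pose dd D := Dsep (2 * D ^ 2).
pose D0 := iter (r * r) Dsep D; pose D7 := iter 7 dd D0.
pose D8 := 2 * D7 ^ 2; pose D9 := 2 * D8 ^ 2.
have [Gam [T1 [G0 T10 main]]] := five_classes D9.
pose Dn := 4 * Gam * D9 ^ 2.
have [T2 T20 {}nd] := nd Dn.
exists (T1 + T2 + Dn); first by rewrite -addnA addn_gt0 T10.
move=> d V G t tm l ul sl H.
have n0 : 0 < #|V| by apply: (tame_gt0 _ tm); rewrite -addnA addn_gt0 T10.
have Dnn : Dn <= #|V| by apply: leq_trans (tame_le tm); rewrite leq_addl.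
have [Gs _ _ _ _] := tm.
have small := nd _ _ _ _ (tame_mono (leq_trans (leq_addl T1 T2) (leq_addr Dn _)) tm).
have dd_ge E : E <= dd E := leq_trans (Dsq_ge E) (Dsep_ge (2 * E ^ 2)).
have sq_ge x : x <= 2 * x ^ 2 := Dsq_ge x.
have D79 : D7 <= D9 := leq_trans (sq_ge D7) (sq_ge D8).
have it7 j : j <= 7 -> iter j dd D0 <= D7.
  by move=> j7; rewrite /D7 -(subnK j7) iterD; elim: (7 - j) => //= i IH; apply: leq_trans IH (dd_ge _).
have small4 j : j <= 7 -> 4 * iter j dd D0 ^ 2 <= Dn.
  move=> j7; rewrite /Dn -mulnA leq_mul2l; apply: leq_trans (leq_pmull _ G0).
  by rewrite leq_exp2r // (leq_trans (it7 j j7)).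
have smallG E : E <= D9 -> 2 * Gam * E ^ 2 <= Dn.
  by move=> ED; rewrite /Dn; apply: leq_mul; rewrite ?leq_exp2r // leq_mul2r orbT.
set s := [seq _ | _ <- _] in H; have ss : size s = r by rewrite size_map.
have [|s' [pe os' H']] := @sort_parts _ _ G Gs n0 s [::] D; first by rewrite cats0 addn0 ss.
have ps : map fst s = l by rewrite /s -map_comp map_id.
rewrite !cats0 addn0 ss -/D0 in H'; rewrite ps in pe.
have ss' : size s' = r by rewrite -(size_map fst) (perm_size pe).
case: s' pe os' H' ss' => [|[a VA] [|[b VB] [|[c VC] [|[e VE] [|[f VF] z]]]]];
  rewrite /= => pe o K0 ss'; try by move: r5; rewrite -ss'.
have cov i p q : i \in [:: a; b; c; e; f] ->
    {subset [:: a, b, c, e, f & map fst z] <= i :: map fst (p ++ q)} -> @covers d V l i (p ++ q).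
  move=> ii sub; apply/andP; split.
    by rewrite -(perm_mem pe); move: ii; rewrite !inE => /or4P[->|->|->|/orP[]->]; rewrite ?orbT.
  by apply/allP => x; rewrite -(perm_mem pe) => /sub; rewrite inE.
have ul5 : uniq [:: a; b; c; e; f].
  by have := ul; rewrite -(perm_uniq pe) -[_ :: _]/([:: a; b; c; e; f] ++ _) cat_uniq => /and3P[].
have double i A s1 s2 j := @double_at d V G r Dn l Gs n0 ul sl small i A s1 s2 (iter j dd D0).
have near i P Q s1 s2 E := @near_at d V G r Dn l Gs n0 ul sl small i P Q s1 s2 E Gam G0.
rewrite -ss' in K0.
have [|||A0 [A [o1 K1]]] := double a VA [::] [:: (b, VB), (c, VC), (e, VE), (f, VF) & z] 0 _ _ _ o K0.
- by cover_tac cov.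
- exact: small4.
- exact: leq_trans (small4 0 isT) Dnn.
rewrite -/(dd _) -iterS in K1.
have [|||B0 [X [o2 K2]]] := double b VB [:: (a, A0); (a, A)] [:: (c, VC), (e, VE), (f, VF) & z] 1 _ _ _ o1 K1.
- by cover_tac cov.
- exact: small4.
- exact: leq_trans (small4 1 isT) Dnn.
rewrite -/(dd _) -iterS in K2.
have [|||B1 [B2 [o3 K3]]] := double b X [:: (a, A0); (a, A); (b, B0)] [:: (c, VC), (e, VE), (f, VF) & z] 2 _ _ _ o2 K2.
- by cover_tac cov.
- exact: small4.
- exact: leq_trans (small4 2 isT) Dnn.
rewrite -/(dd _) -iterS in K3.
have [|||C1 [Y [o4 K4]]] := double c VC [:: (a, A0); (a, A); (b, B0); (b, B1); (b, B2)] [:: (e, VE), (f, VF) & z] 3 _ _ _ o3 K3.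
- by cover_tac cov.
- exact: small4.
- exact: leq_trans (small4 3 isT) Dnn.
rewrite -/(dd _) -iterS in K4.
have [|||C2 [C3 [o5 K5]]] := double c Y [:: (a, A0); (a, A); (b, B0); (b, B1); (b, B2); (c, C1)] [:: (e, VE), (f, VF) & z] 4 _ _ _ o4 K4.
- by cover_tac cov.
- exact: small4.
- exact: leq_trans (small4 4 isT) Dnn.
rewrite -/(dd _) -iterS in K5.
have [|||E1 [Z [o6 K6]]] := double e VE [:: (a, A0); (a, A); (b, B0); (b, B1); (b, B2); (c, C1); (c, C2); (c, C3)] [:: (f, VF) & z] 5 _ _ _ o5 K5.
- by cover_tac cov.
- exact: small4.
- exact: leq_trans (small4 5 isT) Dnn.
rewrite -/(dd _) -iterS in K6.
have [|||E2 [E3 [o7 K7]]] := double e Z [:: (a, A0); (a, A); (b, B0); (b, B1); (b, B2); (c, C1); (c, C2); (c, C3); (e, E1)] [:: (f, VF) & z] 6 _ _ _ o6 K6.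
- by cover_tac cov.
- exact: small4.
- exact: leq_trans (small4 6 isT) Dnn.
rewrite -/(dd _) -iterS in K7.
rewrite -/D7 in K7.
have [||C1' [C2' [o8 CC1 CC2 nearC K8]]] := near c C1 C2 [:: (a, A0); (a, A); (b, B0); (b, B1); (b, B2)]
  [:: (c, C3), (e, E1), (e, E2), (e, E3), (f, VF) & z] D7 _ _ o7 K7.
- by cover_tac cov.
- exact: smallG.
have [||E2' [E3' [o9 EE2 EE3 nearE K9]]] := near e E2 E3
  [:: (a, A0); (a, A); (b, B0); (b, B1); (b, B2); (c, C1'); (c, C2'); (c, C3); (e, E1)] [:: (f, VF) & z] D8 _ _ o8 K8.
- by cover_tac cov.
- by apply: smallG; exact: sq_ge D8.
rewrite npairs_bad_sym // in nearE.
pose s12 := [:: (a, A0); (a, A); (b, B0); (b, B1); (b, B2); (c, C1'); (c, C2'); (c, C3); (e, E1); (e, E2'); (e, E3'); (f, VF)].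
have o12 : ordl s12 by apply: ordl_subseq o9; exact: (prefix_subseq s12 z).
have K12 : #|V| ^ 12 <= K G s12 * D9.
  by apply: (@dense_drop _ _ G _ z s12 D9 Gs n0 _ K9); rewrite /s12; perm_tac.
exact: (main _ _ _ _ (tame_mono (leq_trans (leq_addr T2 T1) (leq_addr Dn _)) tm) a b c e f
  A0 A B0 B1 B2 C1' C2' C3 E1 E2' E3' VF ul5 o12 nearC nearE K12).
Qed.

Lemma no_dense5 : no_dense 5.
Proof.
have [k] := no_dense_many; elim: k => [|k IH] nd.
  by do 5 apply: no_dense_up.
case: (leqP k.+1 5) => k5; last by apply: IH; apply: no_dense_down nd; rewrite -ltnS.
have up j : no_dense (k.+1 + j) by elim: j => [|j IHj]; rewrite ?addn0 // addnS; apply: no_dense_up.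
by have := up (5 - k.+1); rewrite subnKC.
Qed.

(** * From independent sets to configurations *)

Section IndependentSets.
Variables (V : finType) (G : rel V).
Hypothesis Gs : symmetric G.

Definition indep (S : {set V}) := [forall x in S, forall y in S, (x != y) ==> ~~ G x y].

(** An independent set minus one of its vertices [x] is an independent set among the non-neighbours
    of [x], and for distinct labels these are exactly the candidates left by [x]. *)
Lemma indep_sets_le l : forall U : {set V}, uniq l ->
  #|[set S : {set V} | [&& #|S| == size l, S \subset U & indep S]]| <= K G [seq (i, U) | i <- l].
Proof.
elim: l => [|i l IH] U /=.
  move=> _; rewrite /K Sum_nil; apply: (@leq_trans #|[set (set0 : {set V})]|); last by rewrite cards1.
  by apply: subset_leq_card; apply/subsetP => S; rewrite !inE cards_eq0 => /and3P[].
case/andP=> il ul; rewrite K_cons //=.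
pose U' x := [set y in U | (x != y) && ~~ G x y].
apply: (@leq_trans (\sum_(x in U) #|[set S : {set V} | [&& #|S| == size l, S \subset U' x & indep S]]|)); last first.
  apply: leq_sum => x xU; apply: leq_trans (IH (U' x) ul) _.
  rewrite /restr -map_comp; apply: eq_leq; congr (K G _); apply/eq_in_map => j jl /=.
  congr (_, _); apply/setP => y; rewrite !inE /ok; have -> : (i == j) = false by apply: contraNF il => /eqP ->.
  by case: (G x y).
apply: (@leq_trans #|\bigcup_(x in U) [set x |: S | S in [set S : {set V} | [&& #|S| == size l, S \subset U' x & indep S]]]|).
  apply: subset_leq_card; apply/subsetP => S; rewrite inE => /and3P[/eqP cS SU iS].
  have /card_gt0P[x xS] : 0 < #|S| by rewrite cS.
  apply/bigcupP; exists x; first exact: (subsetP SU).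
  apply/imsetP; exists (S :\ x); last by rewrite setD1K.
  rewrite inE; apply/and3P; split.
  - by move: cS; rewrite (cardsD1 x) xS add1n => -[/eqP].
  - apply/subsetP => y; rewrite !inE => /andP[yx yS]; rewrite (subsetP SU) //= eq_sym yx /=.
    by have /implyP := forall_inP (forall_inP iS x xS) y yS; apply; rewrite eq_sym.
  - apply/forall_inP => y /setD1P[_ yS]; apply/forall_inP => z /setD1P[_ zS].
    exact: (forall_inP (forall_inP iS y yS) z zS).
elim/big_rec2: _ => [|x m W _ IHW]; first by rewrite cards0.
apply: leq_trans (leq_card_setU _ _) _; rewrite leq_add //.
exact: leq_imset_card.
Qed.

End IndependentSets.

Lemma ipath_nth (d : Order.disp_t) (V : finOrderType d) (G : rel V) x0 p i j : ipath G p ->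
  i < j < size p -> (nth x0 p i < nth x0 p j)%O && (G (nth x0 p i) (nth x0 p j) == (j == i.+1)).
Proof.
elim: p i j => [|x p IH] i j; first by rewrite ltn0 andbF.
case: p IH => [|y p] IH; first by case: j => [|j] _ /andP[].
move=> /= /and3P[/andP[xy Gxy] nx pp]; case: j => // j; case: i => [|i]; last first.
  by rewrite !ltnS eqSS; apply: (IH i j pp).
case: j => [_|j]; first by rewrite xy Gxy.
rewrite /= !ltnS => jp; have yj : (y < nth x0 p j)%O.
  by have /andP[] := IH 0 j.+1 pp jp.
rewrite (lt_trans xy yj) /=.
by have /negbTE -> := allP nx _ (mem_nth x0 jp).
Qed.

Lemma bin5_ge n : 5 <= n -> n ^ 5 <= 5 ^ 5 * 120 * 'C(n, 5).
Proof.
move=> n5; have e : 'C(n, 5) * 120 = n * (n - 1) * (n - 2) * (n - 3) * (n - 4).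
  have := bin_ffact n 5; rewrite !ffactnS ffactn0 !muln1 !mulnA -!subn1 -!subnDA.
  by move=> <-.
have h k : k <= 4 -> n <= 5 * (n - k) by lia.
rewrite -mulnA [120 * _]mulnC e !expnS expn0 muln1.
have -> : 5 * (5 * (5 * (5 * 5))) * (n * (n - 1) * (n - 2) * (n - 3) * (n - 4)) =
  (5 * n) * ((5 * (n - 1)) * ((5 * (n - 2)) * ((5 * (n - 3)) * (5 * (n - 4))))) by lia.
by rewrite !leq_mul ?h // leq_pmull.
Qed.

(** * Blow-ups in four blocks *)

Section Blowup.
Variables (X : finType) (d e : rel X) (X0 : 0 < #|X|).
Hypotheses (dC : symmetric d) (eC : symmetric e).

(* The first [4 * #|X| * mult] vertices form four consecutive blocks, each of which
   cycles through [X] [mult] times; later vertices are joined to everything. *)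
Section Graph.
Variable n : nat.
Implicit Types v w : 'I_n.

Definition mult := n %/ (4 * #|X|).
Definition block (v : nat) := v %/ (#|X| * mult).
Definition label (v : nat) : X := enum_val (Ordinal (ltn_pmod v X0)).

Definition blowup_adj : rel 'I_n := fun v w =>
  (v != w) && [|| 3 < block v, 3 < block w, block v == block w |
    if (block v)./2 == (block w)./2 then d (label v) (label w) else ~~ e (label v) (label w)].

Lemma blowup_sym : symmetric blowup_adj.
Proof.
move=> v w; rewrite /blowup_adj eq_sym orbCA [block w == _]eq_sym [_./2 == (block v)./2]eq_sym.
by rewrite dC eC.
Qed.

Lemma blowup_irrefl : irreflexive blowup_adj.
Proof. by move=> v; rewrite /blowup_adj eqxx. Qed.

Definition blowup : sgraph 'I_n := SGraph blowup_sym blowup_irrefl.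

Lemma block_le v w : v <= w -> block v <= block w.
Proof. exact: leq_div2r. Qed.

Lemma blowup_nonadj v w : v != w -> ~~ blowup v w ->
  [/\ block v <= 3, block w <= 3, block v != block w &
   if (block v)./2 == (block w)./2 then ~~ d (label v) (label w) else e (label v) (label w)].
Proof.
rewrite /= /blowup_adj => -> /=; rewrite !negb_or -!leqNgt => /and4P[-> -> ->].
by case: ifP => // _; rewrite negbK.
Qed.

(** The path vertices with indices 0, 2, 4, 6 are pairwise nonadjacent and so occupy the four blocks
    in order. The vertex of index 1 lies in block 0 or 1 and yields a [d]-pair across these blocks;
    that of index 5 yields one across blocks 2 and 3. The indices of the two pairs differ by at
    least two, so all four cross pairs are nonadjacent, hence in [e]. *)
Lemma blowup_no_path :
  (forall a b c c', d a b -> d c c' -> ~~ [&& e a c, e a c', e b c & e b c']) ->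
  ~ has_induced_monotone_path 7 blowup.
Proof.
move=> no4 [v [vlt vadj]].
have vne (i j : 'I_7) : i < j -> v i != v j by move=> ij; have := vlt i j ij; rewrite lt_neqAle => /andP[].
have bl (i j : 'I_7) : i <= j -> block (v i) <= block (v j).
  rewrite leq_eqVlt => /orP[/eqP/val_inj -> //|ij]; apply: block_le.
  by have := vlt i j ij; move/ltW.
have non (i j : 'I_7) : i.+1 < j -> [/\ block (v i) <= 3, block (v j) <= 3, block (v i) != block (v j) &
   if (block (v i))./2 == (block (v j))./2 then ~~ d (label (v i)) (label (v j)) else e (label (v i)) (label (v j))].
  move=> ij; apply: blowup_nonadj; first by apply: vne; apply: ltnW.
  rewrite vadj; apply/norP; split; rewrite neq_ltn ?ij //; apply/orP; right; exact: ltn_trans (ltnW ij) _.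
pose i k (hk : k < 7) : 'I_7 := Ordinal hk.
pose o0 := i 0 isT; pose o1 := i 1 isT; pose o2 := i 2 isT; pose o4 := i 4 isT; pose o5 := i 5 isT; pose o6 := i 6 isT.
have [p0 [p2 [p4 p6]]] : block (v o0) = 0 /\ block (v o2) = 1 /\ block (v o4) = 2 /\ block (v o6) = 3.
  have [_ _ /eqP n1 _] := non o0 o2 isT; have [_ _ /eqP n2 _] := non o2 o4 isT; have [_ h /eqP n3 _] := non o4 o6 isT.
  have := bl o0 o2 isT; have := bl o2 o4 isT; have := bl o4 o6 isT; move: n1 n2 n3 h; clear; lia.
have adjd (a b : 'I_7) : blowup (v a) (v b) -> block (v a) <= 3 -> block (v b) <= 3 -> block (v a) != block (v b) ->
    (block (v a))./2 = (block (v b))./2 -> d (label (v a)) (label (v b)).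
  rewrite /= /blowup_adj => /andP[_ adj] ba bb bn bh; move: adj.
  by rewrite bh eqxx (negbTE bn) ![3 < _]ltnNge ba bb.
have [a [b [a2 b2 dab ba bb]]] : exists a b : 'I_7, [/\ a <= 2, b <= 2, d (label (v a)) (label (v b)), block (v a) <= 1 & block (v b) <= 1].
  have := bl o0 o1 isT; have := bl o1 o2 isT; rewrite p0 p2.
  case E: (block (v o1)) => [|[|]] // _ _; [exists o1, o2 | exists o0, o1]; (split=> //; [apply: adjd|rewrite ?E ?p0 ?p2//..]);
    by rewrite ?vadj ?E ?p0 ?p2.
have [c [c' [a4 b4 dcc ca cb]]] : exists a b : 'I_7, [/\ 4 <= a, 4 <= b, d (label (v a)) (label (v b)), 2 <= block (v a) <= 3 & 2 <= block (v b) <= 3].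
  have := bl o4 o5 isT; have := bl o5 o6 isT; rewrite p4 p6.
  case E: (block (v o5)) => [|[|[|[|]]]] // _ _; [exists o5, o6 | exists o4, o5]; (split=> //; [apply: adjd|rewrite ?E ?p4 ?p6//..]);
    by rewrite ?vadj ?E ?p4 ?p6.
have cross (x y : 'I_7) : x <= 2 -> 4 <= y -> block (v x) <= 1 -> 2 <= block (v y) <= 3 -> e (label (v x)) (label (v y)).
  move=> x2 y4 bx by_; have [|_ _ _] := non x y; first by apply: leq_trans y4.
  case: ifP => // /eqP h _; exfalso; move: h bx by_; clear; lia.
by have := no4 _ _ _ _ dab dcc; rewrite !cross.
Qed.

(** Inside a block a vertex is determined by its label and by which of the [mult] rounds through [X]
    it belongs to. *)
Lemma card_block (L : {set 'I_n}) p : 0 < mult -> (forall v, v \in L -> block v = p) ->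
  #|L| <= #|[set label v | v : 'I_n in L]| * mult.
Proof.
move=> b0 Lp; pose f v := (label v, Ordinal (ltn_pmod (v %/ #|X|) b0)).
rewrite -[X in _ <= _ * X]card_ord -cardsT -cardsX -(@card_in_imset _ _ f).
  by apply: subset_leq_card; apply/subsetP => _ /imsetP[v vL ->]; rewrite !inE andbT /=; apply: imset_f.
move=> v w vL wL [/enum_val_inj /(congr1 val) /= m1 m2]; apply: val_inj => /=.
rewrite (divn_eq v #|X|) (divn_eq w #|X|) m1 (divn_eq (v %/ _) mult) (divn_eq (w %/ _) mult) m2 -!divnMA.
by have := Lp v vL; have := Lp w wL; rewrite /block => -> ->.
Qed.

Lemma popular_block (L : {set 'I_n}) : (forall v, v \in L -> block v <= 3) ->
  exists p, #|L| <= 4 * #|[set v in L | block v == p]|.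
Proof.
move=> L3; pose g v : 'I_4 := inord (block v).
have E : #|L| = \sum_(p < 4) #|[set v in L | block v == p]|.
  rewrite -sum1_card (partition_big g predT) //=; apply: eq_bigr => p _; rewrite -sum1_card.
  apply: eq_bigl => v; rewrite inE; apply: andb_id2l => vL.
  by rewrite -val_eqE /= inordK // ltnS L3.
move: E; rewrite !big_ord_recr big_ord0 /= => E.
case: (leqP #|L| (4 * #|[set v in L | block v == 0]|)) => [|h0]; first by exists 0.
case: (leqP #|L| (4 * #|[set v in L | block v == 1]|)) => [|h1]; first by exists 1.
case: (leqP #|L| (4 * #|[set v in L | block v == 2]|)) => [|h2]; first by exists 2.
case: (leqP #|L| (4 * #|[set v in L | block v == 3]|)) => [|h3]; first by exists 3.
exfalso; move: E h0 h1 h2 h3; clear; move: #|L| #|[set v in L | block v == 0]| #|[set v in L | block v == 1]| #|[set v in L | block v == 2]| #|[set v in L | block v == 3]| => l a b c f. lia.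
Qed.

(** Passing to the most frequent block on each side costs the factor 4. Whichever two blocks arise,
    nonadjacency excludes [d], directly or because [e] does. *)
Lemma blowup_biclique t : (forall a b, e a b -> ~~ d a b) -> 0 < mult -> 0 < t ->
  contains_copy (compl blowup) (biclique t) ->
  exists A B : {set X}, [/\ t <= 4 * (#|A| * mult), t <= 4 * (#|B| * mult) &
    forall a b, a \in A -> b \in B -> ~~ d a b].
Proof.
move=> ed b0 t0 [f [fi fadj]].
pose S i : {set 'I_n} := [set f (i, j) | j : 'I_t].
have cS i : #|S i| = t by rewrite card_imset ?card_ord // => j k /fi [].
have non v w : v \in S true -> w \in S false -> [/\ block v <= 3, block w <= 3, block v != block w &
   if (block v)./2 == (block w)./2 then ~~ d (label v) (label w) else e (label v) (label w)].
  by move=> /imsetP[j _ ->] /imsetP[k _ ->]; have /andP[] := fadj (true, j) (false, k) isT; apply: blowup_nonadj.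
have [v0 v0S] : exists v, v \in S true by apply/card_gt0P; rewrite cS.
have [w0 w0S] : exists v, v \in S false by apply/card_gt0P; rewrite cS.
have [p hp] : exists p, #|S true| <= 4 * #|[set v in S true | block v == p]|.
  by apply: popular_block => v vS; have [] := non v w0 vS w0S.
have [q hq] : exists p, #|S false| <= 4 * #|[set v in S false | block v == p]|.
  by apply: popular_block => v vS; have [] := non v0 v v0S vS.
rewrite !cS in hp hq; set A := [set v in S true | _] in hp; set B := [set v in S false | _] in hq.
exists [set label v | v : 'I_n in A], [set label v | v : 'I_n in B]; split.
- by apply: leq_trans hp _; rewrite leq_mul2l /=; apply: (@card_block _ p) => // v; rewrite inE => /andP[_ /eqP].
- by apply: leq_trans hq _; rewrite leq_mul2l /=; apply: (@card_block _ q) => // v; rewrite inE => /andP[_ /eqP].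
move=> _ _ /imsetP[v + ->] /imsetP[w + ->]; rewrite !inE => /andP[vS _] /andP[wS _].
by have [_ _ _] := non v w vS wS; case: ifP => // _; apply: ed.
Qed.

Lemma vertex_proof (p : 'I_4) (x : X) (j : 'I_mult) : p * (#|X| * mult) + (j * #|X| + enum_rank x) < n.
Proof.
apply: (@leq_trans (4 * (#|X| * mult))); last by rewrite mulnA mulnC leq_trunc_div.
have jx : j * #|X| + enum_rank x < #|X| * mult.
  apply: (@leq_trans (j.+1 * #|X|)); first by rewrite mulSn addnC ltn_add2r ltn_ord.
  by rewrite mulnC leq_mul2l ltn_ord orbT.
apply: (@leq_trans (p.+1 * (#|X| * mult))); first by rewrite mulSn [X in _ <= X]addnC ltn_add2l.
by rewrite leq_mul2r ltn_ord orbT.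
Qed.

Definition vertex p x j : 'I_n := Ordinal (@vertex_proof p x j).

Lemma block_vertex p x j : block (vertex p x j) = p.
Proof.
have jx : j * #|X| + enum_rank x < #|X| * mult.
  apply: (@leq_trans (j.+1 * #|X|)); first by rewrite mulSn addnC ltn_add2r ltn_ord.
  by rewrite mulnC leq_mul2l ltn_ord orbT.
by rewrite /block /= divnMDl ?divn_small ?addn0 //; apply: leq_trans jx.
Qed.

Lemma label_vertex p x j : label (vertex p x j) = x.
Proof.
apply: (canLR enum_rankK); apply: val_inj => /=.
by rewrite (mulnC #|X|) mulnA modnMDl modnMDl modn_small.
Qed.

Lemma vertex_inj p x j p' x' j' : vertex p x j = vertex p' x' j' -> [/\ p = p', x = x' & j = j'].
Proof.
move=> E; have Ep : p = p' by apply: val_inj; rewrite /=; rewrite -(block_vertex p x j) E block_vertex.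
have Ex : x = x' by rewrite -(label_vertex p x j) E label_vertex.
split=> //; apply: val_inj; move/(congr1 val): E => /=; rewrite Ep Ex => /addnI /addIn /eqP.
by rewrite eqn_pmul2r // => /eqP.
Qed.

Definition quads := [set z : (X * X) * (X * X) | [&& e z.1.1 z.2.1, e z.1.1 z.2.2, e z.1.2 z.2.1, e z.1.2 z.2.2,
      ~~ d z.1.1 z.1.2 & ~~ d z.2.1 z.2.2]].

Lemma blowup_cliques :
  #|quads| * mult ^ 4 <= #|[set S : {set 'I_n} | (#|S| == 4) && is_clique (compl blowup) S]|.
Proof.
pose J := ('I_mult * 'I_mult * ('I_mult * 'I_mult))%type.
pose V (z : ((X * X) * (X * X)) * J) (p : 'I_4) : 'I_n :=
  vertex p (if p == 0 :> nat then z.1.1.1 else if p == 1 :> nat then z.1.1.2 else if p == 2 :> nat then z.1.2.1 else z.1.2.2)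
           (if p == 0 :> nat then z.2.1.1 else if p == 1 :> nat then z.2.1.2 else if p == 2 :> nat then z.2.2.1 else z.2.2.2).
pose F z : {set 'I_n} := [set V z p | p : 'I_4].
have Vi z : injective (V z) by move=> p q /vertex_inj[].
have Fi : injective F.
  move=> z z' E; have EV p : V z p = V z' p.
    have : V z p \in F z' by rewrite -E imset_f.
    by move=> /imsetP[q _ h]; rewrite h; case: (vertex_inj h) => ->.
  case: z z' E EV => [[[a b] [c c']] [[j k] [l l']]] [[[a1 b1] [c1 c1']] [[j1 k1] [l1 l1']]] _ EV.
  have [_ /= -> ->] := vertex_inj (EV (@Ordinal 4 0 isT)); have [_ /= -> ->] := vertex_inj (EV (@Ordinal 4 1 isT)).
  by have [_ /= -> ->] := vertex_inj (EV (@Ordinal 4 2 isT)); have [_ /= -> ->] := vertex_inj (EV (@Ordinal 4 3 isT)).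
have cJ : #|[set: J]| = mult ^ 4 by rewrite cardsT !card_prod !card_ord; clear; lia.
rewrite -cJ -cardsX -(card_imset _ Fi); apply: subset_leq_card; apply/subsetP => _ /imsetP[z + ->].
rewrite !inE andbT => /and5P[e1 e2 e3 e4 /andP[d1 d2]].
rewrite card_imset // card_ord eqxx /=; apply/forall_inP => _ /imsetP[p _ ->]; apply/forall_inP => _ /imsetP[q _ ->].
apply/implyP => pq; rewrite /= /compl_adj pq /= /blowup_adj pq /= !negb_or -!leqNgt !block_vertex !label_vertex.
have le3 (r : 'I_4) : r <= 3 by [rewrite -ltnS ltn_ord].
rewrite !le3 /=; apply/andP; split; first by apply: contraNneq pq => /val_inj ->.
have pq' : p != q :> nat by apply: contraNneq pq => /val_inj ->.
case: p q {pq} pq' => [[|[|[|[|]]]] //= ?] [[|[|[|[|]]]] //= ?] _ //=; rewrite ?negbK //; by rewrite dC || by rewrite eC.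
Qed.

End Graph.
End Blowup.

From mathcomp Require Import all_classical all_reals all_analysis.
From mathcomp Require Import lra ring.

Import Order.TTheory GRing.Theory Num.Theory.
Import numFieldNormedType.Exports.

Local Open Scope classical_set_scope.
Local Open Scope ring_scope.

(** * Part (i) *)

Lemma has_path_of_ipath (d : Order.disp_t) (V : finOrderType d) (G : sgraph V) p :
  ipath G p -> size p = 7%N -> has_induced_monotone_path 7 G.
Proof.
case: p => // x0 p ip sp; pose q := x0 :: p; exists (fun i : 'I_7 => nth x0 q i).
have H (i j : 'I_7) : (i < j)%N -> (nth x0 q i < nth x0 q j)%O /\ G (nth x0 q i) (nth x0 q j) = (i.+1 == j :> nat).
  move=> ij; have := @ipath_nth d V G x0 q i j ip; rewrite ij sp ltn_ord => /(_ isT) /andP[-> /eqP ->].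
  by rewrite eq_sym.
split=> [i j /H[]//|i j].
have [ij|ji|e] := ltngtP i j.
- by rewrite (H i j ij).2 [j.+1 == i]gtn_eqF ?orbF // ltnS ltnW.
- by rewrite adj_sym (H j i ji).2 [i.+1 == j]gtn_eqF // ltnS ltnW.
- by have -> : i = j by [apply: val_inj]; rewrite (adj_irrefl G) orbb gtn_eqF.
Qed.

Lemma no_biclique_of_copy (d : Order.disp_t) (V : finOrderType d) (G : sgraph V) t :
  ~ contains_copy (compl G) (biclique t) -> no_biclique G t.
Proof.
move=> nc A B AB tA tB; case: (pselect (exists a b, [/\ a \in A, b \in B & G a b])) => // nab.
exfalso; apply: nc.
have E (C : {set V}) (tC : (t <= #|C|)%N) (i : 'I_t) : exists x, x \in C by exists (enum_val (widen_ord tC i)); apply: enum_valP.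
pose f (p : bool * 'I_t) := if p.1 then enum_val (widen_ord tA p.2) else enum_val (widen_ord tB p.2).
have fA i : f (true, i) \in A by apply: enum_valP.
have fB i : f (false, i) \in B by apply: enum_valP.
have AB' i j : (f (true, i) < f (false, j))%O by apply: (beforeP _ _ AB).
exists f; split=> [[[] i] [[] j]|[[] i] [[] j]] //=.
- by move=> /enum_val_inj /(congr1 val) /= /val_inj ->.
- by move=> e; have := AB' i j; rewrite e ltxx.
- by move=> e; have := AB' j i; rewrite -e ltxx.
- by move=> /enum_val_inj /(congr1 val) /= /val_inj ->.
- move=> _; rewrite /compl_adj (lt_eqF (AB' i j)) /=; apply/negP => h.
  by apply: nab; exists (f (true, i)), (f (false, j)).
- move=> _; rewrite /compl_adj (gt_eqF (AB' j i)) /= adj_sym; apply/negP => h.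
  by apply: nab; exists (f (true, j)), (f (false, i)).
Qed.

Lemma log2_le_ln (R : realType) n : (1 < n)%N -> ((trunc_log 2 n).+2%:R : R) <= 6 * ln n%:R.
Proof.
move=> n1; have n0 : (0 : R) < n%:R by rewrite ltr0n ltnW.
(* This gives both [trunc_log 2 n <= 2 ln n] and [2 <= 4 ln n], which add up to the constant 6. *)
have l2 : (1/2 : R) <= ln 2.
  have := @le_ln1Dx R (- (1 / 2)); have -> : 1 + - (1 / 2) = 2^-1 :> R by field.
  by rewrite lnV ?posrE //; lra.
have h1 : ln 2 <= ln (n%:R : R) by rewrite ler_ln ?posrE // ler_nat.
have h2 : (trunc_log 2 n)%:R * ln 2 <= ln (n%:R : R).
  rewrite mulr_natl -lnXn // ler_ln ?posrE ?exprn_gt0 // -natrX ler_nat.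
  by rewrite trunc_logP // ltnW.
set L := trunc_log 2 n in h2 *.
have -> : (L.+2%:R : R) = L%:R + 2 by rewrite -addn2 natrD.
have : (L%:R : R) / 2 <= L%:R * ln 2 by rewrite ler_wpM2l //; lra.
lra.
Qed.

Lemma part_i (R : realType) (eps : R) : 0 < eps ->
  exists c : R, 0 < c /\
    forall (n : nat) (d : Order.disp_t) (V : finOrderType d) (G : sgraph V),
      #|V| = n ->
      ~ has_induced_monotone_path 7 G ->
      eps < clique_density R 5 (compl G) ->
      contains_copy (compl G)
        (biclique (Num.truncn (c * n%:R / ln n%:R))).
Proof.
move=> e0; pose D := (Num.truncn ((5 ^ 5 * 120)%:R / eps : R)).+1.
have [T T0 nd] := no_dense5 D.
(* [72 = 12 * 6], with 12 from [tame] and 6 from [log2_le_ln]. *)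
exists ((72 * T)%:R^-1); split; first by rewrite invr_gt0 ltr0n muln_gt0.
move=> n d V G Vn nP dens; set t := Num.truncn _.
apply: contrapT => nc.
have t0 : (0 < t)%N.
  rewrite lt0n; apply/eqP => z; apply: nc; rewrite z.
  by exists (fun p : bool * 'I_0 => match p.2 with Ordinal i h => False_rect V (notF h) end); split=> [[? [? ?]]|[? [? ?]]].
(* For [n <= 1] the logarithm is 0, so the quotient is 0 by convention and [t] would be 0. *)
have n1 : (1 < n)%N.
  rewrite ltnNge; apply/negP => n1; move: t0; rewrite /t.
  have -> : ln (n%:R : R) = 0 by case: (n) n1 => [|[|]] // _; rewrite ?ln1 // ln0.
  by rewrite invr0 mulr0 truncn0.
have ln0' : 0 < ln (n%:R : R) by rewrite ln_gt0 // ltr1n.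
apply: (nd d V G t _ (iota 0 5)) => //.
- split=> //.
  + exact: adj_sym.
  + by move=> p ip sp; apply: nP; apply: has_path_of_ipath ip sp.
  + exact: no_biclique_of_copy.
  + rewrite Vn -(ler_nat R) !natrM.
    have h := log2_le_ln R n1.
    have ht : t%:R <= (72 * T)%:R^-1 * n%:R / ln (n%:R : R).
      by rewrite truncn_le // !mulr_ge0 ?invr_ge0 // ltW.
    rewrite natrM in ht; set L := (_.+2%:R : R) in h *; set l := ln _ in ht h ln0'.
    have T0' : (0 : R) < T%:R by rewrite ltr0n.
    apply: (@le_trans _ _ (12 * ((72 * T%:R)^-1 * n%:R / l) * (6 * l * T%:R))).
      by rewrite ler_pM ?mulr_ge0 ?ler_wpM2l ?ler_wpM2r.
    by rewrite le_eqVlt; apply/orP; left; apply/eqP; field; rewrite !gt_eqF.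
- have h1 := @indep_sets_le V G (@adj_sym _ G) (iota 0 5) (finset.setT) (iota_uniq 0 5).
  have n5 : (5 <= #|V|)%N.
    rewrite leqNgt; apply/negP => n5; move: dens; rewrite /clique_density bin_small // invr0 mulr0.
    by move/(lt_trans e0); rewrite ltxx.
  have h2 := bin5_ge n5.
  have C0 : (0 < 'C(#|V|, 5))%N by rewrite bin_gt0.
  move: dens; rewrite /clique_density ltr_pdivlMr ?ltr0n //.
  set N := #|_|%:R => hN.
  have hNK : N <= (K G [seq (i, finset.setT) | i <- iota 0 5])%:R.
    rewrite ler_nat; apply: leq_trans h1; apply: subset_leq_card; apply/fintype.subsetP => S.
    rewrite !inE => /andP[-> /forall_inP cl]; rewrite finset.subsetT /=; apply/forall_inP => x xS.
    apply/forall_inP => y yS; apply/implyP => xy.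
    by have /implyP/(_ xy) := forall_inP (cl x xS) y yS; rewrite /= /compl_adj xy.
  rewrite -(ler_nat R) natrM; apply: (@le_trans _ _ ((5 ^ 5 * 120 * 'C(#|V|, 5))%N%:R)).
    by rewrite ler_nat.
  have hD : (5 ^ 5 * 120)%:R <= eps * D%:R.
    by rewrite mulrC -ler_pdivrMr //; apply: ltW; rewrite truncnS_gt.
  rewrite natrM; apply: (@le_trans _ _ (eps * D%:R * 'C(#|V|, 5)%:R)); first by rewrite ler_wpM2r.
  rewrite mulrAC ler_wpM2r //; apply: le_trans hNK; exact: ltW.
Qed.

(** * Concentration *)

Section Sumset.
Variable m : nat.
Implicit Types A B : {set 'I_m}.

Definition sumset A B : {set 'I_(m + m)} :=
  [set s : 'I_(m + m) | [exists x in A, exists y in B, (x + y == s)%N]]%SET.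

Lemma sumset_ord_proof (x y : 'I_m) : (x + y < m + m)%N.
Proof. by rewrite -addnS leq_add // ltnW. Qed.

Lemma mem_sumset A B x y : x \in A -> y \in B -> Ordinal (sumset_ord_proof x y) \in sumset A B.
Proof.
by move=> xA yB; rewrite inE; apply/exists_inP; exists x => //; apply/exists_inP; exists y.
Qed.

(** The translates [A + max B] and [min A + B] meet only in [min A + max B]. *)
Lemma card_sumset A B a b : a \in A -> b \in B -> (#|A| + #|B| <= #|sumset A B|.+1)%N.
Proof.
move=> aA bB.
have [x xA xmin] := @arg_minnP _ a (mem A) val aA.
have [y yB ymax] := @arg_maxnP _ b (mem B) val bB.
pose f (z : 'I_m) := Ordinal (sumset_ord_proof z y).
pose g (z : 'I_m) := Ordinal (sumset_ord_proof x z).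
have fi : injective f by move=> z z' /(congr1 val) /= /addIn /val_inj.
have gi : injective g by move=> z z' /(congr1 val) /= /addnI /val_inj.
rewrite -(card_imset A fi) -(card_imset B gi).
set FA := imset f _; set GB := imset g _.
have sub : (FA :|: GB \subset sumset A B)%SET.
  rewrite finset.subUset; apply/andP; split; apply/fintype.subsetP => _ /imsetP[z zA ->]; exact: mem_sumset.
have fgx s : s \in FA :&: GB -> s = f x.
  case/setIP=> /imsetP[z zA ->] /imsetP[z' z'B e].
  have z1 : (x <= z)%N := xmin z zA; have z2 : (z' <= y)%N := ymax z' z'B.
  have e0 : (z + y = x + z')%N := congr1 val e.
  by congr f; apply: val_inj => /=; lia.
have I1 : (#|FA :&: GB| <= 1)%N.
  by apply/card_le1_eqP => s s' /fgx -> /fgx ->.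
have := subset_leq_card sub; have := cardsUI FA GB.
by move=> <- h; rewrite -addn1 leq_add.
Qed.

End Sumset.

(* A one-dimensional Prekopa-Leindler inequality: level sets of [a] and [b] at a
   common height [t] contribute at least [#|A_t| + #|B_t| - 1] values of [x + y]. *)
Lemma sumset_prekopa (R : realFieldType) m (a b : 'I_m -> R) (phi : nat -> R) M x0 y0 :
  (forall x, 0 <= a x <= M) -> (forall y, 0 <= b y <= M) -> a x0 = M -> b y0 = M ->
  (forall s, 0 <= phi s) -> (forall x y : 'I_m, Num.min (a x) (b y) <= phi (x + y)%N) ->
  \sum_x a x + \sum_y b y - M <= \sum_(s < m + m) phi s.
Proof.
pose supp (c : 'I_m -> R) := [set x | 0 < c x]%SET.
have [n] := ubnP (#|supp a| + #|supp b|); elim: n a b phi M => // n IH a b phi M.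
rewrite ltnS => sz ha hb ax by' p0 hp.
have M0 : 0 <= M by rewrite -ax; case/andP: (ha x0).
have [M00|Mn] := eqVneq M 0.
  have z (c : 'I_m -> R) : (forall x, 0 <= c x <= M) -> \sum_x c x = 0.
    by move=> hc; apply: big1 => x _; apply/eqP; rewrite eq_le andbC -{2}M00.
  by rewrite !z // M00 subr0 addr0 sumr_ge0.
have Mp : 0 < M by rewrite lt0r Mn.
have xA : x0 \in supp a by rewrite inE ax.
have yB : y0 \in supp b by rewrite inE by'.
have [x1 x1A x1min] := @arg_minP _ _ _ x0 (fun x => x \in supp a) a xA.
have [y1 y1B y1min] := @arg_minP _ _ _ y0 (fun x => x \in supp b) b yB.
(* [tau] is the least positive value of [a] and [b]. Subtracting it on both supports and on their
   sumset lowers the right side by at least as much as the left, by [card_sumset], and removes a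
   point from one of the supports. *)
pose tau := Num.min (a x1) (b y1).
have tau0 : 0 < tau by rewrite lt_min; move: x1A y1B; rewrite !inE => -> ->.
pose C := sumset (supp a) (supp b).
pose sub (c : 'I_m -> R) x := if x \in supp c then c x - tau else 0.
pose phi' s := if [exists c in C, val c == s] then phi s - tau else phi s.
have ta x : x \in supp a -> tau <= a x by move/x1min => h; rewrite ge_min h.
have tb x : x \in supp b -> tau <= b x by move/y1min => h; rewrite ge_min h orbT.
have tM : tau <= M by rewrite -ax ta.
have sumE (c : 'I_m -> R) : (forall x, 0 <= c x <= M) -> \sum_x c x = \sum_x sub c x + tau *+ #|supp c|.
  move=> hc; rewrite -sumr_const [X in _ + X]big_mkcond -big_split /=; apply: eq_bigr => x _.
  rewrite /sub inE; case: ltP => [_|cx]; first by rewrite subrK.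
  by rewrite addr0; apply/eqP; rewrite eq_le cx; case/andP: (hc x).
have phiE : \sum_(s < m + m) phi s = \sum_(s < m + m) phi' s + tau *+ #|C|.
  rewrite -sumr_const [X in _ + X]big_mkcond -big_split /=; apply: eq_bigr => s _.
  rewrite /phi'; have -> : [exists c in C, val c == val s] = (s \in C).
    by apply/exists_inP/idP => [[c cC /eqP/val_inj <-]|sC] //; exists s.
  by case: ifP; rewrite ?subrK ?addr0.
have CA : (#|supp a| + #|supp b| <= #|C|.+1)%N := card_sumset xA yB.
have onC s : [exists c in C, val c == s] -> tau <= phi s.
  case/exists_inP=> c; rewrite inE => /exists_inP[x xa /exists_inP[y yb /eqP exy]] /eqP cs.
  have -> : s = (x + y)%N by rewrite exy -cs.
  by apply: le_trans (hp x y); rewrite le_min ta ?tb.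
have phi'0 s : 0 <= phi' s by rewrite /phi'; case: ifP => // /onC; rewrite subr_ge0.
have subs (c : 'I_m -> R) : supp (sub c) \subset supp c.
  by apply/fintype.subsetP => x; rewrite !inE /sub inE; case: ifP => // _; rewrite ltxx.
have hsub (c : 'I_m -> R) : (forall x, 0 <= c x <= M) -> (forall x, x \in supp c -> tau <= c x) ->
    forall x, 0 <= sub c x <= M - tau.
  move=> hc tc x; rewrite /sub; case: ifP => xc; last by rewrite lexx subr_ge0.
  by rewrite subr_ge0 tc //= lerD2r; case/andP: (hc x).
have drop (c : 'I_m -> R) z : z \in supp c -> c z = tau -> (#|supp (sub c)| < #|supp c|)%N.
  move=> zc cz; rewrite (cardsD1 z (supp c)) zc add1n ltnS; apply: subset_leq_card.
  by rewrite finset.subsetD1 subs inE /sub zc cz subrr ltxx.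
have H : \sum_x sub a x + \sum_y sub b y - (M - tau) <= \sum_(s < m + m) phi' s.
  apply: IH.
  - apply: leq_trans sz; have := subset_leq_card (subs a); have := subset_leq_card (subs b).
    case: (leP (a x1) (b y1)) => ab ha' hb'.
      by rewrite -addSn leq_add //; apply: (drop a x1) => //; rewrite /tau; apply/esym/min_l.
    by rewrite -addnS leq_add //; apply: (drop b y1) => //; rewrite /tau; apply/esym/min_r/ltW.
  - exact: hsub ha ta.
  - exact: hsub hb tb.
  - by rewrite /sub xA ax.
  - by rewrite /sub yB by'.
  - exact: phi'0.
  - move=> x y; rewrite /sub; case: ifP => xa; last by rewrite ge_min phi'0.
    case: ifP => yb; last by rewrite ge_min phi'0 orbT.
    have -> : phi' (x + y)%N = phi (x + y)%N - tau.
      rewrite /phi'; case: ifP => // /negbT/negP[]; apply/exists_inP.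
      by exists (Ordinal (sumset_ord_proof x y)); rewrite ?mem_sumset.
    by have := hp x y; rewrite !minElt ltrD2r; case: ifP => _; rewrite lerD2r.
rewrite (sumE a ha) (sumE b hb) phiE.
have : tau *+ (#|supp a| + #|supp b|) <= tau *+ #|C|.+1 by rewrite ler_wpMn2l // ltW.
rewrite mulrnDr mulrS => h; move: H h; set S1 := \sum_x sub a x; set S2 := \sum_y sub b y; set S3 := \sum_(s < _) _.
set t1 := tau *+ _; set t2 := tau *+ _; set t3 := tau *+ _; lra.
Qed.

Lemma expR_half_le (R : realType) (z : R) : 0 <= z <= 1 -> expR (z / 2) <= 1 + z.
Proof.
move=> /andP[z0 z1]; have h := expR_ge1Dx (- (z / 2)).
have p : 0 < 1 - z / 2 by lra.
have e : expR (z / 2) * expR (- (z / 2)) = 1 by rewrite -expRD subrr expR0.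
have h2 : expR (z / 2) * (1 - z / 2) <= 1 by rewrite -[leRHS]e ler_wpM2l ?expR_ge0.
rewrite -(ler_pM2r p); apply: (le_trans h2); nra.
Qed.

Lemma card_ord_lt m k : (k <= m)%N -> #|[set i : 'I_m | (i < k)%N]%SET| = k.
Proof.
by move=> km; rewrite -sum1_card; under eq_bigl => i do rewrite inE; rewrite -(big_ord_widen _ (fun=> 1%N)) // sum1_card card_ord.
Qed.

(* The maximum of two uniform coordinates has the strictly log-concave weights
   [2 x + 1]; uniform weights would leave no room for the gain in [weight_ineq]. *)
Definition pmax m (s : 'I_m * 'I_m) : 'I_m := if (s.1 <= s.2)%N then s.2 else s.1.

Lemma card_pmax_lt m k : (k <= m)%N -> #|[set s | (@pmax m s < k)%N]%SET| = (k * k)%N.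
Proof.
move=> km; rewrite -{2 3}(card_ord_lt km) -finset.cardsX; apply: eq_card => -[i j].
rewrite !inE /pmax /=; case: (leqP i j) => ij; first by rewrite andb_idl // => jk; apply: leq_ltn_trans jk.
by rewrite andb_idr // => ik; apply: ltn_trans ik.
Qed.

Lemma card_pmax m (x : 'I_m) : #|[set s | pmax s == x]%SET| = (x + x).+1.
Proof.
have := card_pmax_lt (ltn_ord x); rewrite -(cardsID [set s | (pmax s < x)%N]%SET).
have -> : [set s | (@pmax m s < x.+1)%N]%SET :&: [set s | (pmax s < x)%N]%SET = [set s | (pmax s < x)%N]%SET.
  by apply/setP => s; rewrite !inE andb_idl // => h; apply: ltnW.
have -> : [set s | (@pmax m s < x.+1)%N]%SET :\: [set s | (pmax s < x)%N]%SET = [set s | pmax s == x]%SET.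
  by apply/setP => s; rewrite !inE -leqNgt ltnS -val_eqE /= eqn_leq andbC.
rewrite card_pmax_lt ?(ltnW (ltn_ord x)) //; move=> h; nia.
Qed.

(* The functional form of Gaussian-type concentration (property tau). *)
Definition plp (R : realType) (T : finType) (w : T -> T -> R) (B : R) :=
  forall (u v : T -> R) (c : R), (forall s, 0 <= u s) -> (forall t, 0 <= v t) -> 0 <= c ->
  (forall s t, u s * v t <= c * expR (w s t)) -> (\sum_s u s) * (\sum_t v t) <= c * B.

Section PLP.
Variable R : realType.

(** [(x + y + 1) ^ 2] exceeds [(2 x + 1) (2 y + 1)] by exactly [(x - y) ^ 2], and that product is at
    most [4 m ^ 2]. The exponential is at most [1 + z] with [z = (x - y) ^ 2 / (4 m ^ 2)], so it
    uses up no more than this excess. *)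
Lemma weight_ineq m (x y : 'I_m) :
  ((x + x).+1%:R * (y + y).+1%:R) * expR ((x%:R - y%:R) ^+ 2 / (8 * m%:R ^+ 2)) <= ((x + y).+1%:R : R) ^+ 2.
Proof.
have m0 : (0 : R) < m%:R by rewrite ltr0n; apply: leq_ltn_trans (ltn_ord x).
have xm : (x%:R + 1 : R) <= m%:R by rewrite natr1 ler_nat.
have ym : (y%:R + 1 : R) <= m%:R by rewrite natr1 ler_nat.
have x0 : (0 : R) <= x%:R by []. have y0 : (0 : R) <= y%:R by [].
have E (a b : nat) : (a + b).+1%:R = a%:R + b%:R + 1 :> R by rewrite -natr1 natrD.
rewrite !E; set X := x%:R in xm x0 *; set Y := y%:R in ym y0 *; set M := m%:R in m0 xm ym *.
pose z := (X - Y) ^+ 2 / (4 * M ^+ 2).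
have -> : (X - Y) ^+ 2 / (8 * M ^+ 2) = z / 2 by rewrite /z; field; rewrite gt_eqF.
have M4 : 0 < 4 * M ^+ 2 by nra.
have z0 : 0 <= z by rewrite divr_ge0 ?sqr_ge0 // ltW.
have z1 : z <= 1 by rewrite ler_pdivrMr // mul1r; nra.
have h : expR (z / 2) <= 1 + z by apply: expR_half_le; rewrite z0.
have P0 : 0 <= (X + X + 1) * (Y + Y + 1) by nra.
apply: le_trans (ler_wpM2l P0 h) _.
have zM : (X + X + 1) * (Y + Y + 1) * z <= (X - Y) ^+ 2.
  rewrite /z mulrA ler_pdivrMr // mulrC ler_wpM2l ?sqr_ge0 //; nra.
nra.
Qed.

(** Sums over the fibres of [pmax], divided by their maxima, satisfy [sumset_prekopa] with
    [phi s = q (s + 1)]; the inequality of the means then bounds the product. Against the exact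
    value [m ^ 4] for constant functions the loss is [(1 + 3 / (2 m)) ^ 2]. *)
Lemma plp_pmax m : (0 < m)%N ->
  @plp R _ (fun s t : 'I_m * 'I_m => ((pmax s)%:R - (pmax t)%:R) ^+ 2 / (8 * m%:R ^+ 2))
    ((m%:R ^+ 2 + 3 / 2 * m%:R) ^+ 2).
Proof.
move=> m0 u v c u0 v0 c0 uv.
pose f x := \sum_(s | pmax s == x) u s; pose g y := \sum_(t | pmax t == y) v t.
have fu : \sum_s u s = \sum_x f x by rewrite (partition_big (@pmax m) predT).
have gv : \sum_s v s = \sum_x g x by rewrite (partition_big (@pmax m) predT).
have f0 x : 0 <= f x by apply: sumr_ge0.
have g0 x : 0 <= g x by apply: sumr_ge0.
have fg x y : f x * g y <= c * ((x + y).+1%:R) ^+ 2.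
  apply: le_trans (ler_wpM2l c0 (weight_ineq x y)).
  rewrite /f /g mulr_suml.
  apply: (@le_trans _ _ (\sum_(s | pmax s == x) \sum_(t | pmax t == y) c * expR ((x%:R - y%:R) ^+ 2 / (8 * m%:R ^+ 2)))).
    apply: ler_sum => s /eqP sx; rewrite mulr_sumr; apply: ler_sum => t /eqP ty.
    by have := uv s t; rewrite sx ty.
  have card z (a : R) : \sum_(s : 'I_m * 'I_m | pmax s == z) a = (z + z).+1%:R * a.
    rewrite -(card_pmax z) -sum1_card natr_sum mulr_suml.
    by apply: eq_big => [s|s _]; rewrite ?inE ?mul1r.
  rewrite card card; set e := expR _; set X := (x + x).+1%:R; set Y := (y + y).+1%:R; clearbody e X Y.
  by rewrite le_eqVlt; apply/orP; left; apply/eqP; ring.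
rewrite fu gv.
have i0 : 'I_m := Ordinal m0.
have [x0 _ fmax] := @arg_maxP _ _ _ i0 predT f isT.
have [y0 _ gmax] := @arg_maxP _ _ _ i0 predT g isT.
have rhs0 : 0 <= c * (m%:R ^+ 2 + 3 / 2 * m%:R) ^+ 2 by rewrite mulr_ge0 ?sqr_ge0.
have [fx0|fx0] := eqVneq (f x0) 0.
  rewrite (_ : \sum_x f x = 0) ?mul0r //; apply: big1 => x _; apply/eqP; rewrite eq_le f0 andbT -fx0.
  exact: fmax.
have [gy0|gy0] := eqVneq (g y0) 0.
  rewrite (_ : \sum_x g x = 0) ?mulr0 //; apply: big1 => x _; apply/eqP; rewrite eq_le g0 andbT -gy0.
  exact: gmax.
have {fx0} F0 : 0 < f x0 by rewrite lt0r fx0 f0.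
have {gy0} G0 : 0 < g y0 by rewrite lt0r gy0 g0.
set Mf := f x0 in F0 fmax *; set Mg := g y0 in G0 gmax *.
pose q := Num.sqrt (c / (Mf * Mg)).
have q0 : 0 <= q by apply: sqrtr_ge0.
have MM : 0 < Mf * Mg by apply: mulr_gt0.
have q2 : q ^+ 2 = c / (Mf * Mg) by rewrite sqr_sqrtr // divr_ge0 // ltW.
have hS : \sum_x f x / Mf + \sum_y g y / Mg - 1 <= \sum_(s < m + m) q * s.+1%:R.
  apply: (@sumset_prekopa R m (fun x => f x / Mf) (fun y => g y / Mg) (fun s => q * s.+1%:R) 1 x0 y0);
    rewrite ?divff ?gt_eqF //.
- by move=> x; rewrite divr_ge0 // ?(ltW F0) //= ler_pdivrMr // mul1r; apply: fmax.
- by move=> x; rewrite divr_ge0 // ?(ltW G0) //= ler_pdivrMr // mul1r; apply: gmax.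
- by move=> s; rewrite mulr_ge0.
- move=> x y; set a := f x / Mf; set b := g y / Mg.
  have a0 : 0 <= a by rewrite divr_ge0 // ltW.
  have b0 : 0 <= b by rewrite divr_ge0 // ltW.
  rewrite -(@ler_sqr _ (Num.min a b)) ?nnegrE ?le_min ?a0 ?b0 ?mulr_ge0 //.
  apply: (@le_trans _ _ (a * b)).
    by rewrite expr2 ler_pM ?le_min ?a0 ?b0 // ge_min lexx ?orbT.
  have e : a * b = f x * g y / (Mf * Mg) by rewrite /a /b; field; rewrite !gt_eqF.
  rewrite exprMn q2 e ler_pdivrMr // mulrAC divfK ?gt_eqF //; exact: fg.
move: hS; rewrite -!mulr_suml; set F := \sum_x f x; set G := \sum_x g x.
have -> : \sum_(s < m + m) q * s.+1%:R = q * (2 * m%:R ^+ 2 + m%:R).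
  rewrite -mulr_sumr; congr (_ * _).
  have gauss n : \sum_(s < n) s.+1%:R * 2 = n%:R * (n%:R + 1) :> R.
    elim: n => [|n IH]; first by rewrite big_ord0 mul0r.
    by rewrite big_ord_recr /= IH -!natr1; ring.
  have := gauss (m + m)%N; rewrite -mulr_suml natrD => h.
  by apply: (@mulIf _ 2) => //; rewrite h; ring.
move=> hS; have M0 : 0 < (m%:R : R) by rewrite ltr0n.
(* The hypothesis at the two maxima turns the 1 subtracted in [hS] into a term [2 m q] of lower
   order. *)
have q2m : 1 <= q * (2 * m%:R).
  have q2m0 : 0 <= q * (2 * m%:R) by rewrite mulr_ge0 // mulr_ge0 // ltW.
  rewrite -(@ler_sqr _ 1) ?nnegrE // expr1n exprMn q2 mulrAC ler_pdivlMr // mul1r.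
  apply: le_trans (fg x0 y0) _; rewrite ler_wpM2l // ler_sqr ?nnegrE ?mulr_ge0 //.
  rewrite -(natrM _ 2) ler_nat; have := ltn_ord x0; have := ltn_ord y0; clear; lia.
set a := F / Mf in hS *; set b := G / Mg in hS *.
have a0 : 0 <= a by rewrite divr_ge0 ?sumr_ge0 // ltW.
have b0 : 0 <= b by rewrite divr_ge0 ?sumr_ge0 // ltW.
have ab : a + b <= q * (2 * m%:R ^+ 2 + 3 * m%:R) by move: hS q2m; set M := m%:R; lra.
have ab2 : 4 * (a * b) <= q ^+ 2 * (2 * m%:R ^+ 2 + 3 * m%:R) ^+ 2.
  rewrite -exprMn; apply: (@le_trans _ _ ((a + b) ^+ 2)).
    rewrite -subr_ge0; have -> : (a + b) ^+ 2 - 4 * (a * b) = (a - b) ^+ 2 by ring.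
    exact: sqr_ge0.
  by rewrite ler_sqr ?nnegrE ?addr_ge0 // mulr_ge0 // addr_ge0 // mulr_ge0 // ltW // exprn_gt0.
have e : F * G = a * b * (Mf * Mg) by rewrite /a /b; field; rewrite !gt_eqF.
rewrite e; have {}q2 : q ^+ 2 * (Mf * Mg) = c by rewrite q2 divfK // gt_eqF.
rewrite -q2 [leRHS]mulrAC ler_pM2r //; move: ab2; set M := m%:R.
have -> : (2 * M ^+ 2 + 3 * M) ^+ 2 = 4 * (M ^+ 2 + 3 / 2 * M) ^+ 2 by field.
by rewrite [q ^+ 2 * (4 * _)]mulrCA ler_pM2l.
Qed.

Lemma plp_unit : @plp R unit (fun _ _ => 0) 1.
Proof.
move=> u v c u0 v0 c0 uv; have E (F : unit -> R) : \sum_s F s = F tt.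
  by rewrite (big_pred1 tt) // => -[].
by rewrite !E; have := uv tt tt; rewrite expR0.
Qed.

(** For fixed first coordinates, [p2] bounds the product of the inner sums with constant
    [c * expR (w1 x y)]; these sums then satisfy the hypothesis of [p1]. *)
Lemma plp_prod (T1 T2 : finType) w1 w2 B1 B2 : 0 <= B2 -> @plp R T1 w1 B1 -> @plp R T2 w2 B2 ->
  plp (fun s t : T1 * T2 => w1 s.1 t.1 + w2 s.2 t.2) (B1 * B2).
Proof.
move=> B20 p1 p2 u v c u0 v0 c0 uv.
have E (F : T1 * T2 -> R) : \sum_s F s = \sum_x \sum_y F (x, y).
  by rewrite pair_bigA /=; apply: eq_bigr => -[].
rewrite !E [B1 * B2]mulrC mulrA; apply: p1 => [x|x||x y].
- by apply: sumr_ge0.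
- by apply: sumr_ge0.
- by rewrite mulr_ge0.
- rewrite mulrAC; apply: p2 => // [|x' y']; first by rewrite mulr_ge0 ?expR_ge0.
  by rewrite -mulrA -expRD; apply: uv.
Qed.

Lemma plp_bij (T : finType) (f : T -> T) w B : bijective f -> @plp R T w B -> plp (fun s t => w s (f t)) B.
Proof.
move=> bf p u v c u0 v0 c0 uv; have [g fg gf] := bf.
rewrite [\sum_t v t](reindex g) /=; last by apply: onW_bij; exists f.
by apply: p => // s t; rewrite -{2}(gf t).
Qed.

End PLP.

(** * Moments *)

(** Nested pairs let products and moments be handled one coordinate at a time, by induction on
    [h]. *)
Fixpoint pow (T : finType) (h : nat) : finType :=
  if h is h'.+1 then (T * pow T h')%type : finType else (unit : finType).

Lemma card_pow (T : finType) h : #|pow T h| = (#|T| ^ h)%N.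
Proof. by elim: h => [|h IH] /=; rewrite ?card_unit ?expn0 // card_prod IH expnS. Qed.

Section Average.
Variable R : realType.
Implicit Types T : finType.

Fixpoint psum T (g : T -> T -> R) h : pow T h -> pow T h -> R :=
  match h return pow T h -> pow T h -> R with
  | 0 => fun _ _ => 0
  | h'.+1 => fun x y => g x.1 y.1 + psum g x.2 y.2
  end.

Lemma ler_psum T (g g' : T -> T -> R) h (x y : pow T h) :
  (forall a b, g a b <= g' a b) -> psum g x y <= psum g' x y.
Proof. by move=> gg; elim: h x y => //= h IH x y; apply: lerD. Qed.

Lemma plp_psum T (w : T -> T -> R) B h : 0 <= B -> plp w B -> plp (@psum T w h) (B ^+ h).
Proof.
move=> B0 p; elim: h => [|h IH]; first exact: plp_unit.
by rewrite exprS; apply: plp_prod => //; apply: exprn_ge0.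
Qed.

Definition av T (F : T -> T -> R) : R := (\sum_x \sum_y F x y) / #|T|%:R ^+ 2.

Lemma eq_av T (F F' : T -> T -> R) : (forall x y, F x y = F' x y) -> av F = av F'.
Proof. by move=> e; rewrite /av; congr (_ / _); apply: eq_bigr => x _; apply: eq_bigr. Qed.

Lemma avD T (F F' : T -> T -> R) : av (fun x y => F x y + F' x y) = av F + av F'.
Proof. by rewrite /av -mulrDl -big_split; congr (_ / _); apply: eq_bigr => x _; rewrite big_split. Qed.

Lemma avZ T a (F : T -> T -> R) : av (fun x y => a * F x y) = a * av F.
Proof. by rewrite /av mulrA mulr_sumr; congr (_ / _); apply: eq_bigr => x _; rewrite mulr_sumr. Qed.

Lemma ler_av T (F F' : T -> T -> R) : (forall x y, F x y <= F' x y) -> av F <= av F'.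
Proof.
by move=> le; rewrite ler_wpM2r ?invr_ge0 ?exprn_ge0 //; apply: ler_sum => x _; apply: ler_sum.
Qed.

Lemma av_cst T a : (0 < #|T|)%N -> @av T (fun _ _ => a) = a.
Proof.
move=> T0; rewrite /av !sumr_const -mulrnA -[a *+ _]mulr_natr natrM -expr2 mulfK //.
by rewrite expf_neq0 // pnatr_eq0 -lt0n.
Qed.

Lemma av_pow0 T (F : pow T 0 -> pow T 0 -> R) : av F = F tt tt.
Proof.
rewrite /av /= card_unit expr1n divr1 (big_pred1 tt) => [|[]//]; by rewrite (big_pred1 tt) => [|[]].
Qed.

Lemma av_prod T T' (F : T * T' -> T * T' -> R) :
  av F = av (fun a b => av (fun x y : T' => F (a, x) (b, y))).
Proof.
have E (H : T * T' -> R) : \sum_s H s = \sum_x \sum_y H (x, y).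
  by rewrite pair_bigA /=; apply: eq_bigr => -[].
rewrite /av card_prod natrM exprMn invfM mulrA mulrAC E; congr (_ / _); rewrite mulr_suml.
apply: eq_bigr => a _; rewrite (eq_bigr _ (fun x _ => E (F (a, x)))).
rewrite exchange_big mulr_suml; apply: eq_bigr => b _; by rewrite mulr_suml.
Qed.

Lemma avC T T' (F : T -> T -> T' -> T' -> R) :
  av (fun a b => av (F a b)) = av (fun x y => av (fun a b => F a b x y)).
Proof.
rewrite /av; under eq_bigr => a _ do rewrite -mulr_suml.
rewrite -mulr_suml mulrAC; under [in RHS]eq_bigr => a _ do rewrite -mulr_suml.
rewrite -mulr_suml; congr (_ / _ / _).
pose H (p : T * T) (q : T' * T') := F p.1 p.2 q.1 q.2.
transitivity (\sum_p \sum_q H p q).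
  rewrite -(pair_bigA _ (fun a b => \sum_q H (a, b) q)); apply: eq_bigr => a _; apply: eq_bigr => b _.
  by rewrite -(pair_bigA _ (fun x y => H (a, b) (x, y))).
rewrite exchange_big -(pair_bigA _ (fun x y => \sum_p H p (x, y))); apply: eq_bigr => x _; apply: eq_bigr => y _.
by rewrite -(pair_bigA _ (fun a b => H (a, b) (x, y))).
Qed.

Section Moments.
Variables (T : finType) (g : T -> T -> R) (B : R).
Hypotheses (T0 : (0 < #|T|)%N) (g0 : av g = 0) (gB : forall a b, `|g a b| <= B).
Let s2 := av (fun a b => g a b ^+ 2).
Let E h (F : R -> R) := av (fun x y : pow T h => F (psum g x y)).

Let cardp h : (0 < #|pow T h|)%N. Proof. by rewrite card_pow expn_gt0 T0. Qed.

Let EZ h c F : E h (fun z => c * F z) = c * E h F. Proof. exact: avZ. Qed.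
Let ED h F F' : E h (fun z => F z + F' z) = E h F + E h F'. Proof. exact: avD. Qed.
Let ES h F : E h.+1 F = av (fun a b => E h (fun z => F (g a b + z))).
Proof. by rewrite /E av_prod. Qed.
Let E1 h c : E h (fun _ => c) = c. Proof. by rewrite /E av_cst. Qed.

Lemma psum_mean h : E h (fun z => z) = 0.
Proof.
elim: h => [|h IH]; first by rewrite /E av_pow0.
rewrite ES -[RHS](@av_cst T 0) //.
transitivity (av g); last by rewrite g0 av_cst.
by apply: eq_av => a b; rewrite ED IH E1 addr0.
Qed.

Lemma psum_second h : E h (fun z => z ^+ 2) = h%:R * s2.
Proof.
elim: h => [|h IH]; first by rewrite /E av_pow0 /= expr0n mul0r.
rewrite ES; transitivity (av (fun a b => g a b ^+ 2 + E h (fun z => z ^+ 2))).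
  apply: eq_av => a b; rewrite -[X in X + _](E1 h) -ED.
  transitivity (E h (fun z => (g a b ^+ 2 + z ^+ 2) + 2 * g a b * z)).
    by apply: eq_av => x y; ring.
  by rewrite (ED h (fun z => g a b ^+ 2 + z ^+ 2)) (EZ h (2 * g a b)) psum_mean mulr0 addr0.
by rewrite avD av_cst // IH -natr1 mulrDl mul1r addrC.
Qed.

(** On expanding [(g + z) ^ 4], the term with [z] has mean 0 and the one with [z ^ 3] vanishes when
    [g] is averaged. The remaining terms give [3 h ^ 2 + 6 h + 1 <= 3 (h + 1) ^ 2]. *)
Lemma psum_fourth h : E h (fun z => z ^+ 4) <= 3 * h%:R ^+ 2 * B ^+ 4.
Proof.
have B0 : 0 <= B by case/card_gt0P: T0 => a _; apply: le_trans (gB a a).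
have gB2 a b : g a b ^+ 2 <= B ^+ 2 by rewrite -[_ ^+ 2]real_normK ?num_real // ler_sqr ?nnegrE.
have s2B : s2 <= B ^+ 2 by rewrite -(@av_cst T (B ^+ 2)) //; apply: ler_av.
have s20 : 0 <= s2 by rewrite -(@av_cst T 0) //; apply: ler_av => a b; apply: sqr_ge0.
elim: h => [|h IH]; first by rewrite /E av_pow0 /= !expr0n mulr0 mul0r.
rewrite ES; pose c := 4 * E h (fun z => z ^+ 3).
apply: (@le_trans _ _ (av (fun a b => (E h (fun z => z ^+ 4) + (6 * h%:R * s2 * B ^+ 2 + B ^+ 4)) + c * g a b))).
  apply: ler_av => a b.
  have -> : E h (fun z => (g a b + z) ^+ 4) = E h (fun z => z ^+ 4) + (4 * g a b * E h (fun z => z ^+ 3)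
     + (6 * g a b ^+ 2 * E h (fun z => z ^+ 2) + (4 * g a b ^+ 3 * E h (fun z => z) + g a b ^+ 4))).
    rewrite -!EZ -[X in _ + (_ + (_ + (_ + X)))](E1 h) -!ED; apply: eq_av => x y; ring.
  rewrite psum_mean psum_second /c.
  have := gB2 a b; have := sqr_ge0 (g a b); set e := g a b ^+ 2 => e0 eB.
  have -> : g a b ^+ 4 = e ^+ 2 by rewrite /e; ring.
  have h1 : e ^+ 2 <= B ^+ 4 by have -> : B ^+ 4 = (B ^+ 2) ^+ 2 by [ring]; rewrite ler_sqr ?nnegrE ?sqr_ge0.
  have h2 : (6 * (h%:R * s2)) * e <= (6 * (h%:R * s2)) * B ^+ 2 by rewrite ler_wpM2l // mulr_ge0 // mulr_ge0.
  by move: h1 h2; set w := E h _; set u := E h _; lra.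
rewrite avD av_cst // avZ g0 mulr0 addr0.
have h2 : 6 * h%:R * s2 * B ^+ 2 <= 6 * h%:R * B ^+ 4.
  have -> : B ^+ 4 = B ^+ 2 * B ^+ 2 by [ring]; rewrite mulrA ler_wpM2r ?sqr_ge0 // ler_wpM2l // mulr_ge0.
have B4 : 0 <= B ^+ 4 by apply: exprn_ge0.
by rewrite -natr1; move: IH h2 B4; set b := B ^+ 4; set x := h%:R; nra.
Qed.

Lemma psum_sym (f : T -> T) h (F : R -> R) : bijective f -> (forall a b, g (f a) b = - g a b) ->
  E h F = E h (fun z => F (- z)).
Proof.
move=> bf gf; elim: h F => [|h IH] F; first by rewrite /E !av_pow0 /= oppr0.
rewrite !ES (avC (fun a b x y => F (- (g a b + psum g x y)))).
transitivity (av (fun a b => E h (fun z => F (g a b - z)))).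
  by apply: eq_av => a b; rewrite (IH (fun z => F (g a b + z))).
rewrite (avC (fun a b x y => F (g a b - psum g x y))); apply: eq_av => x y.
rewrite /av; congr (_ / _); rewrite (reindex f) /=; last exact: onW_bij.
by apply: eq_bigr => a _; apply: eq_bigr => b _; rewrite gf opprD.
Qed.

(** A Paley-Zygmund argument: [z ^ 2] is at most [mu / 4 + z ^ 4 / (2 l)], plus [l / 2] when
    [theta < |z|]. With [l = K / mu] the fourth moment contributes at most [mu / 2], leaving
    [mu / 4] to the tails; the symmetry [f] makes the two tails equally likely. *)
Lemma psum_tail (f : T -> T) h (theta : R) : bijective f -> (forall a b, g (f a) b = - g a b) ->
  (0 < h)%N -> 0 < s2 -> 0 <= theta -> 4 * theta ^+ 2 <= h%:R * s2 ->
  s2 ^+ 2 / (12 * B ^+ 4) <= E h (fun z => (theta < z)%R%:R).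
Proof.
move=> bf gf h0 s20 th0 th; set p := E h _.
have B0 : 0 < B.
  rewrite lt0r; apply/andP; split; last by case/card_gt0P: T0 => a _; apply: le_trans (gB a a).
  apply/negP => /eqP B0; move: s20; rewrite ltNge => /negP; apply.
  rewrite -(@av_cst T 0) //; apply: ler_av => a b; have := gB a b; rewrite B0 normr_le0 => /eqP->.
  by rewrite expr0n.
pose mu := h%:R * s2; have mu0 : 0 < mu by rewrite mulr_gt0 // ltr0n.
pose K := 3 * h%:R ^+ 2 * B ^+ 4.
have hR : 0 < (h%:R : R) by rewrite ltr0n.
have K0 : 0 < K by rewrite !mulr_gt0 ?exprn_gt0.
pose l := K / mu; have l0 : 0 < l by rewrite divr_gt0.
have pt (z : R) : z ^+ 2 <= mu / 4 + (2 * l)^-1 * z ^+ 4 + (l / 2 * (theta < z)%R%:R + l / 2 * (theta < - z)%R%:R).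
  have z4 : 0 <= (2 * l)^-1 * z ^+ 4.
    by have -> : z ^+ 4 = (z ^+ 2) ^+ 2 by [ring]; rewrite mulr_ge0 ?sqr_ge0 // invr_ge0 ltW // mulr_gt0.
  have key : z ^+ 2 <= (2 * l)^-1 * z ^+ 4 + l / 2.
    rewrite -subr_ge0; have -> : (2 * l)^-1 * z ^+ 4 + l / 2 - z ^+ 2 = (2 * l)^-1 * (z ^+ 2 - l) ^+ 2.
      by field; rewrite gt_eqF.
    by rewrite mulr_ge0 ?sqr_ge0 // invr_ge0 ltW // mulr_gt0.
  have [z1|z1] := ltP theta z.
    by case: (theta < - z); rewrite ?mulr1 ?mulr0; move: key z4 mu0 l0; set w := _ * z ^+ 4; lra.
  have [z2|z2] := ltP theta (- z).
    by rewrite ?mulr1 ?mulr0; move: key z4 mu0 l0; set w := _ * z ^+ 4; lra.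
  have : z ^+ 2 <= theta ^+ 2.
    by rewrite -[_ ^+ 2]real_normK ?num_real // ler_sqr ?nnegrE // ler_norml; apply/andP; split; lra.
  by rewrite !mulr0; move: z4 th; rewrite -/mu; set w := _ * z ^+ 4; lra.
have : mu <= mu / 4 + (2 * l)^-1 * K + l * p.
  rewrite [leLHS](_ : mu = E h (fun z => z ^+ 2)); last by rewrite psum_second.
  apply: (@le_trans _ _ (E h (fun z => mu / 4 + (2 * l)^-1 * z ^+ 4 + (l / 2 * (theta < z)%R%:R + l / 2 * (theta < - z)%R%:R)))).
    by apply: ler_av => x y; apply: pt.
  rewrite !ED !EZ E1 -(psum_sym h (fun z => (theta < z)%R%:R) bf gf) -/p.
  have : (2 * l)^-1 * E h (fun z => z ^+ 4) <= (2 * l)^-1 * K.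
    by rewrite ler_wpM2l ?psum_fourth // invr_ge0 ltW // mulr_gt0.
  by set w := (2 * l)^-1 * E h _; set u := (2 * l)^-1 * K; lra.
have -> : (2 * l)^-1 * K = mu / 2 by rewrite /l; field; rewrite !gt_eqF.
move=> H; have {}H : mu / 4 <= l * p by lra.
have -> : s2 ^+ 2 / (12 * B ^+ 4) = mu / 4 / l by rewrite /l /K /mu; field; rewrite !gt_eqF.
by rewrite ler_pdivrMr // [leRHS]mulrC.
Qed.

End Moments.
End Average.

(** * The product space *)

Definition swap (T : Type) (x : T * T) := (x.2, x.1).

Lemma swap_bij T : bijective (@swap T).
Proof. by exists (@swap T) => -[]. Qed.

Section Odd.
Variable R : realType.

Lemma av_reindex (T : finType) (f : T -> T) (F : T -> T -> R) : bijective f ->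
  av F = av (fun a b => F a (f b)).
Proof.
move=> bf; rewrite /av; congr (_ / _); apply: eq_bigr => a _; rewrite (reindex f) //; exact: onW_bij.
Qed.

Lemma av_odd (T : finType) (f : T -> T) (F : T -> T -> R) : bijective f ->
  (forall a b, F a (f b) = - F a b) -> av F = 0.
Proof.
move=> bf odd; have : av F = -1 * av F; last by lra.
by rewrite {1}(av_reindex F bf) -avZ; apply: eq_av => a b; rewrite odd mulN1r.
Qed.
End Odd.

Section Space.
Variables (R : realType) (m : nat).
Let T := ('I_m * 'I_m)%type.
Let v (s : T) : R := (pmax s)%:R.

Definition pdiff (a : T * T) : R := v a.1 - v a.2.
Definition pdot (a b : T * T) : R := pdiff a * pdiff b.
(* The coordinates are crossed so that [pdiff a] and [- pdiff b] nearly agree when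
   [a] and [b] are close. *)
Definition pdist (a b : T * T) : R := (v a.1 - v b.2) ^+ 2 + (v a.2 - v b.1) ^+ 2.
Definition pvar : R := av (fun s t : T => (v s - v t) ^+ 2).

Lemma pmax_dist s t : `|v s - v t| <= m%:R.
Proof.
have L u : v u <= m%:R by rewrite ler_nat ltnW.
have P u : 0 <= v u by [].
by rewrite ler_norml; apply/andP; split; have := L s; have := L t; have := P s; have := P t; lra.
Qed.

Lemma sq_le_of_norm (x y : R) : `|x| <= y -> x ^+ 2 <= y ^+ 2.
Proof. by move=> xy; rewrite -[x ^+ 2]real_normK ?num_real // ler_sqr ?nnegrE // (le_trans _ xy). Qed.

(** With [P = pdiff a + pdiff b] and [Q = pdiff c + pdiff d] the left side is [P * Q]. The crossing
    makes [P] the sum of [a1 - b2] and [b1 - a2], so [pdist a b] is at least [P ^ 2 / 2], and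
    [pdist c d] is likewise at least [Q ^ 2 / 2]. *)
Lemma pdot_pdist a b c d :
  pdot a c + pdot a d + (pdot b c + pdot b d) <= pdist a b + pdist c d.
Proof.
rewrite /pdot /pdist /pdiff; set a1 := v a.1; set a2 := v a.2; set b1 := v b.1; set b2 := v b.2.
set c1 := v c.1; set c2 := v c.2; set d1 := v d.1; set d2 := v d.2.
rewrite -subr_ge0.
have -> : (a1 - b2) ^+ 2 + (a2 - b1) ^+ 2 + ((c1 - d2) ^+ 2 + (c2 - d1) ^+ 2) -
  ((a1 - a2) * (c1 - c2) + (a1 - a2) * (d1 - d2) + ((b1 - b2) * (c1 - c2) + (b1 - b2) * (d1 - d2))) =
  ((a1 - b2) - (b1 - a2)) ^+ 2 / 2 + ((c1 - d2) - (d1 - c2)) ^+ 2 / 2 +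
  (((a1 - a2) + (b1 - b2)) - ((c1 - c2) + (d1 - d2))) ^+ 2 / 2 by field.
by rewrite addr_ge0 ?addr_ge0 ?divr_ge0 ?sqr_ge0.
Qed.

Lemma pdot_le_pdist a c : pdot a c <= pdist a c.
Proof.
rewrite /pdot /pdist /pdiff; set a1 := v a.1; set a2 := v a.2; set c1 := v c.1; set c2 := v c.2.
rewrite -subr_ge0.
have -> : (a1 - c2) ^+ 2 + (a2 - c1) ^+ 2 - (a1 - a2) * (c1 - c2) =
  ((a1 - c2) + (a2 - c1)) ^+ 2 / 2 + (a1 - a2) ^+ 2 / 2 + (c1 - c2) ^+ 2 / 2 by field.
by rewrite addr_ge0 ?addr_ge0 ?divr_ge0 ?sqr_ge0.
Qed.

Lemma psum_pdot_pdist h (a b c d : pow (T * T)%type h) :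
  psum pdot a c + psum pdot a d + (psum pdot b c + psum pdot b d) <= psum pdist a b + psum pdist c d.
Proof.
elim: h a b c d => [|h IH] a b c d /=; first by rewrite !addr0.
by have := IH a.2 b.2 c.2 d.2; have := pdot_pdist a.1 b.1 c.1 d.1; lra.
Qed.

Lemma psum_symm (U : finType) (g : U -> U -> R) h (x y : pow U h) :
  (forall a b, g a b = g b a) -> psum g x y = psum g y x.
Proof. by move=> gC; elim: h x y => //= h IH x y; rewrite gC IH. Qed.

Lemma pdotC a b : pdot a b = pdot b a. Proof. exact: mulrC. Qed.

Lemma pdistC a b : pdist a b = pdist b a.
Proof. by rewrite /pdist addrC -sqrrN opprB; congr (_ + _); rewrite -sqrrN opprB. Qed.

Lemma plp_pdist h : (0 < m)%N ->
  plp (fun x y : pow (T * T)%type h => psum pdist x y / (8 * m%:R ^+ 2))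
    ((((m%:R ^+ 2 + 3 / 2 * m%:R) ^+ 2) ^+ 2) ^+ h).
Proof.
move=> m0; set B := (_ + _) ^+ 2; set B1 := B ^+ 2.
have p1 := plp_pmax (R := R) m0; have p2 := plp_prod (sqr_ge0 _) p1 p1.
have p3 := plp_bij (@swap_bij T) p2; rewrite -expr2 -/B -/B1 in p3.
have := @plp_psum R _ _ B1 h (sqr_ge0 _) p3.
move=> p u w c u0 w0 c0 uw; apply: (p u w c) => // s t; apply: le_trans (uw s t) _.
rewrite le_eqVlt; apply/orP; left; apply/eqP; congr (c * expR _).
elim: h s t {p u w u0 w0 uw} => [|h IH] s t /=; first by rewrite mul0r.
by rewrite mulrDl IH /pdist mulrDl.
Qed.

Hypothesis m4 : (4 <= m)%N.

Let m0 : (0 < m)%N. Proof. by apply: leq_trans m4. Qed.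
Let M0 : 0 < (m%:R : R). Proof. by rewrite ltr0n. Qed.
Let T0 : (0 < #|{: T}|)%N. Proof. by rewrite card_prod card_ord muln_gt0 m0. Qed.
Let TT0 : (0 < #|{: T * T}|)%N. Proof. by rewrite card_prod muln_gt0 T0. Qed.

(** With [k = m %/ 4], maxima below [k] and maxima from [2 k] on differ by at least [k >= m / 8].
    The first have frequency [k ^ 2 / m ^ 2], the second at least [3 / 4]. *)
Lemma pvar_ge : m%:R ^+ 2 / 8192 <= pvar.
Proof.
pose k := (m %/ 4)%N; have k4 : (4 * k <= m)%N by rewrite mulnC leq_trunc_div.
have k8 : (m <= 8 * k)%N.
  have k1 : (0 < k)%N by rewrite divn_gt0.
  have := divn_eq m 4; have := ltn_pmod m (isT : (0 < 4)%N); rewrite -/k; move: (m %% 4)%N => r.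
  by clear -k1; lia.
pose A := [set s : T | (pmax s < k)%N]%SET; pose C := [set s : T | (pmax s < 2 * k)%N]%SET.
have cA : #|A| = (k * k)%N by rewrite card_pmax_lt //; clear -k4; lia.
have cC : #|C| = (2 * k * (2 * k))%N by rewrite card_pmax_lt //; clear -k4; lia.
have cC' : #|(~: C)%SET|%:R = m%:R ^+ 2 - 4 * k%:R ^+ 2 :> R.
  have := cardsC C; rewrite cC card_prod card_ord => /(congr1 (fun x => x%:R : R)).
  by rewrite natrD !natrM => e; rewrite !expr2 -e; ring.
have L : (k%:R ^+ 2 * (m%:R ^+ 2 - 4 * k%:R ^+ 2)) * k%:R ^+ 2 <= \sum_(s : T) \sum_(t : T) (v s - v t) ^+ 2.
  have -> : (k%:R ^+ 2 * (m%:R ^+ 2 - 4 * k%:R ^+ 2)) * k%:R ^+ 2 = \sum_(s in A) \sum_(t in (~: C)%SET) k%:R ^+ 2 :> R.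
    by rewrite !sumr_const cA -mulrnA -[RHS]mulr_natr natrM cC' natrM; ring.
  rewrite big_mkcond; apply: ler_sum => s _; case: ifP => [|_]; last by apply: sumr_ge0 => t _; apply: sqr_ge0.
  rewrite inE => sk; rewrite big_mkcond; apply: ler_sum => t _; case: ifP => [|_]; last exact: sqr_ge0.
  rewrite !inE -leqNgt => tk; rewrite -[leRHS]sqrrN opprB ler_sqr ?nnegrE //; rewrite /v.
  + by rewrite lerBrDr -natrD ler_nat; move: sk tk; clear; lia.
  + by rewrite subr_ge0 ler_nat; move: sk tk; clear; lia.
rewrite /pvar /av ler_pdivlMr ?exprn_gt0 ?ltr0n //; apply: le_trans L.
rewrite card_prod card_ord natrM.
have h4 : 4 * k%:R <= m%:R :> R by rewrite -natrM ler_nat.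
have h8 : m%:R <= 8 * k%:R :> R by rewrite -natrM ler_nat.
move: h4 h8 M0; have : 0 <= (k%:R : R) by []; set x := k%:R; set M := m%:R; clearbody x M => x0 h4 h8 M0'.
have s8 : M ^+ 2 <= 64 * x ^+ 2 by nra.
have s4 : 16 * x ^+ 2 <= M ^+ 2 by nra.
have s0 : 0 <= M ^+ 2 by apply: sqr_ge0.
have e4 : M ^+ 2 * M ^+ 2 <= 4096 * (x ^+ 2 * x ^+ 2) by nra.
have -> : M ^+ 2 / 8192 * (M * M) ^+ 2 = M ^+ 2 * M ^+ 2 * (M ^+ 2 / 8192) by field.
have -> : x ^+ 2 * (M ^+ 2 - 4 * x ^+ 2) * x ^+ 2 = (x ^+ 2 * x ^+ 2) * (M ^+ 2 - 4 * x ^+ 2) by ring.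
have q0 : 0 <= M ^+ 2 / 8192 by lra.
have x4 : 0 <= x ^+ 2 * x ^+ 2 by apply: mulr_ge0; apply: sqr_ge0.
apply: le_trans (ler_wpM2r q0 e4) _; rewrite mulrAC [leRHS]mulrC; apply: ler_wpM2r => //; lra.
Qed.

Lemma pvar_gt0 : 0 < pvar.
Proof. by have := pvar_ge; have := exprn_gt0 2 M0; lra. Qed.

Lemma pvar_le : pvar <= m%:R ^+ 2.
Proof.
by rewrite -[leRHS](av_cst _ T0); apply: ler_av => s t; apply: sq_le_of_norm; apply: pmax_dist.
Qed.

Lemma av_pdot : av pdot = 0.
Proof. by apply: (av_odd (@swap_bij T)) => a b; rewrite /pdot /pdiff /=; ring. Qed.

Lemma pdot_le a b : `|pdot a b| <= m%:R ^+ 2.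
Proof.
by rewrite normrM expr2 ler_pM ?pmax_dist.
Qed.

Lemma av_pdot2 : av (fun a b => pdot a b ^+ 2) = pvar ^+ 2.
Proof.
have E : pvar = (\sum_a pdiff a ^+ 2) / #|{: T}|%:R ^+ 2.
  rewrite /pvar /av; congr (_ / _); rewrite (pair_bigA _ (fun s t => (v s - v t) ^+ 2)); exact: eq_bigr.
rewrite /av card_prod natrM E expr_div_n; congr (_ / _).
rewrite expr2 mulr_suml; apply: eq_bigr => a _; rewrite mulr_sumr; apply: eq_bigr => b _; by rewrite /pdot exprMn.
Qed.

Lemma av_pdist : av pdist = 2 * pvar.
Proof.
rewrite (av_reindex pdist (@swap_bij T)) av_prod.
transitivity (av (fun s t : T => (v s - v t) ^+ 2 + pvar)).
  apply: eq_av => s t; rewrite /pdist /= avD av_cst //.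
by rewrite avD av_cst // -/pvar; ring.
Qed.

Lemma pdot_tail h rho : (0 < h)%N -> 0 <= rho -> 4 * rho ^+ 2 <= h%:R * pvar ^+ 2 ->
  (pvar ^+ 2) ^+ 2 / (12 * (m%:R ^+ 2) ^+ 4) <= av (fun x y : pow (T * T)%type h => (rho < psum pdot x y)%R%:R).
Proof.
move=> h0 r0 r1; have v0 := pvar_gt0.
rewrite -av_pdot2 in r1 *.
apply: (@psum_tail _ _ pdot _ TT0 av_pdot pdot_le (@swap T)) => //; first exact: swap_bij.
- by move=> a b; rewrite /pdot /pdiff /= -mulNr opprB.
- by rewrite av_pdot2 exprn_gt0.
Qed.

(** Chebyshev: the mean of the distance is [2 h pvar], so a value up to [rho] deviates by at least
    half of it, and one coordinate deviates from its mean by at most [2 m ^ 2]. *)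
Lemma pdist_tail h rho : (0 < h)%N -> rho <= h%:R * pvar ->
  av (fun x y : pow (T * T)%type h => (psum pdist x y <= rho)%R%:R) <= 4 * (m%:R ^+ 2) ^+ 2 / (pvar ^+ 2 * h%:R).
Proof.
move=> h0 rh; have v0 := pvar_gt0.
have hR : 0 < (h%:R : R) by rewrite ltr0n.
pose g a b : R := pdist a b + - (2 * pvar).
have g0 : av g = 0 by rewrite avD av_pdist av_cst // subrr.
have gB a b : `|g a b| <= 2 * m%:R ^+ 2.
  have h1 := sq_le_of_norm (pmax_dist a.1 b.2); have h2 := sq_le_of_norm (pmax_dist a.2 b.1).
  rewrite ler_norml; apply/andP; split; rewrite /g /pdist; have := pvar_le; have := v0.
    by have := sqr_ge0 (v a.1 - v b.2); have := sqr_ge0 (v a.2 - v b.1); lra.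
  by lra.
have s2 : av (fun a b => g a b ^+ 2) <= (2 * m%:R ^+ 2) ^+ 2.
  by rewrite -[leRHS](av_cst _ TT0); apply: ler_av => a b; apply: sq_le_of_norm.
have E (x y : pow (T * T)%type h) : psum g x y = psum pdist x y - h%:R * (2 * pvar) :> R.
  elim: h x y {rh h0 hR} => [|k IH] x y /=; first by rewrite mul0r subr0.
  by rewrite IH /g -natr1; ring.
have hv : 0 < h%:R * pvar by rewrite mulr_gt0.
apply: (@le_trans _ _ (av (fun x y : pow (T * T)%type h => (h%:R * pvar) ^- 2 * psum g x y ^+ 2))).
  apply: ler_av => x y; case: (leP (psum pdist x y)) => [le|_]; last by rewrite mulr_ge0 ?sqr_ge0 // invr_ge0 sqr_ge0.
  rewrite mulrC ler_pdivlMr ?exprn_gt0 // mul1r -[leRHS]sqrrN ler_sqr ?nnegrE ?(ltW hv) // E; lra.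
rewrite avZ psum_second //.
have -> : 4 * (m%:R ^+ 2) ^+ 2 / (pvar ^+ 2 * h%:R) = (h%:R * pvar) ^- 2 * (h%:R * (2 * m%:R ^+ 2) ^+ 2) :> R.
  by field; rewrite !gt_eqF.
by rewrite ler_pM2l ?invr_gt0 ?exprn_gt0 // ler_pM2l.
Qed.

End Space.

(** * Counting four-cycles of aligned pairs *)

Section Quadruples.
Variables (R : realType) (X : finType).

Lemma cauchy_card (I : finType) (f : I -> R) : (\sum_i f i) ^+ 2 <= #|I|%:R * \sum_i f i ^+ 2.
Proof.
have : 0 <= \sum_i \sum_j (f i - f j) ^+ 2 by apply: sumr_ge0 => i _; apply: sumr_ge0 => j _; apply: sqr_ge0.
have -> : \sum_i \sum_j (f i - f j) ^+ 2 = 2 * (#|I|%:R * \sum_i f i ^+ 2 - (\sum_i f i) ^+ 2).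
  have e i : \sum_j (f i - f j) ^+ 2 = #|I|%:R * f i ^+ 2 + \sum_j f j ^+ 2 - 2 * f i * \sum_j f j.
    rewrite (eq_bigr (fun j => f i ^+ 2 + f j ^+ 2 - 2 * f i * f j)) => [|j _]; last by ring.
    by rewrite sumrB big_split /= sumr_const -mulr_sumr -(mulr_natl (f i ^+ 2)).
  under eq_bigr => i _ do rewrite e.
  by rewrite sumrB big_split /= -mulr_sumr sumr_const -mulr_suml -mulr_sumr -mulr_natl; ring.
lra.
Qed.

(** Two applications of Cauchy-Schwarz, to degrees and then to codegrees, give [p ^ 4 * N ^ 4]
    closed quadruples; each of the two pairs required to avoid [d] costs at most [q * N ^ 4]. *)
Lemma quadruples (e d : rel X) (p q : R) : 0 <= p -> (0 < #|X|)%N ->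
  p <= av (fun x y => (e x y)%:R) -> av (fun x y => (d x y)%:R) <= q ->
  (p ^+ 4 - 2 * q) * #|X|%:R ^+ 4 <=
  #|[set z : (X * X) * (X * X) | [&& e z.1.1 z.2.1, e z.1.1 z.2.2, e z.1.2 z.2.1, e z.1.2 z.2.2,
      ~~ d z.1.1 z.1.2 & ~~ d z.2.1 z.2.2]]%SET|%:R.
Proof.
move=> p0 X0 pe dq; set N : R := #|X|%:R; have N0 : 0 < N by rewrite ltr0n.
have {}pe : p * N ^+ 2 <= \sum_x \sum_y (e x y)%:R by move: pe; rewrite /av ler_pdivlMr ?exprn_gt0.
have {}dq : \sum_x \sum_y (d x y)%:R <= q * N ^+ 2 by move: dq; rewrite /av ler_pdivrMr ?exprn_gt0.
pose s (ab : X * X) : R := \sum_c (e ab.1 c)%:R * (e ab.2 c)%:R.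
have ss : \sum_ab s ab = \sum_c (\sum_a (e a c)%:R) ^+ 2.
  rewrite exchange_big; apply: eq_bigr => c _.
  rewrite expr2 mulr_suml -(pair_bigA _ (fun a b => (e a c)%:R * (e b c)%:R : R)); apply: eq_bigr => a _.
  by rewrite mulr_sumr.
have s1 : p ^+ 2 * N ^+ 4 <= N * \sum_ab s ab.
  rewrite ss; apply: le_trans (cauchy_card _); rewrite exchange_big /=.
  have -> : p ^+ 2 * N ^+ 4 = (p * N ^+ 2) ^+ 2 by ring.
  by rewrite ler_sqr ?nnegrE ?mulr_ge0 ?sqr_ge0 // (le_trans _ pe) // mulr_ge0 ?sqr_ge0.
pose C4 := \sum_ab s ab ^+ 2.
have c4 : p ^+ 4 * N ^+ 4 <= C4.
  have h1 : (\sum_ab s ab) ^+ 2 <= N ^+ 2 * C4 by have := cauchy_card s; rewrite card_prod natrM.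
  have h2 : (p ^+ 2 * N ^+ 4) ^+ 2 <= N ^+ 2 * (N ^+ 2 * C4).
    apply: (@le_trans _ _ ((N * \sum_ab s ab) ^+ 2)).
      by have a0 : 0 <= p ^+ 2 * N ^+ 4 by [rewrite mulr_ge0 ?exprn_ge0 ?(ltW N0)]; rewrite ler_sqr ?nnegrE ?(le_trans a0 s1).
    by rewrite exprMn ler_pM2l ?exprn_gt0.
  have : N ^+ 4 * (p ^+ 4 * N ^+ 4) <= N ^+ 4 * C4.
    have -> : N ^+ 4 * (p ^+ 4 * N ^+ 4) = (p ^+ 2 * N ^+ 4) ^+ 2 by ring.
    by have -> : N ^+ 4 * C4 = N ^+ 2 * (N ^+ 2 * C4) by ring.
  by rewrite ler_pM2l ?exprn_gt0.
pose E4 (z : (X * X) * (X * X)) := [&& e z.1.1 z.2.1, e z.1.1 z.2.2, e z.1.2 z.2.1 & e z.1.2 z.2.2].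
have C4E : C4 = \sum_z (E4 z)%:R.
  rewrite -(pair_bigA _ (fun ab cd => (E4 (ab, cd))%:R)); apply: eq_bigr => -[a b] _ /=.
  rewrite -(pair_bigA _ (fun c d => (E4 ((a, b), (c, d)))%:R)) expr2 mulr_suml; apply: eq_bigr => c _.
  rewrite mulr_sumr; apply: eq_bigr => c' _; rewrite /E4 /= -!natrM; congr (_%:R).
  by case: (e a c); case: (e a c'); case: (e b c); case: (e b c').
rewrite -sum1_card natr_sum big_mkcond /=.
apply: (@le_trans _ _ (\sum_z ((E4 z)%:R - ((d z.1.1 z.1.2)%:R + (d z.2.1 z.2.2)%:R)))); last first.
  apply: ler_sum => z _; rewrite inE.
  have -> : [&& e z.1.1 z.2.1, e z.1.1 z.2.2, e z.1.2 z.2.1, e z.1.2 z.2.2, ~~ d z.1.1 z.1.2 & ~~ d z.2.1 z.2.2] =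
    [&& E4 z, ~~ d z.1.1 z.1.2 & ~~ d z.2.1 z.2.2] by rewrite /E4 -!andbA.
  by case: (E4 z); case: (d _ _); case: (d _ _) => /=; lra.
rewrite sumrB -C4E big_split /=.
have D : \sum_(x : X * X) (d x.1 x.2)%:R <= q * N ^+ 2.
  by rewrite -(pair_bigA _ (fun a b => (d a b)%:R : R)).
have D1 : \sum_(z : (X * X) * (X * X)) (d z.1.1 z.1.2)%:R <= q * N ^+ 4.
  rewrite -(pair_bigA _ (fun ab cd : X * X => (d ab.1 ab.2)%:R : R)) /=.
  rewrite (eq_bigr (fun ab => (d ab.1 ab.2)%:R * (N * N))) => [|ab _]; last first.
    by rewrite sumr_const -[X in X = _]mulr_natr; congr (_ * _); rewrite -natrM -card_prod.
  rewrite -mulr_suml; have -> : q * N ^+ 4 = q * N ^+ 2 * (N * N) by ring.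
  by rewrite ler_wpM2r // mulr_ge0 // ltW.
have D2 : \sum_(z : (X * X) * (X * X)) (d z.2.1 z.2.2)%:R <= q * N ^+ 4.
  rewrite -(pair_bigA _ (fun ab cd : X * X => (d cd.1 cd.2)%:R : R)) /= exchange_big.
  rewrite (eq_bigr (fun ab => (d ab.1 ab.2)%:R * (N * N))) => [|ab _]; last first.
    by rewrite sumr_const -[X in X = _]mulr_natr; congr (_ * _); rewrite -natrM -card_prod.
  rewrite -mulr_suml; have -> : q * N ^+ 4 = q * N ^+ 2 * (N * N) by ring.
  by rewrite ler_wpM2r // mulr_ge0 // ltW.
by move: c4 D1 D2; rewrite mulrBl -[2 * q * _]mulrA; set w := q * _; lra.
Qed.
End Quadruples.

(** * Part (ii) *)

Definition space (h : nat) : finType := pow (('I_h * 'I_h) * ('I_h * 'I_h))%type h.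

Lemma card_space h : #|space h| = ((h ^ 4) ^ h)%N.
Proof. by rewrite /space card_pow !card_prod !card_ord; congr (_ ^ _)%N; lia. Qed.

Lemma space_gt0 h : (0 < #|space h|)%N.
Proof. by rewrite card_space; case: h => // h; rewrite expn_gt0. Qed.

Section Construction.
Variable R : realType.

(** An inner product has standard deviation [sqrt h * pvar], and [pvar] is at least [h ^ 2 / 8192];
    [rho] is half of the resulting bound. *)
Definition rho h : R := Num.sqrt h%:R * h%:R ^+ 2 / 16384.
Definition close h : rel (space h) := fun x y => psum (@pdist R h) x y <= rho h.
Definition aligned h : rel (space h) := fun x y => rho h < psum (@pdot R h) x y.

Lemma rho_ge0 h : 0 <= rho h.
Proof.
have : 0 <= Num.sqrt h%:R * h%:R ^+ 2 :> R by rewrite mulr_ge0 ?sqrtr_ge0 ?sqr_ge0.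
by rewrite /rho; lra.
Qed.

Lemma closeC h : symmetric (@close h).
Proof. by move=> x y; rewrite /close psum_symm //; apply: pdistC. Qed.

Lemma alignedC h : symmetric (@aligned h).
Proof. by move=> x y; rewrite /aligned psum_symm //; apply: pdotC. Qed.

Lemma close_aligned h (a b c d : space h) : close a b -> close c d ->
  ~~ [&& aligned a c, aligned a d, aligned b c & aligned b d].
Proof.
rewrite /close /aligned => ab cd; apply/negP => /and4P[ac ad bc bd].
by have := psum_pdot_pdist R a b c d; have := rho_ge0 h; lra.
Qed.

Lemma aligned_far h (a b : space h) : aligned a b -> ~~ close a b.
Proof.
rewrite /aligned /close -ltNge => lt; apply: (lt_le_trans lt); apply: ler_psum => s t; exact: pdot_le_pdist.
Qed.

Lemma rho_small h : (4 <= h)%N -> 4 * rho h ^+ 2 <= h%:R * pvar R h ^+ 2 /\ rho h <= h%:R * pvar R h.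
Proof.
move=> h4; have := pvar_ge R h4; rewrite /rho.
have x1 : 1 <= h%:R :> R by rewrite ler1n (leq_trans _ h4).
have sx : Num.sqrt h%:R ^+ 2 = h%:R :> R by rewrite sqr_sqrtr.
have s0 : 0 <= Num.sqrt h%:R :> R by apply: sqrtr_ge0.
have s1 : 1 <= Num.sqrt h%:R :> R by have := ler_wsqrtr x1; rewrite sqrtr1.
have key (s x w : R) : 1 <= x -> s ^+ 2 = x -> 1 <= s -> x ^+ 2 / 8192 <= w ->
    4 * (s * x ^+ 2 / 16384) ^+ 2 <= x * w ^+ 2 /\ s * x ^+ 2 / 16384 <= x * w.
  move=> {}x1 {}sx {}s1 xw.
  pose u := x ^+ 2 / 8192; have u0 : 0 <= u by have := sqr_ge0 x; rewrite /u; lra.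
  have -> : s * x ^+ 2 / 16384 = s * (u / 2) by rewrite /u; field.
  have sle : s <= x by rewrite -sx; nra.
  rewrite -/u in xw; clearbody u; split.
    have -> : 4 * (s * (u / 2)) ^+ 2 = x * u ^+ 2 by rewrite -sx; field.
    apply: ler_wpM2l; first by apply: le_trans x1.
    by rewrite ler_sqr ?nnegrE // (le_trans u0).
  by apply: ler_pM => //; lra.
exact: key.
Qed.

(** [plp_pdist] is applied to indicator functions: all distances from [A] to [B] exceed [rho], so
    [c = exp (- rho / (8 h ^ 2))] is admissible. The 6 comes from
    [(1 + 3 / (2 h)) ^ (4 h) <= e ^ 6]. *)
Lemma far_biclique h (A B : {set space h}) : (0 < h)%N ->
  (forall a b, a \in A -> b \in B -> ~~ close a b) ->
  #|A|%:R * #|B|%:R <= expR (6 - Num.sqrt h%:R / 16384 / 8) * #|space h|%:R ^+ 2 :> R.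
Proof.
move=> h0 AB; have x0 : 0 < h%:R :> R by rewrite ltr0n.
set k := Num.sqrt h%:R / 16384 / 8.
have Ek : rho h = k * (8 * h%:R ^+ 2) by rewrite /rho /k; move: (Num.sqrt (h%:R : R)) (h%:R ^+ 2 : R) => a b; field.
clearbody k.
have := @plp_pdist R h h h0 (fun s => (s \in A)%:R) (fun s => (s \in B)%:R) (expR (- k)).
have S (C : {set space h}) : \sum_s (s \in C)%:R = #|C|%:R :> R.
  by rewrite -sum1_card natr_sum [RHS]big_mkcond; apply: eq_bigr => s _; case: (s \in C).
rewrite !S => H; apply: le_trans (H _ _ _ _) _ => //.
  move=> s t; have [sA|_] := boolP (s \in A); last by rewrite mul0r mulr_ge0 ?expR_ge0.
  have [tB|_] := boolP (t \in B); last by rewrite mulr0 mulr_ge0 ?expR_ge0.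
  rewrite mulr1 -expRD; apply: (@le_trans _ _ (expR 0)); first by rewrite expR0.
  rewrite ler_expR addrC subr_ge0 ler_pdivlMr ?mulr_gt0 ?exprn_gt0 //.
  by have := AB s t sA tB; rewrite /close -ltNge => /ltW; rewrite Ek.
rewrite [6 - k]addrC expRD -[leRHS]mulrA ler_wpM2l ?expR_ge0 // card_space.
have -> : (((h ^ 4) ^ h)%N%:R : R) ^+ 2 = ((((h%:R : R) ^+ 2) ^+ 2) ^+ 2) ^+ h.
  by rewrite !natrX -!exprM; congr (_ ^+ _); lia.
have -> : (h%:R ^+ 2 + 3 / 2 * h%:R) ^+ 2 = (h%:R ^+ 2) ^+ 2 * (1 + 3 / 2 / h%:R) ^+ 2 :> R.
  by field; rewrite gt_eqF.
set z := 1 + _; set Y := (h%:R ^+ 2) ^+ 2; have -> : (Y * z ^+ 2) ^+ 2 = z ^+ 4 * Y ^+ 2 by ring.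
rewrite (exprMn h (z ^+ 4)) ler_wpM2r ?exprn_ge0 ?sqr_ge0 // -exprM.
apply: (@le_trans _ _ (expR (3 / 2 / h%:R) ^+ (4 * h))).
  by rewrite lerXn2r ?nnegrE ?expR_ge0 ?addr_ge0 ?divr_ge0 // expR_ge1Dx.
rewrite -expRM_natl ler_expR; rewrite -mulr_natr !natrM.
by rewrite le_eqVlt; apply/orP; left; apply/eqP; field; rewrite gt_eqF.
Qed.

End Construction.

Section Main.
Variable R : realType.

(** With the constant 16 the space, of size [h ^ (4 h)], has at most about [n ^ (1 / 4)] points, so
    every block runs through it many times. *)
Definition height n : nat := Num.truncn (ln n%:R / (16 * ln (ln n%:R)) : R).

Definition sparse_blowup n : sgraph 'I_n :=
  blowup (space_gt0 (height n)) (@closeC R _) (@alignedC R _) n.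

Lemma sparse_blowup_no_path n : ~ has_induced_monotone_path 7 (sparse_blowup n).
Proof. apply: blowup_no_path; exact: close_aligned. Qed.

Lemma ln_unbounded (K : R) : \forall n \near \oo, K <= ln n%:R.
Proof.
exists (Num.truncn (expR K)).+1 => // n /= Kn.
have h : expR K <= n%:R.
  by apply: le_trans (_ : _ <= (Num.truncn (expR K)).+1%:R) _; [rewrite ltW // truncnS_gt|rewrite ler_nat].
by rewrite -ler_expR lnK // posrE (lt_le_trans _ h) // expR_gt0.
Qed.

Record large (H n : nat) : Prop := Large {
  large_loglog : 1 <= ln (ln n%:R) :> R;
  large_log : 4 <= ln n%:R :> R;
  large_height : (H <= height n)%N;
  large_space : (4 * #|space (height n)| <= n)%N;
  large_n : (0 < n)%N;
  height_le : (height n)%:R * 16 <= ln n%:R :> R;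
  height_ge : (0 < height n)%N -> ln n%:R / ln (ln n%:R) <= 32 * (height n)%:R :> R }.

Lemma ln_le_sqrt (x : R) : 0 < x -> ln x <= 2 * Num.sqrt x.
Proof.
move=> x0; have s0 : 0 < Num.sqrt x by rewrite sqrtr_gt0.
have -> : ln x = ln (Num.sqrt x) + ln (Num.sqrt x) by rewrite -lnM ?posrE // -expr2 sqr_sqrtr // ltW.
by have := expR_ge1Dx (ln (Num.sqrt x)); rewrite lnK ?posrE //; lra.
Qed.

Lemma large_near H : \forall n \near \oo, large H n.
Proof.
have := ln_unbounded ((32 * H%:R + 32) ^+ 2 + expR 1 + 4); apply: filterS => n.
set L : R := ln n%:R => K.
have s0 : 0 <= (32 * H%:R + 32) ^+ 2 :> R by apply: sqr_ge0.
have e0 := @expR_gt0 R 1.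
have L4 : 4 <= L by lra. have L0 : 0 < L by lra.
have LL1 : 1 <= ln L by rewrite -(@expRK R 1) ler_ln ?posrE //; lra.
have n0 : (0 < n)%N.
  by case: n @L K s0 L4 L0 LL1 => //= _ _ L4; move: L4; rewrite ln0 // => h; exfalso; lra.
pose y := L / (16 * ln L); have y0 : 0 <= y by rewrite divr_ge0 //; lra.
have D0 : 0 < 16 * ln L by lra.
have hy : (height n)%:R <= y by rewrite truncn_le.
have hL : (height n)%:R * (16 * ln L) <= L by rewrite -ler_pdivlMr.
have h0 : 0 <= (height n)%:R :> R by [].
have hH : (H <= height n)%N.
  rewrite /height -/L -/y truncn_ge_nat // ler_pdivlMr //.
  have sL : 32 * H%:R + 32 <= Num.sqrt L.
    rewrite -(@ger0_norm _ (32 * H%:R + 32)); last by rewrite addr_ge0 ?mulr_ge0.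
    by rewrite -sqrtr_sqr ler_wsqrtr //; lra.
  have Lsq : Num.sqrt L ^+ 2 = L by rewrite sqr_sqrtr // ltW.
  have := ln_le_sqrt L0; have : 0 <= H%:R :> R by [].
  move=> x0 ll; rewrite -[leRHS]Lsq; apply: (@le_trans _ _ (H%:R * (16 * (2 * Num.sqrt L)))).
    by rewrite ler_wpM2l // ler_wpM2l.
  rewrite expr2 !mulrA ler_wpM2r ?sqrtr_ge0 //; lra.
split=> //.
- have [->|hpos] := posnP (height n).
    have : (4%:R : R) <= n%:R by rewrite -[leRHS]lnK ?posrE ?ltr0n // -/L; have := expR_ge1Dx L; lra.
    by rewrite ler_nat card_space.
  have hp : 0 < (height n)%:R :> R by rewrite ltr0n.
  rewrite -(ler_nat R) natrM card_space natrX.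
  have lh : ln (height n)%:R <= ln L by rewrite ler_ln ?posrE //; nra.
  have lh0 : 0 <= ln (height n)%:R :> R by rewrite ln_ge0 // ler1n.
  have -> : (height n ^ 4)%:R ^+ height n = expR ((4 * height n)%:R * ln (height n)%:R) :> R.
    by rewrite expRM_natl lnK ?posrE // natrX -exprM.
  have : expR ((4 * height n)%:R * ln (height n)%:R) <= expR (L / 4) :> R.
    rewrite ler_expR natrM; move: hL h0 lh lh0; move: (height n)%:R (ln _) (ln L) => a b c; nra.
  have h3 : 1 + 3 <= expR (3 * L / 4) by apply: le_trans (expR_ge1Dx _); lra.
  have e : n%:R = expR (3 * L / 4) * expR (L / 4) :> R.
    by rewrite -expRD -[LHS]lnK ?posrE ?ltr0n // -/L; congr expR; field.
  have := expR_gt0 (L / 4); rewrite e; move: (expR (_ * L / 4)) (expR (L / 4)) h3 => a b h3 b0 h.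
  by apply: le_trans (_ : 4 * b <= _); [rewrite ler_pM2l | rewrite ler_pM2r //; lra].
- by rewrite -/L; apply: le_trans hL; rewrite ler_wpM2l //; lra.
- move=> hpos; rewrite -/L.
  have h1 : 1 <= (height n)%:R :> R by rewrite ler1n.
  have : y < (height n).+1%:R by apply: truncnS_gt.
  have -> : L / ln L = y * 16 by rewrite /y; field; rewrite gt_eqF //; lra.
  by rewrite -natr1; lra.
Qed.
Lemma quads_many : exists p : R, 0 < p /\ exists H, forall h, (H <= h)%N ->
  p * #|space h|%:R ^+ 4 <= #|quads (@close R h) (@aligned R h)|%:R.
Proof.
have [c [c0 cv]] : exists c : R, 0 < c /\ forall h, (4 <= h)%N -> c * h%:R ^+ 2 <= pvar R h.
  by exists (8192^-1); split=> [|h /(pvar_ge R)]; [lra | rewrite mulrC].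
pose p := c ^+ 4 / 12; have p0 : 0 < p by rewrite divr_gt0 // exprn_gt0.
exists (p ^+ 4 / 2); split; first by rewrite divr_gt0 // exprn_gt0.
pose q := 4 / c ^+ 2; have q0 : 0 < q by rewrite divr_gt0 // exprn_gt0.
(* From this height on close pairs have density at most [p ^ 4 / 4], so the two exclusions in
   [quadruples] leave half of [p ^ 4]. *)
exists (maxn 4 (Num.truncn (4 * q / p ^+ 4)).+1) => h; rewrite geq_max => /andP[h4 hH].
have h0 : (0 < h)%N by apply: leq_trans h4.
have x0 : 0 < h%:R :> R by rewrite ltr0n.
have [r1 r2] := rho_small R h4.
have v0 : c * h%:R ^+ 2 <= pvar R h by apply: cv.
have cx : 0 < c * h%:R ^+ 2 by rewrite mulr_gt0 // exprn_gt0.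
have pv : 0 < pvar R h by apply: lt_le_trans v0.
have e1 : p <= av (fun x y : space h => (aligned R x y)%:R).
  apply: le_trans _ (pdot_tail h4 h0 (rho_ge0 R h) r1); rewrite ler_pdivlMr; last by rewrite mulr_gt0 // !exprn_gt0.
  have -> : p * (12 * (h%:R ^+ 2) ^+ 4) = (c * h%:R ^+ 2) ^+ 4 by rewrite /p; field.
  by rewrite -exprM lerXn2r ?nnegrE // ltW.
have d1 : av (fun x y : space h => (close R x y)%:R) <= q / h%:R.
  apply: le_trans (pdist_tail h4 h0 r2) _; rewrite ler_pdivrMr; last by rewrite mulr_gt0 // exprn_gt0.
  have -> : q / h%:R * (pvar R h ^+ 2 * h%:R) = 4 * (pvar R h / c) ^+ 2 by rewrite /q; field; rewrite !gt_eqF.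
  have pc : h%:R ^+ 2 <= pvar R h / c by rewrite ler_pdivlMr // mulrC.
  have x2 : 0 <= h%:R ^+ 2 :> R by apply: sqr_ge0.
  by rewrite ler_pM2l // ler_sqr ?nnegrE ?(le_trans x2 pc).
have := quadruples (ltW p0) (space_gt0 h) e1 d1; apply: le_trans.
apply: ler_wpM2r; first exact: exprn_ge0.
have : 4 * q / p ^+ 4 <= h%:R.
  by apply: le_trans (ltW (truncnS_gt _)) _; rewrite ler_nat.
rewrite ler_pdivrMr ?exprn_gt0 // => H4.
have : q / h%:R <= p ^+ 4 / 4 by rewrite ler_pdivrMr //; lra.
lra.
Qed.

Lemma bin4_le n : ('C(n, 4) <= n ^ 4)%N.
Proof.
have F k : (n ^_ k <= n ^ k)%N by elim: k => // k IH; rewrite ffactnSr expnSr leq_mul // leq_subr.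
by apply: leq_trans (F 4); rewrite -bin_ffact leq_pmulr.
Qed.

Lemma mult_bounds N n : (0 < N)%N -> (4 * N <= n)%N -> let b := (n %/ (4 * N))%N in
  [/\ (0 < b)%N, (4 * (N * b) <= n)%N & (n <= 8 * (N * b))%N].
Proof.
move=> N0 Nn b; have N4 : (0 < 4 * N)%N by rewrite muln_gt0.
have b0 : (0 < b)%N by rewrite divn_gt0.
have := divn_eq n (4 * N); have := ltn_pmod n N4; rewrite -/b; move: (n %% _)%N => r rN e.
by split=> //; [rewrite e; clear; nia|rewrite e; move: rN b0; clear; nia].
Qed.

Lemma density_near : exists eta : R, 0 < eta /\
  \forall n \near \oo, eta <= clique_density R 4 (compl (sparse_blowup n)).
Proof.
have [p [p0 [H hH]]] := quads_many; exists (p / 8 ^+ 4); split; first by rewrite divr_gt0 // exprn_gt0.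
apply: filterS (large_near H) => n ln; have Q := hH _ (large_height ln).
have [b0 b4 b8] := mult_bounds (space_gt0 _) (large_space ln).
have := @blowup_cliques _ _ _ (space_gt0 (height n)) (@closeC R _) (@alignedC R _) n.
rewrite /clique_density card_ord -(ler_nat R) => C.
have n4 : (4 <= n)%N.
  by apply: leq_trans (large_space ln); rewrite leq_pmulr // space_gt0.
rewrite ler_pdivlMr ?ltr0n ?bin_gt0 //; apply: le_trans C; rewrite natrM natrX.
set N := #|space _| in b4 b8 Q *; rewrite -[mult _ n]/(n %/ (4 * N))%N; set b := (n %/ _)%N in b0 b4 b8 *.
apply: (@le_trans _ _ (p * N%:R ^+ 4 * b%:R ^+ 4)); last by rewrite ler_wpM2r ?exprn_ge0.
apply: (@le_trans _ _ (p / 8 ^+ 4 * (8 * (N * b))%:R ^+ 4)).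
  rewrite ler_wpM2l ?divr_ge0 ?exprn_ge0 ?(ltW p0) // -natrX ler_nat (leq_trans (bin4_le n)) //.
  by rewrite leq_exp2r.
by rewrite !natrM le_eqVlt; apply/orP; left; apply/eqP; field.
Qed.

Lemma biclique_near (phi : nat -> R) :
  phi =o_\oo (fun n : nat => Num.sqrt (ln n%:R / ln (ln n%:R)) : R) ->
  \forall n \near \oo, ~ contains_copy (compl (sparse_blowup n)) (biclique (Num.truncn (n%:R / expR (phi n)))).
Proof.
have [k [k0 k1 far]] : exists k : R, [/\ 0 < k, k <= 1 & forall h (A B : {set space h}), (0 < h)%N ->
    (forall a b, a \in A -> b \in B -> ~~ close R a b) ->
    #|A|%:R * #|B|%:R <= expR (6 - Num.sqrt h%:R * k) * #|space h|%:R ^+ 2 :> R].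
  exists (16384^-1 / 8); split; [lra|lra|move=> h A B h0 AB; rewrite [Num.sqrt _ * _]mulrA; exact: far_biclique].
have e0 : 0 < k / 24 by rewrite divr_gt0.
move=> /eqoP/(_ _ e0) small0.
near=> n.
have : large (Num.truncn ((18 / k) ^+ 2)).+1 n by near: n; apply: large_near.
have : `|phi n| <= k / 24 * `|Num.sqrt (ln n%:R / ln (ln n%:R)) : R| by near: n.
move=> small lg; have [LL1 L4 hH Nn n0 hle hge] := lg.
set L := ln n%:R in small LL1 L4 hle hge; set h := height n in hH Nn hle hge.
have h0 : (0 < h)%N by apply: leq_trans hH.
set s := Num.sqrt (h%:R : R).
have s2 : s ^+ 2 = h%:R by rewrite sqr_sqrtr.
have s0 : 0 <= s by apply: sqrtr_ge0.
have s1 : 1 <= s by rewrite -(@ler_sqr _ 1) ?nnegrE // s2 expr1n ler1n.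
have phile : phi n <= k / 4 * s.
  apply: le_trans (ler_norm _) _; apply: le_trans small _.
  have -> : k / 4 * s = k / 24 * (6 * s) by field.
  rewrite ler_wpM2l ?(ltW e0) // ger0_norm ?sqrtr_ge0 //.
  have {1}-> : 6 * s = Num.sqrt ((6 * s) ^+ 2) by rewrite sqrtr_sqr ger0_norm // mulr_ge0.
  rewrite ler_wsqrtr //; apply: le_trans (hge h0) _; rewrite exprMn s2.
  by rewrite ler_wpM2r //; lra.
(* The final comparison of exponents reads [s * k <= 9 + 2 * phi n <= 9 + s * k / 2], which fails
   beyond 18. *)
have big : 18 < s * k.
  rewrite -ltr_pdivrMr // -(@ltr_sqr _ (18 / k)) ?nnegrE ?divr_ge0 ?(ltW k0) // s2.
  by apply: lt_le_trans (truncnS_gt _) _; rewrite ler_nat.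
set x := n%:R / expR (phi n); have n0R : 0 < n%:R :> R by rewrite ltr0n.
have x1 : 1 <= x.
  rewrite ler_pdivlMr ?expR_gt0 // mul1r -[leRHS]lnK ?posrE // ler_expR -/L.
  by apply: le_trans phile _; nra.
have t0 : (0 < Num.truncn x)%N by rewrite truncn_gt0.
have xt : x <= 2 * (Num.truncn x)%:R.
  have := truncnS_gt x; rewrite -natr1; have : 1 <= (Num.truncn x)%:R :> R by rewrite ler1n.
  by lra.
have [b0 b4 b8] := mult_bounds (space_gt0 _) Nn.
move=> /blowup_biclique[||//|A [B [tA tB AB]]]; first exact: aligned_far.
  exact: b0.
have := far h A B h0 AB; rewrite -/s.
set N := #|space h| in b0 b4 b8 *; rewrite -[mult _ n]/(n %/ (4 * N))%N in tA tB; set b := (n %/ _)%N in b0 b4 b8 tA tB.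
set E := expR _ => AB2.
have tA' : (Num.truncn x)%:R <= 4 * (#|A|%:R * b%:R) :> R by rewrite -!natrM ler_nat.
have tB' : (Num.truncn x)%:R <= 4 * (#|B|%:R * b%:R) :> R by rewrite -!natrM ler_nat.
have b4' : 4 * (N%:R * b%:R) <= n%:R :> R by rewrite -!natrM ler_nat.
(* The 4 is the price of truncating [x]; the factors 4 lost to the choice of blocks are absorbed by
   [4 * (N * b) <= n]. *)
have xx : x ^+ 2 <= 4 * (E * n%:R ^+ 2).
  have t0' : 0 <= (Num.truncn x)%:R :> R by [].
  apply: (@le_trans _ _ (4 * ((4 * (#|A|%:R * b%:R)) * (4 * (#|B|%:R * b%:R))))).
    apply: (@le_trans _ _ ((2 * (Num.truncn x)%:R) ^+ 2)); first by rewrite lerXn2r ?nnegrE ?mulr_ge0 // (le_trans _ x1).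
    by rewrite exprMn -natrX ler_wpM2l // expr2 ler_pM.
  rewrite ler_pM2l //; apply: (@le_trans _ _ (E * (4 * (N%:R * b%:R)) ^+ 2)).
    have -> : 4 * (#|A|%:R * b%:R) * (4 * (#|B|%:R * b%:R)) = 16 * b%:R ^+ 2 * (#|A|%:R * #|B|%:R) :> R by ring.
    have -> : E * (4 * (N%:R * b%:R)) ^+ 2 = 16 * b%:R ^+ 2 * (E * N%:R ^+ 2) by ring.
    by rewrite ler_wpM2l // mulr_ge0 ?exprn_ge0.
  by rewrite ler_wpM2l ?expR_ge0 // lerXn2r ?nnegrE ?mulr_ge0.
have e4 : 4 <= expR 3 :> R by apply: le_trans (expR_ge1Dx _); lra.
have : expR (- (2 * phi n)) <= expR (3 + (6 - s * k)).
  rewrite expRD -/E -(ler_pM2r (exprn_gt0 2 n0R)).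
  apply: (@le_trans _ _ (x ^+ 2)).
    rewrite /x exprMn mulrC -expRN -expRM_natl; rewrite le_eqVlt; apply/orP; left; apply/eqP.
    by congr (_ * expR _); ring.
  by apply: le_trans xx _; rewrite -mulrA ler_wpM2r // mulr_ge0 ?expR_ge0 ?exprn_ge0.
by rewrite ler_expR; move: phile big; clear; nra.
Unshelve. all: by end_near.
Qed.

Lemma part_ii : exists eta : R, 0 < eta /\
     exists G : forall n : nat, sgraph 'I_n,
       (\forall n \near \oo,
          ~ has_induced_monotone_path 7 (G n) /\
          eta <= clique_density R 4 (compl (G n))) /\
       (forall phi : nat -> R,
          phi =o_\oo (fun n : nat => Num.sqrt (ln n%:R / ln (ln n%:R)) : R) ->
          \forall n \near \oo,
            ~ contains_copy (compl (G n))
                (biclique (Num.truncn (n%:R / expR (phi n))))).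
Proof.
have [eta [eta0 dens]] := density_near; exists eta; split=> //; exists sparse_blowup; split.
  by apply: filterS dens => n; split=> //; apply: sparse_blowup_no_path.
exact: biclique_near.
Qed.

End Main.

Theorem theorem1p3 (R : realType) :
  (forall eps : R, 0 < eps ->
     exists c : R, 0 < c /\
       forall (n : nat) (d : Order.disp_t) (V : finOrderType d) (G : sgraph V),
         #|V| = n ->
         ~ has_induced_monotone_path 7 G ->
         eps < clique_density R 5 (compl G) ->
         contains_copy (compl G)
           (biclique (Num.truncn (c * n%:R / ln n%:R))))
  /\
  (exists eta : R, 0 < eta /\
     exists G : forall n : nat, sgraph 'I_n,
       (\forall n \near \oo,
          ~ has_induced_monotone_path 7 (G n) /\
          eta <= clique_density R 4 (compl (G n))) /\
       (forall phi : nat -> R,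
          phi =o_\oo (fun n : nat => Num.sqrt (ln n%:R / ln (ln n%:R)) : R) ->
          \forall n \near \oo,
            ~ contains_copy (compl (G n))
                (biclique (Num.truncn (n%:R / expR (phi n)))))).
Proof. by split; [apply: part_i|apply: part_ii]. Qed.
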